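(* Let $(X,\sigma)$ be a braided set with $\sigma$ idempotent, and let $M$ be a linear bimodule over $(X,\sigma)$, regarded also as a bimodule over the structure monoid $\mathbf{M}(X,\sigma)$. Then the quantum symmetrizer induces quasi-isomorphisms between the critical (co)chain complex for $(X,\sigma)$ and the Hochschild (co)chain complex for $\mathbf{M}(X,\sigma)$, both with coefficients in $M$: $$\mathcal{QS}_k\colon CrC_k(X,\sigma;M)\to HC_k(\mathbf{M}(X,\sigma);M),\qquad \mathcal{QS}_*^k\colon HC^k(\mathbf{M}(X,\sigma);M)\to CrC^k(X,\sigma;M),\qquad k\ge 0.$$ If moreover $(X,\sigma)$ admits a pseudo-unit $1$ acting on $M$ trivially (that is, $m\cdot 1=1\cdot m=m$ for all $m\in M$), then the reduced quantum symmetrizer induces quasi-isomorphisms between the critical (co)chain complexes for $(X,\sigma,1)$ and the (normalized) Hochschild (co)chain complexes of the reduced structure monoid $\overline{\mathbf{M}}(X,\sigma,1)$: $$\overline{\mathcal{QS}}_k\colon CrC_k(X,\sigma,1;M)\to HC_k(\overline{\mathbf{M}}(X,\sigma,1);M),\qquad \overline{\mathcal{QS}}_*^k\colon HC^k(\overline{\mathbf{M}}(X,\sigma,1);M)\to CrC^k(X,\sigma,1;M),\qquad k\ge 0.$$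
   Context: **Braided sets.** A braided set $(X,\sigma)$ is a set $X$ with a (not necessarily invertible) map $\sigma\colon X^{\times 2}\to X^{\times 2}$ satisfying $(\sigma\times \mathrm{Id})(\mathrm{Id}\times\sigma)(\sigma\times \mathrm{Id})=(\mathrm{Id}\times\sigma)(\sigma\times \mathrm{Id})(\mathrm{Id}\times\sigma)$ on $X^{\times 3}$. It is idempotent if $\sigma\sigma=\sigma$. Let $b_i$ ($1\le i\le k-1$) act on $X^{\times k}$ by $\mathrm{Id}^{\times(i-1)}\times\sigma\times \mathrm{Id}^{\times(k-i-1)}$; this is an action of the positive braid monoid $B_k^+$. In products, the rightmost factor acts first. $X^*$ is the set of words in $X$; words of length $k$ are identified with elements of $X^{\times k}$. For $s\in S_k$ with a shortest expression $s=s_{i_1}\cdots s_{i_t}$ in the adjacent transpositions $s_i=(i\;i+1)$, put $T_s=b_{i_1}\cdots b_{i_t}$ and $|s|=t$. **Structure monoid.** $\mathbf{M}(X,\sigma)$ is the monoid generated by $X$ with relations $xy=y'x'$ whenever $\sigma(x,y)=(y',x')$, $x,y\in X$. **Pseudo-units.** A word $x_1\ldots x_k\in X^*$ is normal if $\sigma(x_j,x_{j+1})=(x_j,x_{j+1})$ for all $1\le j<k$. A pseudo-unit of an idempotent braided set $(X,\sigma)$ is an element $1\in X$ such that (1) $\sigma(1,x)$ and $\sigma(x,1)$ lie in $\{(1,x),(x,1)\}$ for all $x\in X$; (2) a normal word with any occurrence of the letter $1$ omitted remains normal. The reduced structure monoid $\overline{\mathbf{M}}(X,\sigma,1)$ is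 the quotient of $\mathbf{M}(X,\sigma)$ obtained by identifying the letter $1$ with the empty word. **Bimodules.** A linear bimodule over $(X,\sigma)$ is an abelian group $M$ with maps $M\times X\to M$, $(m,x)\mapsto m\cdot x$ and $X\times M\to M$, $(x,m)\mapsto x\cdot m$, additive in $m$, such that $(m\cdot x)\cdot y=(m\cdot y')\cdot x'$ and $x\cdot(y\cdot m)=y'\cdot(x'\cdot m)$ whenever $\sigma(x,y)=(y',x')$, and $(x\cdot m)\cdot y=x\cdot(m\cdot y)$. The actions extend to actions of $\mathbf{M}(X,\sigma)$ (and of $\overline{\mathbf{M}}(X,\sigma,1)$ if $1$ acts trivially). **Braided complexes.** On $C_k=M\otimes_{\mathbb Z}\mathbb ZX^{\times k}$, $k\ge0$, the differential is $d_k=\sum_{i=1}^k(-1)^{i-1}(d^l_{k;i}-d^r_{k;i})$ ($d_0=0$), with $d^l_{k;i}(m,x_1,\ldots,x_k)=(m\cdot x'_i,x'_1,\ldots,x'_{i-1},x_{i+1},\ldots,x_k)$, where $x'_ix'_1\ldots x'_{i-1}=b_1\cdots b_{i-1}(x_1\ldots x_i)$, and $d^r_{k;i}(m,x_1,\ldots,x_k)=(x''_i\cdot m,x_1,\ldots,x_{i-1},x''_{i+1},\ldots,x''_k)$, where $x''_{i+1}\ldots x''_kx''_i=b_{k-i}\cdots b_1(x_i\ldots x_k)$. On $C^k=\mathrm{Map}(X^{\times k},M)$ (with $C^0=M$) the differential is $d^k=\sum_{i=1}^k(-1)^{i-1}(d_l^{k;i}-d_r^{k;i})\colon C^{k-1}\to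 C^k$, with $(d_l^{k;i}f)(x_1,\ldots,x_k)=x'_i\cdot f(x'_1,\ldots,x'_{i-1},x_{i+1},\ldots,x_k)$ and $(d_r^{k;i}f)(x_1,\ldots,x_k)=f(x_1,\ldots,x_{i-1},x''_{i+1},\ldots,x''_k)\cdot x''_i$. **Critical complexes.** Let $\mathbb Z\langle X\rangle=\bigoplus_{k\ge0}\mathbb ZX^{\times k}$ with concatenation product, and let $R_-\subseteq\mathbb ZX^{\times 2}$ be the subgroup generated by pairs with $\sigma(x,y)=(x,y)$. Let $T_k(X;R_-)$ be the degree $k$ part of the two-sided ideal generated by $R_-$, and $T_k(X,\sigma,1)$ the degree $k$ part of the two-sided ideal generated by $R_-$ and the letter $1\in X$. The critical complexes are the quotients $CrC_k(X,\sigma;M)=(M\otimes\mathbb ZX^{\times k})/(M\otimes T_k(X;R_-))$, $CrC_k(X,\sigma,1;M)=(M\otimes\mathbb ZX^{\times k})/(M\otimes T_k(X,\sigma,1))$, and the subcomplexes $CrC^k(X,\sigma;M)$, resp. $CrC^k(X,\sigma,1;M)$, of $\mathrm{Map}(X^{\times k},M)$ formed by the maps whose linearization vanishes on $T_k(X;R_-)$, resp. $T_k(X,\sigma,1)$, with the induced differentials. **Hochschild complexes.** For a monoid $S$ and a linear $S$-bimodule $M$: $HC_k(S;M)=M\otimes\mathbb ZS^{\times k}$ with differential $(m,s_1,\ldots,s_k)\mapsto(m\cdot s_1,s_2,\ldots,s_k)+\sum_{i=1}^{k-1}(-1)^i(m,\ldots,s_is_{i+1},\ldots)+(-1)^k(s_k\cdot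 m,s_1,\ldots,s_{k-1})$, and $HC^k(S;M)=\mathrm{Map}(S^{\times k},M)$ with $(df)(s_1,\ldots,s_k)=s_1\cdot f(s_2,\ldots,s_k)+\sum_{i=1}^{k-1}(-1)^if(\ldots,s_is_{i+1},\ldots)+(-1)^kf(s_1,\ldots,s_{k-1})\cdot s_k$. The normalized versions are the quotient by tuples with some $s_i$ equal to the unit, resp. the subcomplex of maps vanishing on such tuples. **Quantum symmetrizers.** $\mathcal{QS}_k\colon\mathbb ZX^{\times k}\to\mathbb Z\mathbf{M}(X,\sigma)^{\times k}$ is the map $\sum_{s\in S_k}(-1)^{|s|}T_s$ on $\mathbb ZX^{\times k}$ followed by the map $\mathbb ZX^{\times k}\to\mathbb Z\mathbf{M}(X,\sigma)^{\times k}$ sending letters to generators. The reduced quantum symmetrizer $\overline{\mathcal{QS}}_k$ is $\mathcal{QS}_k$ followed by the projection $\mathbb Z\mathbf{M}(X,\sigma)^{\times k}\to\mathbb Z\overline{\mathbf{M}}(X,\sigma,1)^{\times k}$ and by the map sending all $k$-tuples containing at least one empty word (unit) to $0$. On chains they act as $\mathrm{Id}_M\otimes\mathcal{QS}_k$, $\mathrm{Id}_M\otimes\overline{\mathcal{QS}}_k$; on cochains, $\mathcal{QS}_*^k$ and $\overline{\mathcal{QS}}_*^k$ are precomposition with them. *)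

(* Defs.v *)
From HB Require Import structures.
From mathcomp Require Import all_boot all_algebra perm.
From mathcomp Require Import boolp classical_sets functions.
From mathcomp Require Import finmap.
From mathcomp.multinomials Require Import monalg.

Set Implicit Arguments.
Unset Strict Implicit.
Unset Printing Implicit Defensive.

Import GRing.Theory.

Local Open Scope classical_set_scope.
Local Open Scope ring_scope.
Local Open Scope quotient_scope.

Section Subgroups.
Context {V : zmodType}.

Definition subgroup (A : set V) : Prop :=
  A 0 /\ forall x y, A x -> A y -> A (x - y).

Definition gen_subgroup (G : set V) : {pred V} :=
  [pred x | `[< smallest subgroup G x >]].

Lemma gen_subgroup_zmod_closed (G : set V) : zmod_closed (gen_subgroup G).
Proof.
split=> [|x y]; first by apply/asboolP => A [[A0 _] _].
move=> /asboolP Gx /asboolP Gy; apply/asboolP => A AG.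
by have [[_ AB] _] := AG; apply: AB; [exact: Gx|exact: Gy].
Qed.
HB.instance Definition _ (G : set V) :=
  GRing.isZmodClosed.Build V (gen_subgroup G) (gen_subgroup_zmod_closed G).

Record subgrp (P : zmodClosed V) := SubGrp {
  subgrp_val :> V; _ : subgrp_val \in P }.

Section SubgrpInstances.
Variable P : zmodClosed V.
HB.instance Definition _ := [isSub for @subgrp_val P].
HB.instance Definition _ := [Choice of subgrp P by <:].
HB.instance Definition _ := [SubChoice_isSubZmodule of subgrp P by <:].
End SubgrpInstances.

End Subgroups.

Section Homology.
Context {A B C : zmodType} (f : {additive A -> B}) (g : {additive B -> C}).

Definition ker_pred : {pred B} := [pred x | g x == 0].
Lemma ker_pred_zmod_closed : zmod_closed ker_pred.
Proof.
split=> [|x y]; rewrite !inE ?raddf0 // => /eqP gx /eqP gy.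
by rewrite raddfB gx gy subr0.
Qed.
HB.instance Definition _ :=
  GRing.isZmodClosed.Build B ker_pred ker_pred_zmod_closed.

Definition im_pred : {pred subgrp ker_pred} :=
  [pred z | `[< exists a, f a = val z >]].
Lemma im_pred_zmod_closed : zmod_closed im_pred.
Proof.
split=> [|x y]; rewrite !inE.
  by apply/asboolP; exists 0; rewrite !raddf0.
move=> /asboolP[a fa] /asboolP[b fb]; apply/asboolP.
by exists (a - b); rewrite !raddfB fa fb.
Qed.
HB.instance Definition _ :=
  GRing.isZmodClosed.Build _ im_pred im_pred_zmod_closed.

(* ker g / (ker g :&: im f); this is ker g / im f as soon as g \o f = 0 *)
Definition homology : zmodType := {ideal_quot im_pred}.

End Homology.
Arguments im_pred {A B C} f g.

Section HomologyMap.
Context {A B C A' B' C' : zmodType}.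
Context (f : {additive A -> B}) (g : {additive B -> C}).
Context (f' : {additive A' -> B'}) (g' : {additive B' -> C'}).
Context (u : {additive A -> A'}) (v : {additive B -> B'}).
Hypothesis vf : forall a, v (f a) = f' (u a).
Hypothesis vker : forall z, z \in ker_pred g -> v z \in ker_pred g'.

Definition cycle_map (z : subgrp (ker_pred g)) : subgrp (ker_pred g') :=
  SubGrp (vker (valP z)).

Definition homology_map (h : homology f g) : homology f' g' :=
  \pi_{ideal_quot im_pred f' g'} (cycle_map (repr h)).

Lemma homology_map_pi z :
  homology_map (\pi_{ideal_quot im_pred f g} z) =
  \pi_{ideal_quot im_pred f' g'} (cycle_map z).
Proof.
rewrite /homology_map; apply/eqP; rewrite -Quotient.idealrBE.
set y := repr _.
have : y == z %[mod {ideal_quot im_pred f g}] by rewrite reprK.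
rewrite -Quotient.idealrBE => /asboolP[a fa].
by apply/asboolP; exists (u a); rewrite -vf fa /= !raddfB.
Qed.

End HomologyMap.

(* [chain_seq] and [cochain_seq] only record additive maps of degree -1 (resp. +1); that they
  square to zero is the predicate [is_complex] (resp. [is_cocomplex]), which is
  required of both sides by the definition of a quasi-isomorphism. *)

Record chain_seq := ChainSeq {
  cgrp :> nat -> zmodType;
  cdiff : forall k, {additive cgrp k.+1 -> cgrp k} }.

Record cochain_seq := CochainSeq {
  cogrp :> nat -> zmodType;
  codiff : forall k, {additive cogrp k -> cogrp k.+1} }.

Definition is_complex (C : chain_seq) : Prop :=
  forall k (x : C k.+2), cdiff C k (cdiff C k.+1 x) = 0.

Definition is_cocomplex (C : cochain_seq) : Prop :=
  forall k (x : C k), codiff C k.+1 (codiff C k x) = 0.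

Record chain_map (C D : chain_seq) := ChainMap {
  cmap :> forall k, {additive C k -> D k};
  cmapP : forall k x, cmap k (cdiff C k x) = cdiff D k (cmap k.+1 x) }.

Record cochain_map (C D : cochain_seq) := CochainMap {
  comap :> forall k, {additive C k -> D k};
  comapP : forall k x, comap k.+1 (codiff C k x) = codiff D k (comap k x) }.

(* the differential out of C_k, resp. into C^k, with the convention that it is
   zero for k = 0 *)
Definition cdiff_out (C : chain_seq) k : {additive C k -> C k.-1} :=
  match k with 0%N => \0 | k'.+1 => cdiff C k' end.

Definition codiff_in (C : cochain_seq) k : {additive C k.-1 -> C k} :=
  match k with 0%N => \0 | k'.+1 => codiff C k' end.

Definition chain_homology (C : chain_seq) k : zmodType :=
  homology (cdiff C k) (cdiff_out C k).

Definition cochain_cohomology (C : cochain_seq) k : zmodType :=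
  homology (codiff_in C k) (codiff C k).

Lemma chain_map_cycle C D (F : chain_map C D) k z :
  z \in ker_pred (cdiff_out C k) -> F k z \in ker_pred (cdiff_out D k).
Proof.
case: k z => [|k] z; rewrite !inE //= => /eqP dz.
by rewrite -cmapP dz raddf0.
Qed.

Lemma cochain_map_cycle C D (F : cochain_map C D) k z :
  z \in ker_pred (codiff C k) -> F k z \in ker_pred (codiff D k).
Proof. by rewrite !inE => /eqP dz; rewrite -comapP dz raddf0. Qed.

Definition chain_homology_map C D (F : chain_map C D) k :
    chain_homology C k -> chain_homology D k :=
  homology_map (cdiff D k) (@chain_map_cycle _ _ F k).

Definition cochain_cohomology_map C D (F : cochain_map C D) k :
    cochain_cohomology C k -> cochain_cohomology D k :=
  homology_map (codiff_in D k) (@cochain_map_cycle _ _ F k).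

Definition quasi_iso C D (F : chain_map C D) : Prop :=
  [/\ is_complex C, is_complex D & forall k, bijective (@chain_homology_map _ _ F k)].

Definition co_quasi_iso C D (F : cochain_map C D) : Prop :=
  [/\ is_cocomplex C, is_cocomplex D
    & forall k, bijective (@cochain_cohomology_map _ _ F k)].

Section QuotientComplex.
Variables (C : chain_seq) (N : forall k, zmodClosed (C k)).

Definition chain_stable : Prop :=
  forall k (x : C k.+1), x \in N k.+1 -> cdiff C k x \in N k.

Hypothesis stabN : chain_stable.

Definition quot_diff k (q : {ideal_quot N k.+1}) : {ideal_quot N k} :=
  \pi_{ideal_quot N k} (cdiff C k (repr q)).

Lemma quot_diff_pi k x : quot_diff (\pi_{ideal_quot N k.+1} x) =
  \pi_{ideal_quot N k} (cdiff C k x).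
Proof.
apply/eqP; rewrite -Quotient.idealrBE -raddfB.
by apply: stabN; rewrite Quotient.idealrBE reprK.
Qed.

Lemma quot_diff_additive k : zmod_morphism (@quot_diff k).
Proof.
move=> x y; rewrite -[x]reprK -[y]reprK -raddfB !quot_diff_pi.
by rewrite !raddfB.
Qed.
HB.instance Definition _ k :=
  GRing.isZmodMorphism.Build _ _ (@quot_diff k) (@quot_diff_additive k).

Definition quot_chain : chain_seq :=
  @ChainSeq (fun k => {ideal_quot N k}) (fun k => @quot_diff k).

Definition quot_proj k (x : C k) : quot_chain k := \pi_{ideal_quot N k} x.

End QuotientComplex.

Section SubComplex.
Variables (C : cochain_seq) (P : forall k, zmodClosed (C k)).

Definition cochain_stable : Prop :=
  forall k (x : C k), x \in P k -> codiff C k x \in P k.+1.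

Hypothesis stabP : cochain_stable.

Definition sub_diff k (x : subgrp (P k)) : subgrp (P k.+1) :=
  SubGrp (stabP (valP x)).

Lemma sub_diff_additive k : zmod_morphism (@sub_diff k).
Proof. by move=> x y; apply: val_inj; rewrite /= !raddfB. Qed.
HB.instance Definition _ k :=
  GRing.isZmodMorphism.Build _ _ (@sub_diff k) (@sub_diff_additive k).

Definition sub_cochain : cochain_seq :=
  @CochainSeq (fun k => subgrp (P k)) (fun k => @sub_diff k).

Definition sub_incl k (x : sub_cochain k) : C k := subgrp_val x.

End SubComplex.

(* [{malg M[K]}] is the group of finitely supported functions from K to M, that
  is, M (x) Z[K]; the element m (x) w is [<< m *g w >>]. *)

Section FreeModules.
Context {K L : choiceType} {M A : zmodType}.

Definition mlift (F : K -> M -> A) (c : {malg M[K]}) : A :=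
  \sum_(w <- msupp c) F w c@_w.

Lemma mlift_additive (F : K -> {additive M -> A}) : zmod_morphism (mlift F).
Proof.
have widen (D : {fset K}) c : (msupp c `<=` D)%fset ->
    mlift F c = \sum_(w <- D) F w c@_w.
  move=> sD; rewrite /mlift; apply: (big_fset_incl _ sD) => w _ wc.
  by rewrite mcoeff_outdom // raddf0.
move=> c d; pose D := (msupp c `|` msupp d)%fset.
rewrite !(widen D) ?fsubsetUl ?fsubsetUr ?msuppB_le // -sumrB.
by apply: eq_bigr => w _; rewrite mcoeffB raddfB.
Qed.

End FreeModules.

Section Linearization.
Context {K L : choiceType}.

Definition linearize {M : zmodType} (f : K -> M) : {malg int[K]} -> M :=
  mlift (fun w n => f w *~ n).

Definition tens {M : zmodType} (m : M) : {malg int[K]} -> {malg M[K]} :=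
  mlift (fun w n => << m *~ n *g w >>).

(* the map M (x) Z[K] -> M (x) Z[L] induced by f : K -> L *)
Definition mpush {M : zmodType} (f : K -> L) : {malg M[K]} -> {malg M[L]} :=
  mlift (fun w m => << m *g f w >>).

End Linearization.

Section IdTensor.
Context {K L : choiceType} (Phi : {malg int[K]} -> {malg int[L]}).

(* Id_M (x) Phi *)
Definition id_tensor {M : zmodType} : {malg M[K]} -> {malg M[L]} :=
  mlift (fun w m => tens m (Phi << w >>)).

(* precomposition with Phi, for maps identified with their linearizations *)
Definition precomp {M : zmodType} (f : L -> M) : K -> M :=
  fun w => linearize f (Phi << w >>).

End IdTensor.

Section Annihilators.
Context {K : choiceType} {M : zmodType}.

Definition vanish_on (A : set K) : {pred K -> M} :=
  [pred f : K -> M | `[< forall w, A w -> f w = 0 >]].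
Lemma vanish_on_zmod_closed A : zmod_closed (vanish_on A).
Proof.
split=> [|f g /asboolP f0 /asboolP g0]; apply/asboolP => // w Aw.
by rewrite !fctE f0 // g0 // subr0.
Qed.
HB.instance Definition _ A :=
  GRing.isZmodClosed.Build _ (vanish_on A) (vanish_on_zmod_closed A).

Definition lin_vanish_on (T : set {malg int[K]}) : {pred K -> M} :=
  [pred f : K -> M | `[< forall t, T t -> linearize f t = 0 >]].
Lemma lin_vanish_on_zmod_closed T : zmod_closed (lin_vanish_on T).
Proof.
split=> [|f g /asboolP f0 /asboolP g0]; apply/asboolP => t Tt.
  by apply: big1 => w _; rewrite mul0rz.
transitivity (linearize f t - linearize g t); last by rewrite f0 // g0 // subr0.
by rewrite -sumrB; apply: eq_bigr => w _; rewrite !fctE mulrzBl.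
Qed.
HB.instance Definition _ T :=
  GRing.isZmodClosed.Build _ (lin_vanish_on T) (lin_vanish_on_zmod_closed T).

End Annihilators.

Section Presentation.
Variables (X : choiceType) (R : seq X -> seq X -> Prop).

Inductive word_cong : seq X -> seq X -> Prop :=
| cong_step u a b v : R a b -> word_cong (u ++ a ++ v) (u ++ b ++ v)
| cong_refl u : word_cong u u
| cong_sym u v : word_cong u v -> word_cong v u
| cong_trans u v w : word_cong u v -> word_cong v w -> word_cong u w.

Definition word_equiv : rel (seq X) := fun u v => `[< word_cong u v >].

Lemma word_equiv_is_equiv : equiv_class_of word_equiv.
Proof.
split=> [u|u v|v u w]; first by apply/asboolP; exact: cong_refl.
  by apply/asboolP/asboolP; exact: cong_sym.
by move=> /asboolP uv /asboolP vw; apply/asboolP; exact: cong_trans uv vw.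
Qed.

Canonical word_equiv_equiv := EquivRelPack word_equiv_is_equiv.
Canonical word_equiv_encModRel := defaultEncModRel word_equiv.

Definition presented := {eq_quot word_equiv}.
HB.instance Definition _ : EqQuotient _ word_equiv presented :=
  EqQuotient.on presented.
HB.instance Definition _ := Choice.on presented.

Lemma presentedP u v :
  word_cong u v <-> \pi_presented u = \pi_presented v.
Proof. by split=> [uv|/eqmodP/asboolP//]; apply/eqmodP/asboolP. Qed.

Lemma repr_cong u : word_cong (repr (\pi_presented u)) u.
Proof. by apply/presentedP; rewrite reprK. Qed.

Lemma cong_catr u v w : word_cong u v -> word_cong (u ++ w) (v ++ w).
Proof.
elim=> [u' a b v' ab|u'|u' v' _|u' v' w' _ uv _ vw].
- by rewrite -!catA; apply: cong_step.
- exact: cong_refl.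
- exact: cong_sym.
- exact: cong_trans uv vw.
Qed.

Lemma cong_catl u v w : word_cong u v -> word_cong (w ++ u) (w ++ v).
Proof.
elim=> [u' a b v' ab|u'|u' v' _|u' v' w' _ uv _ vw].
- by rewrite !(catA w); apply: cong_step.
- exact: cong_refl.
- exact: cong_sym.
- exact: cong_trans uv vw.
Qed.

Definition pmul (a b : presented) : presented := \pi_presented (repr a ++ repr b).
Definition pone : presented := \pi_presented [::].
Definition gen (x : X) : presented := \pi_presented [:: x].

Lemma pmul_pi u v :
  pmul (\pi_presented u) (\pi_presented v) = \pi_presented (u ++ v).
Proof.
apply/presentedP; apply: (@cong_trans _ (u ++ repr (\pi_presented v))).
  exact/cong_catr/repr_cong.
exact/cong_catl/repr_cong.
Qed.

Lemma pmulA : associative pmul.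
Proof.
move=> a b c; rewrite -(reprK a) -(reprK b) -(reprK c).
move: (repr a) (repr b) (repr c) => u v w.
by rewrite (pmul_pi v w) (pmul_pi u (v ++ w)) (pmul_pi u v)
  (pmul_pi (u ++ v) w) catA.
Qed.
Lemma pmul1 : left_id pone pmul.
Proof. by move=> a; rewrite -(reprK a) (pmul_pi [::]). Qed.
Lemma pmulr1 : right_id pone pmul.
Proof. by move=> a; rewrite -(reprK a) (pmul_pi _ [::]) cats0. Qed.

HB.instance Definition _ := isMonoid.Build presented pmulA pmul1 pmulr1.

End Presentation.

Definition presented_proj (X : choiceType) (R R' : seq X -> seq X -> Prop)
  (a : presented R) : presented R' := \pi_(presented R') (repr a).

Record mon_bimodule (S : monoidType) (M : zmodType) := MonBimodule {
  mact_r : M -> S -> M;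
  mact_l : S -> M -> M;
  mact_rD : forall s, zmod_morphism (mact_r^~ s);
  mact_lD : forall s, zmod_morphism (mact_l s);
  mact_r1 : forall m, mact_r m 1%g = m;
  mact_l1 : forall m, mact_l 1%g m = m;
  mact_rM : forall m s t, mact_r m (s * t)%g = mact_r (mact_r m s) t;
  mact_lM : forall m s t, mact_l (s * t)%g m = mact_l s (mact_l t m);
  mact_lr : forall s m t, mact_r (mact_l s m) t = mact_l s (mact_r m t) }.

Section TupleOps.
Context {T : Type} {k : nat}.

Definition tbehead (t : k.+1.-tuple T) : k.-tuple T :=
  [tuple tnth t (lift ord0 i) | i < k].

Definition tbelast (t : k.+1.-tuple T) : k.-tuple T :=
  [tuple tnth t (lift ord_max i) | i < k].

End TupleOps.

Lemma sum3B (V : zmodType) k (a a' b b' : V) (F G H : 'I_k -> V) :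
  (forall j, F j = G j - H j) ->
  a - a' + \sum_j F j + (b - b') =
  a + \sum_j G j + b - (a' + \sum_j H j + b').
Proof.
move=> FGH; rewrite (eq_bigr _ (fun j _ => FGH j)) sumrB.
by rewrite opprD [RHS]addrACA opprD [X in _ = X + _]addrACA.
Qed.

Section Hochschild.
Variables (S : monoidType) (M : zmodType) (B : mon_bimodule S M).

(* with s = (s_0, ..., s_k): (s_0, ..., s_j * s_j.+1, ..., s_k) *)
Definition tmerge k (j : nat) (s : k.+1.-tuple S) : k.-tuple S :=
  [tuple (if i < j then tnth s (lift ord_max i)
          else if i == j :> nat
               then (tnth s (lift ord_max i) * tnth s (lift ord0 i))%g
          else tnth s (lift ord0 i))%N | i < k].

Definition hoch_bd k (s : k.+1.-tuple S) (m : M) : {malg M[k.-tuple S]} :=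
  << mact_r B m (tnth s ord0) *g tbehead s >>
  + \sum_(j < k) << m *g tmerge j s >> *~ (-1) ^+ j.+1
  + << mact_l B (tnth s ord_max) m *g tbelast s >> *~ (-1) ^+ k.+1.

Lemma hoch_bd_additive k s : zmod_morphism (@hoch_bd k s).
Proof.
move=> m n; rewrite /hoch_bd mact_rD mact_lD.
rewrite [<< mact_r B m _ - _ *g _ >>]monalgUB.
rewrite [<< mact_l B _ m - _ *g _ >>]monalgUB mulrzBl.
apply: sum3B => j.
by rewrite monalgUB mulrzBl.
Qed.
HB.instance Definition _ k s :=
  GRing.isZmodMorphism.Build _ _ (@hoch_bd k s) (@hoch_bd_additive k s).

Definition hoch_diff k : {malg M[k.+1.-tuple S]} -> {malg M[k.-tuple S]} :=
  mlift (@hoch_bd k).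
Lemma hoch_diff_additive k : zmod_morphism (@hoch_diff k).
Proof. exact: (@mlift_additive _ _ _ (fun s => @hoch_bd k s)). Qed.
HB.instance Definition _ k :=
  GRing.isZmodMorphism.Build _ _ (@hoch_diff k) (@hoch_diff_additive k).

Definition hoch_chain : chain_seq :=
  @ChainSeq (fun k => {malg M[k.-tuple S]}) (fun k => @hoch_diff k).

Definition hoch_codiff k (f : k.-tuple S -> M) : k.+1.-tuple S -> M := fun s =>
  mact_l B (tnth s ord0) (f (tbehead s))
  + \sum_(j < k) f (tmerge j s) *~ (-1) ^+ j.+1
  + mact_r B (f (tbelast s)) (tnth s ord_max) *~ (-1) ^+ k.+1.
Lemma hoch_codiff_additive k : zmod_morphism (@hoch_codiff k).
Proof.
move=> f g; apply/funext=> s; rewrite /hoch_codiff !fctE /=.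
rewrite mact_rD mact_lD mulrzBl.
by apply: sum3B => j; rewrite mulrzBl.
Qed.
HB.instance Definition _ k :=
  GRing.isZmodMorphism.Build _ _ (@hoch_codiff k) (@hoch_codiff_additive k).

Definition hoch_cochain : cochain_seq :=
  @CochainSeq (fun k => k.-tuple S -> M) (fun k => @hoch_codiff k).

Definition unit_tuple k : set (k.-tuple S) := [set s | 1%g \in s].

Definition unit_chains k : zmodClosed (hoch_chain k) :=
  gen_subgroup [set c | exists m s, unit_tuple s /\ c = << m *g s >>].

Definition norm_cochains k : zmodClosed (hoch_cochain k) :=
  vanish_on (@unit_tuple k).

Definition norm_hoch_chain (h : chain_stable unit_chains) : chain_seq :=
  quot_chain h.

Definition norm_hoch_cochain (h : cochain_stable norm_cochains) : cochain_seq :=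
  sub_cochain h.

End Hochschild.

Section PresentedBimodule.
Variables (X : choiceType) (R : seq X -> seq X -> Prop) (M : zmodType).
Variables (r : M -> X -> M) (l : X -> M -> M).
Hypothesis rD : forall x, zmod_morphism (r^~ x).
Hypothesis lD : forall x, zmod_morphism (l x).
Hypothesis rR : forall a b m, R a b -> foldl r m a = foldl r m b.
Hypothesis lR : forall a b m, R a b -> foldr l m a = foldr l m b.
Hypothesis lr : forall x m y, r (l x m) y = l x (r m y).

Definition pact_r (m : M) (a : presented R) : M := foldl r m (repr a).
Definition pact_l (a : presented R) (m : M) : M := foldr l m (repr a).

Lemma foldl_cong u v m : word_cong R u v -> foldl r m u = foldl r m v.
Proof.
move=> uv; elim: uv m => [u' a b v' ab|u'|u' v' _ IH|u' v' w _ IH1 _ IH2] m //.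
  by rewrite !foldl_cat (rR _ ab).
by rewrite IH1.
Qed.

Lemma foldr_cong u v m : word_cong R u v -> foldr l m u = foldr l m v.
Proof.
move=> uv; elim: uv m => [u' a b v' ab|u'|u' v' _ IH|u' v' w _ IH1 _ IH2] m //.
  by rewrite !foldr_cat (lR _ ab).
by rewrite IH1.
Qed.

Lemma pact_r_pi m u : pact_r m (\pi_(presented R) u) = foldl r m u.
Proof. exact/foldl_cong/repr_cong. Qed.

Lemma pact_l_pi m u : pact_l (\pi_(presented R) u) m = foldr l m u.
Proof. exact/foldr_cong/repr_cong. Qed.

Lemma pact_rD a : zmod_morphism (pact_r^~ a).
Proof.
rewrite /pact_r; elim: (repr a) => [|x u IH] m n //=.
by rewrite rD IH.
Qed.

Lemma pact_lD a : zmod_morphism (pact_l a).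
Proof.
rewrite /pact_l; elim: (repr a) => [|x u IH] m n //=.
by rewrite IH lD.
Qed.

Lemma pact_r1 m : pact_r m 1%g = m.
Proof. exact: (pact_r_pi m [::]). Qed.

Lemma pact_l1 m : pact_l 1%g m = m.
Proof. exact: (pact_l_pi m [::]). Qed.

Lemma pact_rM m a b : pact_r m (a * b)%g = pact_r (pact_r m a) b.
Proof. by rewrite /pact_r -foldl_cat; exact/foldl_cong/repr_cong. Qed.

Lemma pact_lM m a b : pact_l (a * b)%g m = pact_l a (pact_l b m).
Proof. by rewrite /pact_l -foldr_cat; exact/foldr_cong/repr_cong. Qed.

Lemma pact_lr a m b : pact_r (pact_l a m) b = pact_l a (pact_r m b).
Proof.
have lr1 x v n : foldl r (l x n) v = l x (foldl r n v).
  by elim: v n => //= y v IH n; rewrite lr IH.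
rewrite /pact_r /pact_l; elim: (repr a) => //= x u IH.
by rewrite lr1 IH.
Qed.

Definition presented_bimodule : mon_bimodule (presented R) M :=
  MonBimodule pact_rD pact_lD pact_r1 pact_l1 pact_rM pact_lM pact_lr.

End PresentedBimodule.

Section Braided.
Variables (X : choiceType) (sigma : X * X -> X * X).

Definition sigma_Id (t : X * X * X) : X * X * X :=
  let: (x, y, z) := t in let: (a, b) := sigma (x, y) in (a, b, z).
Definition Id_sigma (t : X * X * X) : X * X * X :=
  let: (x, y, z) := t in let: (a, b) := sigma (y, z) in (x, a, b).

Definition braided : Prop := forall t,
  sigma_Id (Id_sigma (sigma_Id t)) = Id_sigma (sigma_Id (Id_sigma t)).

(* Positions are counted from 0, so [bgen i] is b_(i+1): it applies sigma to the
   letters at positions i and i + 1. *)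
Fixpoint bgen_seq (i : nat) (w : seq X) : seq X :=
  match i, w with
  | 0%N, x :: y :: v => (sigma (x, y)).1 :: (sigma (x, y)).2 :: v
  | i'.+1, x :: v => x :: bgen_seq i' v
  | _, _ => w
  end.

Lemma size_bgen_seq i w : size (bgen_seq i w) = size w.
Proof. by elim: i w => [|i IH] [|x [|y v]] //=; rewrite IH. Qed.

Lemma bgen_subproof k i (w : k.-tuple X) : size (bgen_seq i w) == k.
Proof. by rewrite size_bgen_seq size_tuple. Qed.
Definition bgen k i (w : k.-tuple X) : k.-tuple X := Tuple (bgen_subproof i w).

(* the product of the b_i for i in e; the last entry of e acts first *)
Definition bword k (e : seq nat) (w : k.-tuple X) : k.-tuple X :=
  foldr (@bgen k) w e.

Definition normal_word (w : seq X) : bool :=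
  sorted (fun x y => sigma (x, y) == (x, y)) w.

Definition pseudo_unit (e : X) : Prop :=
  (forall x, sigma (e, x) \in [:: (e, x); (x, e)] /\
             sigma (x, e) \in [:: (e, x); (x, e)]) /\
  (forall u v, normal_word (u ++ e :: v) -> normal_word (u ++ v)).

Definition struct_rel (u v : seq X) : Prop := exists x y,
  u = [:: x; y] /\ v = [:: (sigma (x, y)).1; (sigma (x, y)).2].

Definition red_struct_rel (e : X) (u v : seq X) : Prop :=
  struct_rel u v \/ (u = [:: e] /\ v = [::]).

(* M(X, sigma) and its quotient by the identification of e with the unit *)
Definition struct_monoid : monoidType := presented struct_rel.
Definition red_struct_monoid (e : X) : monoidType :=
  presented (red_struct_rel e).

Record bimodule (M : zmodType) := Bimodule {
  bact_r : M -> X -> M;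
  bact_l : X -> M -> M;
  bact_rD : forall x, zmod_morphism (bact_r^~ x);
  bact_lD : forall x, zmod_morphism (bact_l x);
  bact_r_sigma : forall m x y, bact_r (bact_r m x) y =
    bact_r (bact_r m (sigma (x, y)).1) (sigma (x, y)).2;
  bact_l_sigma : forall m x y, bact_l x (bact_l y m) =
    bact_l (sigma (x, y)).1 (bact_l (sigma (x, y)).2 m);
  bact_lr : forall x m y, bact_r (bact_l x m) y = bact_l x (bact_r m y) }.

Section Bimodules.
Variables (M : zmodType) (B : bimodule M).

Definition acts_trivially (e : X) : Prop :=
  forall m, bact_r B m e = m /\ bact_l B e m = m.

Lemma struct_rel_r a b m :
  struct_rel a b -> foldl (bact_r B) m a = foldl (bact_r B) m b.
Proof. by case=> x [y [-> ->]] /=; exact: bact_r_sigma. Qed.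

Lemma struct_rel_l a b m :
  struct_rel a b -> foldr (bact_l B) m a = foldr (bact_l B) m b.
Proof. by case=> x [y [-> ->]] /=; exact: bact_l_sigma. Qed.

Definition struct_bimodule : mon_bimodule struct_monoid M :=
  presented_bimodule (bact_rD B) (bact_lD B) struct_rel_r struct_rel_l
    (bact_lr B).

Variable e : X.
Hypothesis triv : acts_trivially e.

Lemma red_struct_rel_r a b m :
  red_struct_rel e a b -> foldl (bact_r B) m a = foldl (bact_r B) m b.
Proof.
by case=> [ab|[-> ->]]; [exact: struct_rel_r|rewrite /=; case: (triv m) => -> _].
Qed.

Lemma red_struct_rel_l a b m :
  red_struct_rel e a b -> foldr (bact_l B) m a = foldr (bact_l B) m b.
Proof.
by case=> [ab|[-> ->]]; [exact: struct_rel_l|rewrite /=; case: (triv m) => _ ->].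
Qed.

Definition red_struct_bimodule : mon_bimodule (red_struct_monoid e) M :=
  presented_bimodule (bact_rD B) (bact_lD B) red_struct_rel_r red_struct_rel_l
    (bact_lr B).

End Bimodules.

(* For w = (w_0, ..., w_k), the word x'_i x'_0 ... x'_(i-1) w_(i+1) ... w_k
   obtained by pulling w_i to the left end, resp. the word
   w_0 ... w_(i-1) x''_(i+1) ... x''_k x''_i obtained by pulling it to the right
   end; the letters on the other side of w_i are not moved. *)
Definition pull_left k (i : nat) (w : k.+1.-tuple X) : k.+1.-tuple X :=
  bword (iota 0 i) w.
Definition pull_right k (i : nat) (w : k.+1.-tuple X) : k.+1.-tuple X :=
  bword (rev (iota i (k - i))) w.

Section BraidedComplexes.
Variables (M : zmodType) (B : bimodule M).

Definition face_l k (i : nat) (w : k.+1.-tuple X) (m : M) :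
    {malg M[k.-tuple X]} :=
  << bact_r B m (tnth (pull_left i w) ord0) *g tbehead (pull_left i w) >>.

Definition face_r k (i : nat) (w : k.+1.-tuple X) (m : M) :
    {malg M[k.-tuple X]} :=
  << bact_l B (tnth (pull_right i w) ord_max) m *g tbelast (pull_right i w) >>.

Definition braid_bd k (w : k.+1.-tuple X) (m : M) : {malg M[k.-tuple X]} :=
  \sum_(i < k.+1) (face_l i w m - face_r i w m) *~ (-1) ^+ i.

Lemma braid_bd_additive k w : zmod_morphism (@braid_bd k w).
Proof.
move=> m n; rewrite /braid_bd -sumrB; apply: eq_bigr => i _.
rewrite -mulrzBl; congr (_ *~ _).
rewrite /face_l /face_r bact_rD bact_lD !monalgUB.
by rewrite opprD addrACA -opprD.
Qed.
HB.instance Definition _ k w :=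
  GRing.isZmodMorphism.Build _ _ (@braid_bd k w) (@braid_bd_additive k w).

Definition braid_diff k : {malg M[k.+1.-tuple X]} -> {malg M[k.-tuple X]} :=
  mlift (@braid_bd k).
Lemma braid_diff_additive k : zmod_morphism (@braid_diff k).
Proof. exact: (@mlift_additive _ _ _ (fun w => @braid_bd k w)). Qed.
HB.instance Definition _ k :=
  GRing.isZmodMorphism.Build _ _ (@braid_diff k) (@braid_diff_additive k).

Definition braid_chain : chain_seq :=
  @ChainSeq (fun k => {malg M[k.-tuple X]}) (fun k => @braid_diff k).

Definition coface_l k (i : nat) (f : k.-tuple X -> M) (w : k.+1.-tuple X) : M :=
  bact_l B (tnth (pull_left i w) ord0) (f (tbehead (pull_left i w))).

Definition coface_r k (i : nat) (f : k.-tuple X -> M) (w : k.+1.-tuple X) : M :=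
  bact_r B (f (tbelast (pull_right i w))) (tnth (pull_right i w) ord_max).

Definition braid_codiff k (f : k.-tuple X -> M) : k.+1.-tuple X -> M := fun w =>
  \sum_(i < k.+1) (coface_l i f w - coface_r i f w) *~ (-1) ^+ i.
Lemma braid_codiff_additive k : zmod_morphism (@braid_codiff k).
Proof.
move=> f g; apply/funext=> w; rewrite /braid_codiff !fctE /= -sumrB.
apply: eq_bigr => i _; rewrite -mulrzBl; congr (_ *~ _).
rewrite /coface_l /coface_r bact_rD bact_lD.
by rewrite opprD addrACA -opprD.
Qed.
HB.instance Definition _ k :=
  GRing.isZmodMorphism.Build _ _ (@braid_codiff k) (@braid_codiff_additive k).

Definition braid_cochain : cochain_seq :=
  @CochainSeq (fun k => k.-tuple X -> M) (fun k => @braid_codiff k).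

End BraidedComplexes.

(* the inclusion of Z[X^k] as the degree k part of Z<X> *)
Definition word_incl k : {malg int[k.-tuple X]} -> {malg int[{fmonom X}]} :=
  mpush (fun w => FMonom (tval w)).

Definition two_sided_ideal (I : set {malg int[{fmonom X}]}) : Prop :=
  subgroup I /\ forall a x, I x -> I (a * x) /\ I (x * a).

Definition Rminus : set {malg int[2.-tuple X]} :=
  smallest (@subgroup _)
    [set c | exists x y, sigma (x, y) = (x, y) /\ c = << [tuple x; y] >>].

(* T_k(X; R_-) and T_k(X, sigma, e) *)
Definition Tminus k : set {malg int[k.-tuple X]} :=
  @word_incl k @^-1` smallest two_sided_ideal (@word_incl 2 @` Rminus).
Definition Tunit (e : X) k : set {malg int[k.-tuple X]} :=
  @word_incl k @^-1` smallest two_sided_ideal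
    (@word_incl 2 @` Rminus `|` [set << FMonom [:: e] >>]).

Section CriticalComplexes.
Variables (M : zmodType) (B : bimodule M).
Variable T : forall k, set {malg int[k.-tuple X]}.

(* the image of M (x) T_k in M (x) Z[X^k] *)
Definition crit_sub k : zmodClosed (braid_chain B k) :=
  gen_subgroup [set c | exists m t, T t /\ c = tens m t].

Definition crit_cosub k : zmodClosed (braid_cochain B k) :=
  lin_vanish_on (@T k).

Definition crit_chain (h : chain_stable crit_sub) : chain_seq := quot_chain h.

Definition crit_cochain (h : cochain_stable crit_cosub) : cochain_seq :=
  sub_cochain h.

End CriticalComplexes.

(* the adjacent transposition of i and i + 1, on positions counted from 0 *)
Definition adj_swap (i n : nat) : nat :=
  if n == i then i.+1 else if n == i.+1 then i else n.

(* s is the composite of the transpositions listed in e, the last acting first *)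
Definition expresses k (s : 'S_k) (e : seq nat) : Prop :=
  all (fun i => i.+1 < k)%N e /\
  forall x : 'I_k, s x = foldr adj_swap x e :> nat.

Definition shortest_expr k (s : 'S_k) : set (seq nat) :=
  [set e | expresses s e /\
    forall e', expresses s e' -> (size e <= size e')%N].

(* [xget] picks a shortest expression; its default value is never used, as
   adjacent transpositions generate 'S_k *)
Definition reduced_expr k (s : 'S_k) : seq nat := xget [::] (shortest_expr s).
Definition perm_len k (s : 'S_k) : nat := size (reduced_expr s).
Definition perm_act k (s : 'S_k) : k.-tuple X -> k.-tuple X :=
  bword (reduced_expr s).

Definition quantum_sym k (c : {malg int[k.-tuple X]}) :
    {malg int[k.-tuple struct_monoid]} :=
  mpush (map_tuple (gen struct_rel))
    (\sum_(s : 'S_k) mpush (perm_act s) c *~ (-1) ^+ perm_len s).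

Definition kill_units (S : monoidType) k :
    {malg int[k.-tuple S]} -> {malg int[k.-tuple S]} :=
  mlift (fun (s : k.-tuple S) n => if 1%g \in s then 0 else << n *g s >>).

Definition red_quantum_sym (e : X) k (c : {malg int[k.-tuple X]}) :
    {malg int[k.-tuple (red_struct_monoid e)]} :=
  kill_units (mpush (map_tuple (presented_proj (red_struct_rel e)
    (R := struct_rel))) (quantum_sym c)).

End Braided.

(* Main.v *)
(* The free bimodules over S = M(X, sigma) on the tuples of letters, resp. of
   elements of S, carry differentials [braid_d] and [bar_d]; tensoring with M or
   mapping to M gives back the braided and the Hochschild complexes. The quantum
   symmetrizer is a chain map between them: in bar_d (qs w) the inner faces
   cancel in pairs (s against s_j s, as x y = y' x' in S), while the outer ones
   are sorted by the letter of w that s moves to the corresponding end.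

   Modulo the non-critical words (those containing an adjacent normal pair or
   the pseudo-unit) the braided bimodules form a free resolution of Z[S].
   Firstly, qs is injective modulo these words: for s <> 1, the word T_s w has
   a normal pair, by idempotence of sigma. Hence braid_d^2 = 0 and the
   stability of non-critical words are inherited from the bar complex.
   Exactness follows from the contraction that moves the first letter of the
   normal form of b into w in a . w . b whenever this gives a critical word,
   by induction on the length of that normal form. As the bar complex,
   normalized or not, is a free resolution of Z[S] too, qs is a homotopy
   equivalence of complexes of bimodules, which yields the four quasi-
   isomorphisms. With a pseudo-unit the proof is the same. *)
Require Import Defs.
From HB Require Import structures.
From mathcomp Require Import fingroup perm.
From mathcomp Require Import all_boot all_algebra.
From mathcomp Require Import boolp classical_sets functions.
From mathcomp Require Import finmap.
From mathcomp.multinomials Require Import monalg.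

Set Implicit Arguments.
Unset Strict Implicit.
Unset Printing Implicit Defensive.

Import GRing.Theory.
Local Open Scope ring_scope.
Local Open Scope quotient_scope.

(** * Reduced expressions of permutations *)

(** As sigma need not be invertible, only the positive braid monoid acts and T_s makes sense only
    through reduced expressions; hence the start with inversions and Matsumoto's theorem. The
    comparison takes place on bimodules because M is arbitrary: exactness alone is not preserved by
    tensoring with M or mapping to M, while homotopies between bimodule maps are. Quotients of free
    bimodules are never formed. A set of bad generators is carried along, and identities are stated
    modulo their span, so that a bimodule map is just a function on generators and one notion of
    resolution covers the bar and the critical side. The predicate [E] (empty, or the pseudo-unit
    alone) and the boolean [norm] treat both halves of the theorem at once. The contraction works
    because normal forms are computed in one pass: if sigma(x, y) = (x', x'') and y v is normal,
    then x' followed by the normal form of x'' v is normal. In the boundary of the cell w y . v, the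
    right faces that pull a letter of w therefore cannot be moved up, the left faces have a shorter
    coefficient, and one face is the cell w . y v itself. *)

Section BraidRelations.
Variables (X : choiceType) (sigma : X * X -> X * X).
Local Notation b := (bgen_seq sigma).

Lemma bgen_seq_far i j w : (i.+1 < j)%N -> b i (b j w) = b j (b i w).
Proof.
elim: i j w => [|i IH] [|j] [|x w] //= ij; last by rewrite IH.
by case: j w ij => [|j] [|y w].
Qed.

Hypothesis sigma_braided : braided sigma.

Lemma bgen_seq_braid i w : (i.+2 < size w)%N ->
  b i (b i.+1 (b i w)) = b i.+1 (b i (b i.+1 w)).
Proof.
elim: i w => [|i IH] [|x w] //=; last by move=> iw; rewrite IH.
case: w => [|y [|z w]] // _ /=; have := sigma_braided (x, y, z).
rewrite /sigma_Id /Id_sigma.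
case: (sigma (x, y)) => a c; case: (sigma (y, z)) => d e /=.
case: (sigma (c, z)) => f g; case: (sigma (x, d)) => h l /=.
case: (sigma (a, f)) => ? ?; case: (sigma (l, e)) => ? ? /=.
by case=> -> -> ->.
Qed.

Hypothesis sigma_idem : forall p, sigma (sigma p) = sigma p.

Lemma bgen_seq_idem i w : b i (b i w) = b i w.
Proof.
elim: i w => [|i IH] [|x w] //=; last by rewrite IH.
by case: w => //= y w; rewrite -surjective_pairing sigma_idem.
Qed.

End BraidRelations.

Section Words.
Variables (X : choiceType) (sigma : X * X -> X * X).

Definition bword_seq (e : seq nat) (w : seq X) := foldr (bgen_seq sigma) w e.

Lemma size_bword_seq e w : size (bword_seq e w) = size w.
Proof. by elim: e => //= i e; rewrite size_bgen_seq. Qed.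

Lemma val_bword k e (w : k.-tuple X) : tval (bword sigma e w) = bword_seq e w.
Proof. by elim: e => //= i e ->. Qed.

Lemma bword_cat k e f (w : k.-tuple X) :
  bword sigma (e ++ f) w = bword sigma e (bword sigma f w).
Proof. exact: foldr_cat. Qed.

Lemma bword_seq_shift e x v :
  bword_seq (map S e) (x :: v) = x :: bword_seq e v.
Proof. by elim: e => //= i e ->. Qed.

Lemma bgen_seq_rcons i v x : (i.+1 < size v)%N ->
  bgen_seq sigma i (rcons v x) = rcons (bgen_seq sigma i v) x.
Proof.
elim: i v => [|i IH] [|y v] //=; last by move=> iv; rewrite IH.
by case: v.
Qed.

Lemma bword_seq_rcons e v x : all (fun i => i.+1 < size v)%N e ->
  bword_seq e (rcons v x) = rcons (bword_seq e v) x.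
Proof.
elim: e => //= i e IH /andP[iv ev].
by rewrite IH // bgen_seq_rcons ?size_bword_seq.
Qed.

End Words.

(** Exchanging two letters is itself a braiding. Acting on the word 0 1 ... k-1 it yields one-line
    notations, so the relations proved for [bgen_seq] also serve for permutations. *)
Definition flip (p : nat * nat) := (p.2, p.1).
Local Notation swap := (bgen_seq flip).
Local Notation oneline k e := (bword_seq flip e (iota 0 k)).

Lemma flip_braided : braided flip.
Proof. by case=> -[x y] z. Qed.

Lemma swapK i w : swap i (swap i w) = w.
Proof.
by elim: i w => [|i IH] [|x w] //=; [case: w|rewrite IH].
Qed.

Lemma adj_swapK i : involutive (adj_swap i).
Proof.
move=> m; rewrite /adj_swap; have [->|mi] := eqVneq m i.
  by rewrite eqxx; case: eqP => // /eqP; rewrite eqn_leq ltnn.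
by have [->|mi1] := eqVneq m i.+1; rewrite ?eqxx // (negPf mi) (negPf mi1).
Qed.

Lemma adj_swapS i m : adj_swap i.+1 m.+1 = (adj_swap i m).+1.
Proof. by rewrite /adj_swap !eqSS; case: eqP => // _; case: eqP. Qed.

Lemma adj_swap_id i m : m != i -> m != i.+1 -> adj_swap i m = m.
Proof. by rewrite /adj_swap => /negPf-> /negPf->. Qed.

Lemma adj_swapE i : (adj_swap i i = i.+1) * (adj_swap i i.+1 = i) *
  (adj_swap i i.+2 = i.+2) * (adj_swap i.+1 i = i).
Proof.
have e1 : (i == i.+1) = false by rewrite ltn_eqF.
have e2 : (i == i.+2) = false by rewrite ltn_eqF // ltnW.
by rewrite /adj_swap !eqxx !eqSS ![i.+1 == i]eq_sym ![i.+2 == i]eq_sym e1 e2.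
Qed.

Lemma adj_swap_lt k i m : (i.+1 < k -> m < k -> adj_swap i m < k)%N.
Proof.
by move=> ik mk; rewrite /adj_swap; do 2!case: ifP => // _; exact: ltnW.
Qed.

Lemma nth_swap x0 i w m : (i.+1 < size w)%N ->
  nth x0 (swap i w) m = nth x0 w (adj_swap i m).
Proof.
elim: i w m => [|i IH] [|x w] m //=; first by case: w m => [|y w] [|[|m]].
by case: m => [|m] iw //=; rewrite adj_swapS /= IH.
Qed.

Lemma perm_swap i w : perm_eq (swap i w) w.
Proof.
elim: i w => [|i IH] [|x w] //=; last by rewrite perm_cons.
by case: w => // y w; rewrite -[[:: _, _ & _]]/([:: y] ++ x :: w) perm_catC /=
  -[X in perm_eq X](cat1s x) perm_cons perm_catC.
Qed.

Fixpoint inversions (w : seq nat) : nat :=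
  if w is x :: v then (count (fun y => y < x) v + inversions v)%N else 0%N.

Lemma inv_swap_asc i w : (i.+1 < size w)%N -> (nth 0 w i < nth 0 w i.+1)%N ->
  inversions (swap i w) = (inversions w).+1.
Proof.
elim: i w => [|i IH] [|x w] //=.
  case: w => [|y w] //= _ xy.
  by rewrite xy (leq_gtF (ltnW xy)) add0n add1n addSn addnCA.
move=> iw asc; rewrite IH // addnS.
by have /seq.permP-> := perm_swap i w.
Qed.

Lemma inv_swap_desc i w : (i.+1 < size w)%N -> (nth 0 w i.+1 < nth 0 w i)%N ->
  inversions w = (inversions (swap i w)).+1.
Proof.
move=> iw desc; rewrite -{1}(swapK i w) inv_swap_asc ?size_bgen_seq //.
by rewrite !nth_swap // /adj_swap !eqxx [_.+1 == _]gtn_eqF.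
Qed.

Lemma uniq_nth_neq i w : uniq w -> (i.+1 < size w)%N ->
  nth 0%N w i != nth 0%N w i.+1.
Proof. by move=> uw iw; rewrite nth_uniq // ?ltn_eqF // ltnW. Qed.

Lemma inv_swap_cases i w : uniq w -> (i.+1 < size w)%N ->
  inversions (swap i w) = (inversions w).+1 \/
  inversions w = (inversions (swap i w)).+1.
Proof.
move=> uw iw; have := uniq_nth_neq uw iw; rewrite neq_ltn => /orP[asc|desc].
  by left; exact: inv_swap_asc.
by right; exact: inv_swap_desc.
Qed.

Lemma inv_swap_gt i w : uniq w -> (i.+1 < size w)%N ->
  (inversions (swap i w) < inversions w -> nth 0 w i.+1 < nth 0 w i)%N.
Proof.
move=> uw iw lt; have := uniq_nth_neq uw iw; rewrite neq_ltn => /orP[asc|//].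
by move: lt; rewrite inv_swap_asc // ltnNge leqnSn.
Qed.

Local Notation valid k := (all (fun i => i.+1 < k)%N).

Lemma perm_oneline k e : perm_eq (oneline k e) (iota 0 k).
Proof. by elim: e => //= i e; exact: perm_trans (perm_swap _ _). Qed.

Lemma uniq_oneline k e : uniq (oneline k e).
Proof. by rewrite (perm_uniq (perm_oneline k e)) iota_uniq. Qed.

Lemma size_oneline k e : size (oneline k e) = k.
Proof. by rewrite size_bword_seq size_iota. Qed.

(** A sorted word has no inversion, and each swap changes their number by one. *)
Lemma inv_oneline k e : valid k e -> (inversions (oneline k e) <= size e)%N.
Proof.
elim: e => [_|i e IH] /=.
  suff -> : forall m, inversions (iota m k) = 0%N by [].
  elim: k => //= k IH m; rewrite IH addn0.
  apply/eqP; rewrite eqn0Ngt -has_count.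
  apply/hasPn => y; rewrite mem_iota => /andP[my _].
  by rewrite -leqNgt ltnW.
case/andP=> ik /IH; have := @inv_swap_cases i _ (uniq_oneline k e).
rewrite size_oneline => /(_ ik)[->|eq] //; rewrite eq => /ltnW; exact: leqW.
Qed.

(** Bubble sort, by induction on the inversions: an unsorted word has a descent, and swapping there
    removes exactly one inversion. *)
Lemma oneline_exists k u : perm_eq u (iota 0 k) ->
  exists e, [/\ valid k e, oneline k e = u & size e = inversions u].
Proof.
move: {2}(inversions u) (erefl (inversions u)) => n.
elim: n u => [|n IH] u nu pu.
  exists [::]; split=> //=.
  apply/esym/(sorted_eq leq_trans anti_leq) => //; last exact: iota_sorted.
  elim: u {pu} nu => //= x u IHu /eqP; rewrite addn_eq0 => /andP[/eqP c0 /eqP].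
  move=> /IHu su; rewrite path_min_sorted //; apply/allP => y yu.
  rewrite leqNgt; apply/negP => yx; have := has_count (fun y => y < x)%N u.
  by rewrite c0 ltnn => /hasP; apply; exists y.
have uu : uniq u by rewrite (perm_uniq pu) iota_uniq.
have su : size u = k by rewrite (perm_size pu) size_iota.
have [i iu desc] : exists2 i, (i.+1 < size u)%N & (nth 0 u i.+1 < nth 0 u i)%N.
  apply: contrapT => nodesc.
  have : sorted leq u.
    apply/(sortedP 0%N) => i iu; rewrite leqNgt; apply/negP => d.
    by apply: nodesc; exists i.
  move: nu; clear; elim: u => //= x u IHu nu ps.
  have /allP := order_path_min leq_trans ps => xmin; apply: IHu.
    move: nu; suff -> : count (fun y => y < x)%N u = 0%N by [].
    apply/eqP; rewrite eqn0Ngt -has_count; apply/hasPn => y /xmin.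
    by rewrite -leqNgt.
  exact: path_sorted ps.
have [|e [ve oe se]] := IH (swap i u) _ (perm_trans (perm_swap i u) pu).
  by have := inv_swap_desc iu desc; rewrite nu => -[].
exists (i :: e); rewrite /= oe swapK se nu ve -su iu; split=> //.
by have := inv_swap_desc iu desc; rewrite nu => ->.
Qed.

(** By [inv_oneline] and [oneline_exists] this is minimality of the length; in this form it passes
    easily to the tail of an expression. *)
Definition reduced k e := valid k e && (size e == inversions (oneline k e)).

Lemma reduced_exists k u : perm_eq u (iota 0 k) ->
  exists2 r, reduced k r & oneline k r = u.
Proof.
move=> /oneline_exists[r [vr or sr]]; exists r => //.
by rewrite /reduced vr or sr /=.
Qed.

Lemma reduced_desc k u i r : size u = k -> (i.+1 < k)%N ->
  (nth 0 u i.+1 < nth 0 u i)%N -> reduced k r -> oneline k r = swap i u ->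
  reduced k (i :: r) /\ oneline k (i :: r) = u.
Proof.
move=> su ik desc /andP[vr /eqP sr] or; rewrite /reduced /= or swapK ik vr.
by rewrite sr or -inv_swap_desc ?su //=.
Qed.

Lemma reduced_cons k i f : reduced k (i :: f) ->
  [/\ (i.+1 < k)%N, reduced k f &
   (nth 0 (oneline k (i :: f)) i.+1 < nth 0 (oneline k (i :: f)) i)%N].
Proof.
move=> /andP[/= /andP[ik fk] /eqP sf]; have le := inv_oneline fk.
have := @inv_swap_cases i _ (uniq_oneline k f).
rewrite size_oneline => /(_ ik); rewrite -sf => -[[sf']|lt]; last first.
  by move: le; rewrite lt ltnNge leqnSn.
split=> //; first by rewrite /reduced fk sf' /=.
apply: inv_swap_gt.
- exact: (uniq_oneline k (i :: f)).
- by rewrite size_bgen_seq size_oneline.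
- by rewrite swapK -sf sf'.
Qed.

(** * Matsumoto's theorem for the action of reduced words *)

Section Matsumoto.
Variables (X : choiceType) (sigma : X * X -> X * X).
Hypothesis sigma_braided : braided sigma.

(** Induction on the length. The first letters i and j are both descents of the same permutation u,
    so u also has reduced expressions starting with the two sides of the relation between i and j.
    By induction each given expression may be exchanged for one of these, and a single relation of
    sigma compares them. *)
Lemma matsumoto k e e' (w : seq X) : size w = k ->
  reduced k e -> reduced k e' -> oneline k e = oneline k e' ->
  bword_seq sigma e w = bword_seq sigma e' w.
Proof.
move=> wk; move: {2}(size e) (erefl (size e)) => n.
elim: n e e' => [|n IH] e e' se re re' eq.
all: have se' : size e' = size e
  by move: re re' => /andP[_ /eqP->] /andP[_ /eqP->]; rewrite eq.
  by rewrite (size0nil se) (size0nil (etrans se' se)).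
have key i j f g u : (i <= j)%N -> size f = n -> size g = n ->
    (i.+1 < k)%N -> (j.+1 < k)%N -> reduced k f -> reduced k g ->
    perm_eq u (iota 0 k) ->
    oneline k f = swap i u -> oneline k g = swap j u ->
    (nth 0 u i.+1 < nth 0 u i)%N -> (nth 0 u j.+1 < nth 0 u j)%N ->
    bgen_seq sigma i (bword_seq sigma f w) =
    bgen_seq sigma j (bword_seq sigma g w).
  move=> ij sf sg ik jk rf rg pu uf ug di dj.
  have su : size u = k by rewrite (perm_size pu) size_iota.
  have swk m v : size v = k -> size (swap m v) = k by rewrite size_bgen_seq.
  move: ij; rewrite leq_eqVlt => /orP[/eqP ij|].
    by subst j; rewrite (IH f g) // uf ug.
  rewrite leq_eqVlt => /orP[/eqP ij|ij].
    (* Adjacent descents: three consecutive letters of u decrease. The common tail [r] is an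
       expression of u with these three letters reversed. *)
    subst j; have d2 := ltn_trans dj di.
    have [|r rr or] := @reduced_exists k (swap i (swap i.+1 (swap i u))).
      by do 3!apply: perm_trans (perm_swap _ _) _.
    have or' : oneline k r = swap i.+1 (swap i (swap i.+1 u)).
      by rewrite or bgen_seq_braid ?su //; exact: flip_braided.
    have [||r1 o1] := @reduced_desc k (swap i.+1 (swap i u)) i r _ ik _ rr or.
    - by rewrite !swk.
    - by rewrite !nth_swap ?swk ?su // !adj_swapE.
    have [||r2 o2] := @reduced_desc k (swap i u) i.+1 (i :: r) _ jk _ r1 o1.
    - by rewrite !swk.
    - by rewrite !nth_swap ?swk ?su // !adj_swapE.
    have [||r3 o3] :=
      @reduced_desc k (swap i (swap i.+1 u)) i.+1 r _ jk _ rr or'.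
    - by rewrite !swk.
    - by rewrite !nth_swap ?swk ?su // !adj_swapE.
    have [||r4 o4] := @reduced_desc k (swap i.+1 u) i (i.+1 :: r) _ ik _ r3 o3.
    - by rewrite !swk.
    - by rewrite !nth_swap ?swk ?su // !adj_swapE.
    rewrite (IH f _ sf rf r2) ?uf ?o2 // (IH g _ sg rg r4) ?ug ?o4 //.
    by rewrite /= bgen_seq_braid // size_bword_seq wk.
  (* Distant descents: here [r] is an expression of u with both descents undone. *)
  have [|r rr or] := @reduced_exists k (swap j (swap i u)).
    by do 2!apply: perm_trans (perm_swap _ _) _.
  have [||r1 o1] := @reduced_desc k (swap i u) j r _ jk _ rr or.
  - by rewrite !swk.
  - have ij' := ltnW ij.
    by rewrite !nth_swap ?su // !adj_swap_id // gtn_eqF // ltnW.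
  have or' : oneline k r = swap i (swap j u) by rewrite or -bgen_seq_far.
  have [||r2 o2] := @reduced_desc k (swap j u) i r _ ik _ rr or'.
  - by rewrite !swk.
  - have ij' := ltnW ij.
    by rewrite !nth_swap ?su // !adj_swap_id // ltn_eqF // ltnW.
  rewrite (IH f _ sf rf r1) ?uf ?o1 // (IH g _ sg rg r2) ?ug ?o2 //.
  exact: bgen_seq_far.
case: e e' se se' re re' eq => [|i f] [|j g] // [sf] [].
rewrite sf => sg re re' eq.
have [ik rf di] := reduced_cons re; have [jk rg dj] := reduced_cons re'.
have pu := perm_oneline k (i :: f).
have uf : oneline k f = swap i (oneline k (i :: f)).
  by rewrite /bword_seq /= swapK.
have ug : oneline k g = swap j (oneline k (i :: f)).
  by rewrite eq /bword_seq /= swapK.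
rewrite -eq in dj.
case: (leqP i j) => [ij|/ltnW ij].
  exact: key ij sf sg ik jk rf rg pu uf ug di dj.
exact/esym/(key _ _ _ _ _ ij sg sf jk ik rg rf pu ug uf dj di).
Qed.
End Matsumoto.

(** * Length and expressions of permutations *)

Section PermWords.
Variable k : nat.
Implicit Types (s : 'S_k) (e : seq nat).

(** The one-line notation of the inverse: letter x stands at place s x, which is what moving the
    letters along s produces. *)
Definition pcode s : seq nat := [seq val ((s^-1)%g x) | x <- enum 'I_k].

Lemma size_pcode s : size (pcode s) = k.
Proof. by rewrite size_map size_enum_ord. Qed.

Lemma nth_pcode s (x : 'I_k) : nth 0%N (pcode s) (s x) = x.
Proof. by rewrite (nth_map x) ?size_enum_ord // nth_ord_enum permK. Qed.

Lemma perm_pcode s : perm_eq (pcode s) (iota 0 k).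
Proof.
rewrite -val_enum_ord /pcode (map_comp val); apply: perm_map.
apply: uniq_perm; rewrite ?enum_uniq //.
  by rewrite map_inj_uniq ?enum_uniq //; exact: perm_inj.
move=> x; rewrite mem_enum; apply/mapP; exists (s x); rewrite ?mem_enum //.
by rewrite permK.
Qed.

Lemma foldr_adj_swap_lt e x : valid k e -> (x < k)%N ->
  (foldr adj_swap x e < k)%N.
Proof. by elim: e => //= i e IH /andP[ik /IH{}IH] /IH; exact: adj_swap_lt. Qed.

Lemma nth_oneline e x : valid k e -> (x < k)%N ->
  nth 0%N (oneline k e) (foldr adj_swap x e) = x.
Proof.
elim: e => [_ xk|i e IH] /=; first by rewrite nth_iota.
by move=> /andP[ik ve] xk; rewrite nth_swap ?size_oneline // adj_swapK IH.
Qed.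

Lemma expressesP s e : valid k e ->
  expresses s e <-> oneline k e = pcode s.
Proof.
move=> ve; split=> [[_ se]|oe].
  apply: (@eq_from_nth _ 0%N) => [|m];
    rewrite size_oneline ?size_pcode // => mk.
  have [x ->] : exists x : 'I_k, m = s x.
    by exists ((s^-1)%g (Ordinal mk)); rewrite permKV.
  by rewrite nth_pcode se nth_oneline.
split=> // x; have yk := foldr_adj_swap_lt ve (ltn_ord x).
have := nth_pcode s ((s^-1)%g (Ordinal yk)).
rewrite permKV /= -oe nth_oneline // => /val_inj xE.
suff -> : s x = Ordinal yk by [].
by apply: (@perm_inj _ (s^-1)%g); rewrite permK.
Qed.

Lemma expresses_valid s e : expresses s e -> valid k e.
Proof. by case. Qed.

(** An expression found by sorting is shortest, since the inversions bound every length from below.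
    Hence the set given to [xget] is inhabited. *)
Lemma reduced_exprP s :
  expresses s (reduced_expr s) /\ perm_len s = inversions (pcode s).
Proof.
have [e [ve oe se]] := oneline_exists (perm_pcode s).
have ese : expresses s e by apply/expressesP.
have shortest : shortest_expr s e.
  split=> // e' [ve' /(conj ve')/(expressesP _ ve') oe'].
  by rewrite se -oe' inv_oneline.
have [es min] := xgetPex [::] (ex_intro _ e shortest).
split=> //; apply/eqP; rewrite eqn_leq -{1}se min //=.
have vs := expresses_valid es.
by rewrite -((expressesP _ vs).1 es) inv_oneline.
Qed.

Lemma expresses_reduced s e : expresses s e -> size e = perm_len s ->
  reduced k e.
Proof.
move=> es; rewrite (reduced_exprP s).2 /reduced (expresses_valid es) => ->.
by rewrite ((expressesP _ (expresses_valid es)).1 es) /=.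
Qed.

Lemma perm_len_le s e : expresses s e -> (perm_len s <= size e)%N.
Proof.
move=> es; rewrite (reduced_exprP s).2.
by rewrite -((expressesP _ (expresses_valid es)).1 es) inv_oneline //;
  exact: expresses_valid es.
Qed.

Lemma expresses_rev s e : expresses s e -> expresses (s^-1)%g (rev e).
Proof.
move=> [ve se]; split=> [|x]; first by rewrite all_rev.
have inv_e m : foldr adj_swap (foldr adj_swap m (rev e)) e = m.
  elim: e {ve se} m => //= i e IH m; rewrite rev_cons -cats1 foldr_cat /= IH.
  exact: adj_swapK.
have vr : valid k (rev e) by rewrite all_rev.
have yk := foldr_adj_swap_lt vr (ltn_ord x).
rewrite -[RHS]/(val (Ordinal yk)); congr val; apply: (@perm_inj _ s).
by rewrite permKV; apply: val_inj; rewrite /= se /= inv_e.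
Qed.

Lemma perm_lenV s : perm_len (s^-1)%g = perm_len s.
Proof.
have le (t : 'S_k) : (perm_len (t^-1)%g <= perm_len t)%N.
  have /perm_len_le := expresses_rev (reduced_exprP t).1.
  by rewrite size_rev.
by apply/eqP; rewrite eqn_leq le -{1}[s]invgK le.
Qed.

Lemma perm_len1 : perm_len (1%g : 'S_k) = 0%N.
Proof.
apply/eqP; rewrite -leqn0; apply: (@perm_len_le _ [::]).
by split=> // x; rewrite perm1.
Qed.

Lemma reduced_expr_nil s : reduced_expr s = [::] -> s = 1%g.
Proof.
move=> s0; have [[_ se] _] := reduced_exprP s.
by apply/perm.permP => x; apply: val_inj; rewrite /= se s0 perm1.
Qed.

Definition adj_perm j (jk : (j.+1 < k)%N) : 'S_k :=
  tperm (Ordinal (ltnW jk)) (Ordinal jk).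

Lemma adj_permE j (jk : (j.+1 < k)%N) x : adj_perm jk x = adj_swap j x :> nat.
Proof.
rewrite /adj_perm /adj_swap.
case: tpermP => [->|->|/eqP xj /eqP xj1] /=; rewrite ?eqxx //.
  by rewrite gtn_eqF.
by rewrite -!val_eqE /= in xj xj1; rewrite (negPf xj) (negPf xj1).
Qed.

Lemma adj_permK j (jk : (j.+1 < k)%N) : (adj_perm jk * adj_perm jk = 1)%g.
Proof. by rewrite /adj_perm tperm2. Qed.

(** In [s * t] the factor s acts first, whereas the last letter of an expression acts first; right
    multiplication thus adds a letter on the left. *)
Lemma expresses_mulr s e j (jk : (j.+1 < k)%N) : expresses s e ->
  expresses (s * adj_perm jk)%g (j :: e).
Proof.
move=> [ve se]; split=> [|x]; first by rewrite /= jk.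
by rewrite permM adj_permE se.
Qed.

Lemma expresses_mull s e j (jk : (j.+1 < k)%N) : expresses s e ->
  expresses (adj_perm jk * s)%g (rcons e j).
Proof.
move=> [ve se]; split=> [|x]; first by rewrite all_rcons jk.
by rewrite permM se adj_permE -cats1 foldr_cat.
Qed.

Lemma perm_len_mulr s j (jk : (j.+1 < k)%N) :
  perm_len (s * adj_perm jk)%g = (perm_len s).+1 \/
  perm_len s = (perm_len (s * adj_perm jk)%g).+1.
Proof.
have es := (reduced_exprP s).1; have es' := expresses_mulr jk es.
rewrite !(reduced_exprP _).2.
rewrite -((expressesP _ (expresses_valid es')).1 es').
rewrite -((expressesP _ (expresses_valid es)).1 es).
by apply: inv_swap_cases; rewrite ?uniq_oneline ?size_oneline.
Qed.

Lemma perm_len_mull s j (jk : (j.+1 < k)%N) :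
  perm_len (adj_perm jk * s)%g = (perm_len s).+1 \/
  perm_len s = (perm_len (adj_perm jk * s)%g).+1.
Proof.
rewrite -(perm_lenV s) -(perm_lenV (_ * s)%g) invMg.
rewrite (_ : (adj_perm jk)^-1 = adj_perm jk)%g; first exact: perm_len_mulr.
by rewrite /adj_perm tpermV.
Qed.

End PermWords.

Section PermAct.
Variables (X : choiceType) (sigma : X * X -> X * X).
Hypothesis sigma_braided : braided sigma.
Variable k : nat.
Implicit Types (s : 'S_k) (w : k.-tuple X).

(** Matsumoto's theorem makes T_s independent of the expression chosen by [reduced_expr]. *)
Lemma perm_actE s e w : expresses s e -> size e = perm_len s ->
  perm_act sigma s w = bword sigma e w.
Proof.
move=> es se; apply: val_inj; rewrite /= !val_bword.
have es' := (reduced_exprP s).1.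
apply: (@matsumoto _ _ sigma_braided k); rewrite ?size_tuple //.
- exact: expresses_reduced es' _.
- exact: expresses_reduced es se.
- rewrite ((expressesP _ (expresses_valid es)).1 es).
  by rewrite ((expressesP _ (expresses_valid es')).1 es').
Qed.

(** Only when the length grows does the longer expression stay reduced; sigma does not square to the
    identity. *)
Lemma perm_act_mulr s j (jk : (j.+1 < k)%N) w :
  perm_len (s * adj_perm jk)%g = (perm_len s).+1 ->
  perm_act sigma (s * adj_perm jk)%g w = bgen sigma j (perm_act sigma s w).
Proof.
move=> len; rewrite (@perm_actE _ (j :: reduced_expr s)) //.
exact/expresses_mulr/(reduced_exprP s).1.
Qed.

Lemma perm_act_mull s j (jk : (j.+1 < k)%N) w :
  perm_len (adj_perm jk * s)%g = (perm_len s).+1 ->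
  perm_act sigma (adj_perm jk * s)%g w = perm_act sigma s (bgen sigma j w).
Proof.
move=> len; rewrite (@perm_actE _ (rcons (reduced_expr s) j)).
- by rewrite -cats1 bword_cat.
- exact/expresses_mull/(reduced_exprP s).1.
- by rewrite size_rcons len.
Qed.

Lemma perm_act1 w : perm_act sigma 1%g w = w.
Proof.
by rewrite (@perm_actE _ [::]) ?perm_len1 //; split=> // x; rewrite perm1.
Qed.

End PermAct.

(** * Outer faces and merged entries of tuples *)

Section Tuples.
Context {T : Type}.

Lemma tnth_rcons_ord0 k (s : k.+1.-tuple T) b :
  tnth (rcons_tuple s b) ord0 = tnth s ord0.
Proof. by rewrite !(tnth_nth b) /= nth_rcons size_tuple. Qed.

Lemma tnth_rcons_max k (s : k.-tuple T) b :
  tnth (rcons_tuple s b) ord_max = b.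
Proof. by rewrite !(tnth_nth b) /= nth_rcons size_tuple ltnn eqxx. Qed.

Lemma val_tbehead k (s : k.+1.-tuple T) : tval (tbehead s) = behead s.
Proof.
have x0 := tnth s ord0; apply: (@eq_from_nth _ x0) => [|i].
  by rewrite size_behead !size_tuple.
rewrite size_tuple => ik; rewrite nth_behead.
by rewrite -[i]/(Ordinal ik : nat) nth_mktuple (tnth_nth x0) lift0.
Qed.

Lemma val_tbelast k (s : k.+1.-tuple T) : tval (tbelast s) = take k s.
Proof.
have x0 := tnth s ord0; apply: (@eq_from_nth _ x0) => [|i].
  by rewrite size_take !size_tuple leqnn.
rewrite size_tuple => ik; rewrite nth_take //.
rewrite -[i]/(Ordinal ik : nat) nth_mktuple (tnth_nth x0) /=.
by rewrite /bump leqNgt ik.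
Qed.

Lemma tbehead_rcons k (s : k.+1.-tuple T) b :
  tbehead (rcons_tuple s b) = (rcons_tuple (tbehead s) b).
Proof.
apply: val_inj => /=; rewrite !val_tbehead /=.
by case: s => -[].
Qed.

Lemma tbelast_rcons k (s : k.-tuple T) b :
  tbelast (rcons_tuple s b) = s.
Proof.
apply: val_inj => /=; rewrite val_tbelast /= -cats1 take_size_cat //.
by rewrite size_tuple.
Qed.

Lemma rcons_tbelast k (s : k.+1.-tuple T) :
  (rcons_tuple (tbelast s) (tnth s ord_max)) = s.
Proof.
apply: val_inj => /=; rewrite val_tbelast (tnth_nth (tnth s ord0)) /=.
by rewrite -take_nth ?size_tuple // take_oversize // size_tuple.
Qed.

Lemma val_rcons_tuple k (s : k.-tuple T) b : tval (rcons_tuple s b) = rcons s b.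
Proof. by []. Qed.

Lemma tuple_rconsP k (s : k.+1.-tuple T) :
  exists (s' : k.-tuple T) b, s = rcons_tuple s' b.
Proof. by exists (tbelast s), (tnth s ord_max); rewrite rcons_tbelast. Qed.

End Tuples.

Section TupleMerge.
Context {S : monoidType}.

Lemma tnth_tmerge k j (s : k.+1.-tuple S) x0 i :
  tnth (tmerge j s) i = (if i < j then nth x0 s i
    else if i == j :> nat then (nth x0 s i * nth x0 s i.+1)%g
    else nth x0 s i.+1)%N.
Proof.
rewrite tnth_mktuple !(tnth_nth x0) /= /bump leq0n add1n.
by rewrite [(k <= i)%N]leqNgt ltn_ord.
Qed.

Lemma tmerge_rcons k (s : k.+1.-tuple S) b (j : 'I_k) :
  tmerge j (rcons_tuple s b) = (rcons_tuple (tmerge j s) b).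
Proof.
apply: eq_from_tnth => i; rewrite (tnth_tmerge _ _ b).
rewrite (tnth_nth b) /= !nth_rcons !size_tuple card_ord ltn_ord !ltnS.
have ij := ltn_ord j; case: (ltnP i k) => [ik|ki].
  rewrite (_ : nth b (tmerge j s) i = tnth (tmerge j s) (Ordinal ik)).
    by rewrite (tnth_tmerge _ _ b).
  by rewrite (tnth_nth b).
have -> : i = k :> nat by apply/eqP; rewrite eqn_leq ki -ltnS ltn_ord.
by rewrite !eqxx ltnNge (ltnW ij) /= gtn_eqF.
Qed.

Lemma tmerge_rcons_last k (s : k.+1.-tuple S) b :
  tmerge k (rcons_tuple s b) =
  (rcons_tuple (tbelast s) (tnth s ord_max * b)%g).
Proof.
apply: eq_from_tnth => i; rewrite (tnth_tmerge _ _ b) (tnth_nth b) /=.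
rewrite val_tbelast !nth_rcons size_takel ?size_tuple // ltn_ord.
case: (ltngtP i k) => [ik|ki|ik].
- by rewrite nth_take.
- by have := ltn_ord i; rewrite ltnS leqNgt ki.
- by rewrite ik ltnn eqxx (tnth_nth b).
Qed.

End TupleMerge.

Lemma foldr_adj_swap_revK e m :
  foldr adj_swap (foldr adj_swap m e) (rev e) = m.
Proof.
elim/last_ind: e m => //= e i IH m; rewrite rev_rcons /= -cats1 foldr_cat /= IH.
exact: adj_swapK.
Qed.

Lemma foldr_adj_swap_iota m n : foldr adj_swap (m + n)%N (iota m n) = m.
Proof.
elim: n m => [|n IH] m /=; first by rewrite addn0.
by rewrite addnS -addSn IH adj_swapE.
Qed.

(** Together with [foldr_adj_swap_iota]: the product is the cycle that brings place m + n to m and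
    keeps the other places, enumerated by [bump], in order. *)
Lemma foldr_adj_swap_iota_bump m n y :
  foldr adj_swap (bump (m + n) y) (iota m n) = bump m y.
Proof.
elim: n m => [|n IH] m /=; first by rewrite addn0.
rewrite addnS -addSn IH /bump; case: (ltngtP m y) => [my|ym|->].
- by rewrite add1n adj_swap_id // gtn_eqF // ltnS // ltnW.
- by rewrite add0n adj_swap_id // ltn_eqF // leqW.
- by rewrite add0n add1n adj_swapE.
Qed.

Lemma foldr_adj_swap_shift y e :
  foldr adj_swap y.+1 (map S e) = (foldr adj_swap y e).+1.
Proof. by elim: e => //= i e ->; rewrite adj_swapS. Qed.

Lemma foldr_adj_swap_shift0 e : foldr adj_swap 0 (map S e) = 0%N.
Proof. by elim: e => //= i e ->. Qed.

Lemma foldr_adj_swap_max k e : valid k e -> foldr adj_swap k e = k.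
Proof.
elim: e => //= i e IH /andP[ik /IH->].
by rewrite adj_swap_id // gtn_eqF // ltnW.
Qed.

Lemma valid_widen k e : valid k e -> valid k.+1 e.
Proof. by apply: sub_all => i; exact: leqW. Qed.

(** * Permutations sorted by the letter that they move to an end *)

Section LiftPerm.
Variable k : nat.
Implicit Types (s : 'S_k) (i : 'I_k.+1).

Lemma ordSP i x : x = i \/ exists y : 'I_k, x = lift i y.
Proof. by case: (unliftP i x) => [y ->|->]; [right; exists y|left]. Qed.

(** First the cycle [iota 0 i] pulls place i to the front, then s permutes the other places. By
    [perm_len_lift0] the lengths add, so T factors in the same way. *)
Lemma expresses_lift0 i s e : expresses s e ->
  expresses (lift_perm i ord0 s) (map S e ++ iota 0 i).
Proof.
move=> [ve se]; split=> [|x].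
  rewrite all_cat all_map ve; apply/allP => j; rewrite mem_iota add0n => /= ji.
  exact: leq_ltn_trans ji (ltn_ord i).
rewrite foldr_cat; have [->|[y ->]] := ordSP i x.
  by rewrite lift_perm_id -{1}[val i]add0n foldr_adj_swap_iota
    foldr_adj_swap_shift0.
rewrite lift_perm_lift /= -{1}[val i]add0n foldr_adj_swap_iota_bump.
by rewrite /bump !leq0n !add1n se foldr_adj_swap_shift.
Qed.

Lemma expresses_lift_max i s e : expresses s e ->
  expresses (lift_perm i ord_max s) (e ++ rev (iota i (k - i))).
Proof.
move=> [ve se]; have ik : (i <= k)%N by rewrite -ltnS.
split=> [|x].
  rewrite all_cat valid_widen //= all_rev; apply/allP => j.
  by rewrite mem_iota subnKC // => /andP[_ jk].
rewrite foldr_cat; have [->|[y ->]] := ordSP i x.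
  rewrite lift_perm_id /= -{1}(foldr_adj_swap_iota i (k - i)).
  by rewrite foldr_adj_swap_revK subnKC // foldr_adj_swap_max.
rewrite lift_perm_lift /= -(foldr_adj_swap_iota_bump i (k - i)).
have bumpk z : (z < k)%N -> bump k z = z by rewrite /bump ltnNge => /negPf->.
by rewrite foldr_adj_swap_revK subnKC // !bumpk ?ltn_ord.
Qed.

Lemma inversions_map f u : {mono f : x y / (x < y)%N} ->
  inversions (map f u) = inversions u.
Proof.
move=> fm; elim: u => //= x u ->; congr (_ + _)%N.
by rewrite count_map; apply: eq_count => y /=; rewrite fm.
Qed.

Lemma bump_lt i : {mono bump i : x y / (x < y)%N}.
Proof. by move=> x y; rewrite !ltnNge leq_bump2. Qed.

Lemma inversions_rcons u x :
  inversions (rcons u x) = (inversions u + count (fun y => x < y) u)%N.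
Proof.
elim: u => //= y u ->; rewrite -cats1 count_cat /= addn0.
exact: addnACA.
Qed.

Lemma count_ltn_iota n m : (m <= n)%N ->
  count (fun y => y < m)%N (iota 0 n) = m.
Proof.
move=> mn; rewrite -(subnKC mn) iotaD count_cat.
rewrite (eq_in_count (a2 := xpredT)) ?count_predT ?size_iota; last first.
  by move=> y; rewrite mem_iota.
rewrite (eq_in_count (a2 := xpred0)) ?count_pred0 ?addn0 // => y.
by rewrite mem_iota add0n => /andP[my _]; rewrite ltnNge my.
Qed.

Lemma pcode_lift0 i s :
  pcode (lift_perm i ord0 s) = (i : nat) :: map (bump i) (pcode s).
Proof.
rewrite /pcode lift_permV enum_ordSl /= lift_perm_id -!map_comp.
by congr cons; apply: eq_map => x; rewrite /= lift_perm_lift.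
Qed.

Lemma pcode_lift_max i s :
  pcode (lift_perm i ord_max s) = rcons (map (bump i) (pcode s)) (i : nat).
Proof.
rewrite /pcode lift_permV enum_ordSr map_rcons lift_perm_id -!map_comp.
congr rcons; apply: eq_map => x /=.
rewrite (_ : widen_ord _ x = lift ord_max x) ?lift_perm_lift //.
by apply: val_inj; rewrite /= /bump leqNgt ltn_ord.
Qed.

(** The letter i, put first, is inverted with the i smaller letters; the monotone relabelling [bump]
    keeps the inversions of the rest. *)
Lemma perm_len_lift0 i s :
  perm_len (lift_perm i ord0 s) = (i + perm_len s)%N.
Proof.
rewrite !(reduced_exprP _).2 pcode_lift0 /= (inversions_map _ (@bump_lt i)).
congr (_ + _)%N; rewrite count_map.
rewrite (eq_count (a2 := fun y => y < i)%N).
  by rewrite (seq.permP (perm_pcode s)) count_ltn_iota // -ltnS.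
move=> y /=; rewrite /bump; case: (leqP i y) => iy; last by rewrite add0n.
by rewrite add1n ltnNge (leq_trans iy).
Qed.

(** Put last, the letter i is inverted with the k - i larger letters. *)
Lemma perm_len_lift_max i s :
  perm_len (lift_perm i ord_max s) = (perm_len s + (k - i))%N.
Proof.
rewrite !(reduced_exprP _).2 pcode_lift_max inversions_rcons.
rewrite (inversions_map _ (@bump_lt i)).
congr (_ + _)%N; rewrite count_map.
have ik : (i <= k)%N by rewrite -ltnS.
rewrite (eq_count (a2 := predC (fun y => y < i)%N)); last first.
  move=> y /=; rewrite /bump -leqNgt; case: (leqP i y) => iy.
    by rewrite add1n ltnS.
  by rewrite add0n ltnNge (ltnW iy).
have := count_predC (fun y => y < i)%N (pcode s).
rewrite (seq.permP (perm_pcode s)) count_ltn_iota // size_pcode => eq.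
by apply/eqP; rewrite -(eqn_add2l i) subnKC // eq.
Qed.

(** Each permutation sends exactly one i to j. The reindexing is bijective as an injection between
    finite sets of the same cardinal. *)
Lemma sum_lift_perm (V : zmodType) (j : 'I_k.+1) (F : 'S_k.+1 -> V) :
  \sum_s F s = \sum_i \sum_(s : 'S_k) F (lift_perm i j s).
Proof.
rewrite pair_bigA /=.
have inj : injective (fun p : 'I_k.+1 * 'S_k => lift_perm p.1 j p.2).
  move=> [i s] [i' s'] /= eq.
  have ii' : i = i'.
    apply: (@perm_inj _ (lift_perm i j s)).
    by rewrite {2}eq !lift_perm_id.
  rewrite -{}ii' in eq *; congr pair; apply/perm.permP => x.
  by apply: (@lift_inj _ j); rewrite -!(lift_perm_lift i) eq.
apply: reindex; apply: onW_bij; apply: inj_card_bij inj _.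
by rewrite card_prod card_ord !card_Sn factS.
Qed.

End LiftPerm.

Section PermActLift.
Variables (X : choiceType) (sigma : X * X -> X * X).
Hypothesis sigma_braided : braided sigma.
Variable k : nat.
Implicit Types (s : 'S_k) (i : 'I_k.+1) (w : k.+1.-tuple X).

Lemma bword_shift e w :
  tnth (bword sigma (map S e) w) ord0 = tnth w ord0 /\
  tbehead (bword sigma (map S e) w) = bword sigma e (tbehead w).
Proof.
have x0 := tnth w ord0; split.
  rewrite !(tnth_nth x0) val_bword; case: w => -[|x v] //= _.
  by rewrite bword_seq_shift.
apply: val_inj; rewrite /= val_tbehead !val_bword val_tbehead.
by case: w => -[|x v] //= _; rewrite bword_seq_shift.
Qed.

Lemma bword_widen e w : valid k e ->
  tnth (bword sigma e w) ord_max = tnth w ord_max /\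
  tbelast (bword sigma e w) = bword sigma e (tbelast w).
Proof.
have [v [x ->]] := tuple_rconsP w => ve; rewrite tnth_rcons_max tbelast_rcons.
have -> : bword sigma e (rcons_tuple v x) = rcons_tuple (bword sigma e v) x.
  by apply: val_inj => /=; rewrite !val_bword bword_seq_rcons ?size_tuple.
by rewrite tnth_rcons_max tbelast_rcons.
Qed.

Lemma perm_act_lift0 i s w :
  let t := perm_act sigma (lift_perm i ord0 s) w in
  tnth t ord0 = tnth (pull_left sigma i w) ord0 /\
  tbehead t = perm_act sigma s (tbehead (pull_left sigma i w)).
Proof.
rewrite /=
  (@perm_actE _ _ sigma_braided _ _ (map S (reduced_expr s) ++ iota 0 i)).
- by rewrite bword_cat; exact: bword_shift.
- exact/expresses_lift0/(reduced_exprP s).1.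
- by rewrite size_cat size_map size_iota perm_len_lift0 addnC.
Qed.

Lemma perm_act_lift_max i s w :
  let t := perm_act sigma (lift_perm i ord_max s) w in
  tnth t ord_max = tnth (pull_right sigma i w) ord_max /\
  tbelast t = perm_act sigma s (tbelast (pull_right sigma i w)).
Proof.
rewrite /= (@perm_actE _ _ sigma_braided _ _
  (reduced_expr s ++ rev (iota i (k - i)))).
- by rewrite bword_cat; apply/bword_widen/expresses_valid/(reduced_exprP s).1.
- exact/expresses_lift_max/(reduced_exprP s).1.
- by rewrite size_cat size_rev size_iota perm_len_lift_max.
Qed.

End PermActLift.

Lemma bgen_seq_last (X : choiceType) (sigma : X * X -> X * X) u x y :
  bgen_seq sigma (size u) (rcons (rcons u x) y) =
  rcons (rcons u (sigma (x, y)).1) (sigma (x, y)).2.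
Proof. by elim: u => //= z u ->. Qed.

(** The last generator applied meets the still untouched letter y, so the two letters at the end
    come from one value of sigma. [kos_up] uses this to see that such a face cannot be moved up. *)
Lemma pull_right_rcons (X : choiceType) (sigma : X * X -> X * X) k i
    (w : k.-tuple X) y : (i < k)%N -> exists u x,
  tval (tbelast (pull_right sigma i (rcons_tuple w y))) =
    rcons u (sigma (x, y)).1 /\
  tnth (pull_right sigma i (rcons_tuple w y)) ord_max = (sigma (x, y)).2.
Proof.
case: k w => // k w; rewrite ltnS => ik.
have -> : pull_right sigma i (rcons_tuple w y) =
    bgen sigma k (rcons_tuple (bword sigma (rev (iota i (k - i))) w) y).
  apply: val_inj; rewrite /pull_right subSn // -(addn1 (k - i)) iotaD rev_cat.
  rewrite subnKC //= !(val_bword, val_rcons_tuple) bword_seq_rcons // all_rev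
    size_tuple.
  by apply/allP => j; rewrite mem_iota subnKC // ltnS => /andP[].
have [v [x ->]] := tuple_rconsP (bword sigma (rev (iota i (k - i))) w).
exists v, x; set t := bgen sigma k _.
have et : tval t = rcons (rcons v (sigma (x, y)).1) (sigma (x, y)).2.
  have := bgen_seq_last sigma v x y; rewrite (size_tuple v) => <-.
  by [].
rewrite val_tbelast (tnth_nth y) et; split.
  by rewrite -cats1 take_size_cat // size_rcons size_tuple.
by rewrite nth_rcons size_rcons size_tuple ltnn eqxx.
Qed.

(** * Normal forms in the structure monoid *)

Section NormalForms.
Variables (X : choiceType) (sigma : X * X -> X * X).
Hypothesis sigma_braided : braided sigma.
Hypothesis sigma_idem : forall p, sigma (sigma p) = sigma p.

(* E is either empty or reduced to the pseudo-unit *)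
Variable E : pred X.
Hypothesis E_sigma : forall e, E e -> forall x,
  sigma (e, x) \in [:: (e, x); (x, e)] /\
  sigma (x, e) \in [:: (e, x); (x, e)].
Hypothesis E_normal : forall e, E e -> forall u v,
  normal_word sigma (u ++ e :: v) -> normal_word sigma (u ++ v).

Variable R : seq X -> seq X -> Prop.
Hypothesis R_def : forall u v, R u v <->
  struct_rel sigma u v \/ (exists2 e, E e & u = [:: e] /\ v = [::]).

Local Notation normal := (normal_word sigma).

(** One round of an insertion sort: x is pushed through w by sigma, changing on the way. *)
Fixpoint ins (x : X) (w : seq X) : seq X :=
  if w is y :: v then (sigma (x, y)).1 :: ins (sigma (x, y)).2 v else [:: x].

Lemma size_ins x v : size (ins x v) = (size v).+1.
Proof. by elim: v x => //= y v IH x; rewrite IH. Qed.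

(** This makes insertion compatible with the relation x y = y' x'. Along v it is the braid relation,
    and at the end of v it is idempotence. *)
Lemma ins_ins x y v :
  ins x (ins y v) = ins (sigma (x, y)).1 (ins (sigma (x, y)).2 v).
Proof.
elim: v x y => [|z v IH] x y /=.
  by rewrite -surjective_pairing sigma_idem.
have := sigma_braided (x, y, z); rewrite /sigma_Id /Id_sigma.
case: (sigma (x, y)) => a c; case: (sigma (y, z)) => d e /=.
case: (sigma (c, z)) => f g; case: (sigma (x, d)) => h l /=.
case eaf: (sigma (a, f)) => [p q]; case ele: (sigma (l, e)) => [r s] /=.
by case=> -> qr gs; rewrite IH ele /= -qr -gs.
Qed.

Lemma normal_cons x y v :
  normal (x :: y :: v) = (sigma (x, y) == (x, y)) && normal (y :: v).
Proof. by []. Qed.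

(** When sigma fixes (y, z), the braid relation at (x, y, z) says that sigma fixes the first two
    letters left behind by x; at the end of the word idempotence takes over. *)
Lemma normal_ins x v : normal v -> normal (ins x v).
Proof.
elim: v x => [|y v IH] x // nv; have nv' : normal v := path_sorted nv.
have := IH (sigma (x, y)).2 nv'; case: v nv {nv' IH} => [|z v] nv.
  by move=> _ /=; rewrite /normal_word /= -surjective_pairing sigma_idem eqxx.
rewrite ![ins _ (_ :: _)]/= normal_cons => ->; rewrite andbT.
move: nv => /= /andP[/eqP yz _].
have := sigma_braided (x, y, z); rewrite /sigma_Id /Id_sigma yz.
case: (sigma (x, y)) => a c /=; case: (sigma (c, z)) => f g /=.
by case: (sigma (a, f)) => [p q] [-> ->].
Qed.

Lemma ins_id x v : normal (x :: v) -> ins x v = x :: v.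
Proof.
by elim: v x => //= y v IH x /andP[/eqP-> nv]; rewrite /= IH.
Qed.

Definition del : seq X -> seq X := filter (predC E).

Arguments del : simpl never.

Lemma del_cons x v : del (x :: v) = if E x then del v else x :: del v.
Proof. by rewrite /del /=; case: (E x). Qed.

Lemma normal_del_cat u v : normal (u ++ v) -> normal (u ++ del v).
Proof.
elim: v u => // y v IH u; rewrite del_cons; case: ifP => [Ey|_] nv.
  exact/IH/(E_normal Ey).
by rewrite -cat_rcons; apply: IH; rewrite cat_rcons.
Qed.

Lemma normal_del v : normal v -> normal (del v).
Proof. exact: (@normal_del_cat [::]). Qed.

(** A pseudo-unit either stops before y, and the rest is already normal, or exchanges places with y
    and goes on. *)
Lemma del_ins_E e v : E e -> normal v -> del (ins e v) = del v.
Proof.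
move=> Ee; elim: v => [|y v IH] nv /=; first by rewrite del_cons Ee.
have nv' : normal v := path_sorted nv.
have [+ _] := E_sigma Ee y; rewrite !inE => /orP[]/eqP-> /=.
  by rewrite del_cons Ee ins_id.
by rewrite !del_cons IH.
Qed.

Lemma del_idem v : del (del v) = del v.
Proof. by rewrite /del filter_id. Qed.

(** On meeting a pseudo-unit, x either passes it unchanged or forms a fixed pair with it. In the
    second case x v remains normal without the pseudo-unit, by the second axiom, and insertion
    alters neither word. *)
Lemma del_ins_del x v : normal v -> del (ins x v) = del (ins x (del v)).
Proof.
elim: v x => // y v IH x nv; have nv' : normal v := path_sorted nv.
rewrite [del (y :: v)]del_cons /=; case: ifP => [Ey|_]; last first.
  by rewrite /= !del_cons IH.
have [_] := E_sigma Ey x; rewrite !inE => /orP[]/eqP xy; rewrite xy /=.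
  by rewrite del_cons Ey IH.
have nxy : normal (x :: y :: v) by rewrite normal_cons xy eqxx.
have nx : normal (x :: del v).
  by apply: (@normal_del_cat [:: x]); apply: (@E_normal _ Ey [:: x]).
rewrite [in RHS]ins_id // ins_id // !del_cons Ey.
by rewrite del_idem.
Qed.

Definition nf (w : seq X) : seq X := foldr (fun x v => del (ins x v)) [::] w.

Lemma normal_nf w : normal (nf w).
Proof.
case: w => //= x w; elim: w x => [|y w IH] x;
  by apply/normal_del/normal_ins => //=.
Qed.

Lemma del_nf w : del (nf w) = nf w.
Proof. by case: w => //= x w; rewrite del_idem. Qed.

Lemma nfE w : all (predC E) (nf w).
Proof. by case: w => //= x w; exact: filter_all. Qed.

Lemma nf_id w : normal w -> all (predC E) w -> nf w = w.
Proof.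
elim: w => //= x w IH nw /andP[Ex Ew].
rewrite (IH (path_sorted nw) Ew) ins_id // del_cons (negPf Ex); congr cons.
exact/all_filterP.
Qed.

(** As [nf] is a fold, a relation inside a word has to be checked only in front of the normal form
    of what follows it. *)
Lemma nf_cong u v : word_cong R u v -> nf u = nf v.
Proof.
elim=> // [u' a b v' ab|u1 u2 u3 _ -> _ -> //].
rewrite /nf !foldr_cat -/(nf v'); congr foldr.
move: ab => /R_def[[x [y [-> ->]]]|[e Ee [-> ->]]] /=.
  by rewrite -!del_ins_del ?normal_ins ?normal_nf // ins_ins.
by rewrite del_ins_E ?normal_nf // del_nf.
Qed.

Lemma ins_sound x v : word_cong R (ins x v) (x :: v).
Proof.
elim: v x => [|y v IH] x /=; first exact: cong_refl.
apply: cong_trans (@cong_catl _ _ _ _ [:: (sigma (x, y)).1] (IH _)) _.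
apply: cong_sym; apply: (@cong_step _ _ [::] [:: x; y]
  [:: (sigma (x, y)).1; (sigma (x, y)).2] v).
by apply/R_def; left; exists x, y.
Qed.

Lemma del_sound v : word_cong R (del v) v.
Proof.
elim: v => [|y v IH]; first exact: cong_refl.
rewrite del_cons; case: ifP => [Ey|_]; last first.
  exact: (@cong_catl _ _ _ _ [:: y] IH).
apply: cong_trans IH (cong_sym _); apply: (@cong_step _ _ [::] [:: y] [::] v).
by apply/R_def; right; exists y.
Qed.

Lemma nf_sound w : word_cong R (nf w) w.
Proof.
elim: w => [|x w IH] /=; first exact: cong_refl.
apply: cong_trans (del_sound _) _; apply: cong_trans (ins_sound _ _) _.
exact: (@cong_catl _ _ _ _ [:: x] IH).
Qed.

Local Notation S := (presented R).

Definition nfS (s : S) : seq X := nf (repr s).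

Lemma normal_nfS s : normal (nfS s).
Proof. exact: normal_nf. Qed.

Lemma nfS_noE s : all (predC E) (nfS s).
Proof. exact: nfE. Qed.

Lemma nfS_pi w : nfS (\pi_S w) = nf w.
Proof. exact/nf_cong/repr_cong. Qed.

Lemma pi_nfS s : \pi_S (nfS s) = s.
Proof. by rewrite -[RHS]reprK; apply/presentedP/nf_sound. Qed.

Lemma nfS_gen_mul x (b : S) : nfS (gen R x * b)%g = del (ins x (nfS b)).
Proof.
by rewrite -{1}(pi_nfS b) [(_ * _)%g]pmul_pi nfS_pi /= nf_id ?normal_nf ?nfE.
Qed.

Lemma nfS_one : nfS (1%g : S) = [::].
Proof. exact: nfS_pi. Qed.

Lemma nfS_nil s : nfS s = [::] -> s = 1%g.
Proof. by move=> s0; rewrite -(pi_nfS s) s0. Qed.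

Lemma nfS_gen x : nfS (gen R x) = if E x then [::] else [:: x].
Proof. by rewrite nfS_pi /= del_cons. Qed.

Lemma gen_E e : E e -> gen R e = 1%g.
Proof. by move=> Ee; apply: nfS_nil; rewrite nfS_gen Ee. Qed.

Lemma gen_sigma x y : (gen R x * gen R y =
  gen R (sigma (x, y)).1 * gen R (sigma (x, y)).2 :> S)%g.
Proof.
rewrite [LHS]pmul_pi [RHS]pmul_pi; apply/presentedP.
apply: (@cong_step _ _ [::] [:: x; y]
  [:: (sigma (x, y)).1; (sigma (x, y)).2] [::]).
by apply/R_def; left; exists x, y.
Qed.

End NormalForms.

(** * Free bimodules *)

Section Malg.
Context {K : choiceType}.

Lemma mliftU {M A : zmodType} (F : K -> {additive M -> A}) m w :
  mlift F << m *g w >> = F w m.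
Proof.
rewrite /mlift msuppU; case: eqP => [->|_].
  by rewrite big_seq_fset0 raddf0.
by rewrite big_seq_fset1 mcoeffUU.
Qed.

Lemma malg_addP {M A : zmodType} (f g : {additive {malg M[K]} -> A}) :
  (forall m w, f << m *g w >> = g << m *g w >>) -> f =1 g.
Proof.
move=> fg c; rewrite [c]monalgE !raddf_sum; apply: eq_bigr => w _; exact: fg.
Qed.

Lemma malg_intE (n : int) (w : K) : << n *g w >> = << w >> *~ n.
Proof. by rewrite -raddfMz intz. Qed.

Lemma malg_intP {A : zmodType} (f g : {additive {malg int[K]} -> A}) :
  (forall w, f << w >> = g << w >>) -> f =1 g.
Proof.
by move=> fg; apply: malg_addP => m w; rewrite malg_intE !raddfMz fg.
Qed.

Lemma linearize_additive {A : zmodType} (f : K -> A) :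
  zmod_morphism (@linearize K A f).
Proof.
have h w : zmod_morphism (fun n : int => f w *~ n).
  by move=> m n; rewrite mulrzBr.
pose ad w := GRing.isZmodMorphism.Build int A _ (h w).
pose F w : {additive int -> A} := HB.pack (fun n : int => f w *~ n) (ad w).
exact: (@mlift_additive _ _ _ F).
Qed.
HB.instance Definition _ (A : zmodType) (f : K -> A) :=
  GRing.isZmodMorphism.Build _ _ (@linearize K A f) (linearize_additive f).

Lemma linearizeU {A : zmodType} (f : K -> A) w : linearize f << w >> = f w.
Proof.
rewrite /linearize /mlift msuppU; case: eqP => [//|_].
by rewrite big_seq_fset1 mcoeffUU.
Qed.

Lemma eq_linearize {A : zmodType} (f g : K -> A) :
  f =1 g -> linearize f =1 linearize g.
Proof. by move=> fg c; apply: eq_bigr => w _; rewrite fg. Qed.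

Lemma linearize_comp {A A' : zmodType} (g : {additive A -> A'}) (f : K -> A) c :
  g (linearize f c) = linearize (g \o f) c.
Proof.
by rewrite raddf_sum; apply: eq_bigr => w _; rewrite raddfMz.
Qed.

Lemma linearizeB {A : zmodType} (f g : K -> A) c :
  linearize (fun w => f w - g w) c = linearize f c - linearize g c.
Proof. by rewrite -sumrB; apply: eq_bigr => w _; rewrite mulrzBl. Qed.

Lemma linearizeD {A : zmodType} (f g : K -> A) c :
  linearize (fun w => f w + g w) c = linearize f c + linearize g c.
Proof. by rewrite -big_split; apply: eq_bigr => w _; rewrite mulrzDl. Qed.

(** The kernel of the projection onto the free module on the generators outside P; membership of a
    difference replaces equality in that quotient. *)
Definition badsupp {M : zmodType} (P : pred K) : {pred {malg M[K]}} :=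
  [pred c | all P (msupp c)].

Lemma badsuppP {M : zmodType} (P : pred K) (c : {malg M[K]}) :
  reflect (forall w, w \in msupp c -> P w) (c \in badsupp P).
Proof. exact: allP. Qed.

Lemma badsupp_zmod_closed {M : zmodType} P : zmod_closed (@badsupp M P).
Proof.
split=> [|x y /badsuppP xP /badsuppP yP]; first by rewrite !inE msupp0.
apply/badsuppP => w /(fsubsetP (msuppB_le x y)).
by rewrite inE => /orP[/xP|/yP].
Qed.
HB.instance Definition _ M P := GRing.isZmodClosed.Build _ (@badsupp M P)
  (badsupp_zmod_closed P).

Lemma badsuppU {M : zmodType} (P : pred K) (m : M) w :
  P w -> << m *g w >> \in badsupp P.
Proof.
move=> Pw; apply/badsuppP => v; rewrite msuppU; case: ifP; rewrite ?inE //.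
by move=> _ /eqP->.
Qed.

Lemma badsuppS {M : zmodType} (P Q : pred K) (c : {malg M[K]}) :
  (forall w, P w -> Q w) -> c \in badsupp P -> c \in badsupp Q.
Proof. by move=> PQ /badsuppP cP; apply/badsuppP => w /cP/PQ. Qed.

Lemma badsupp0 {M : zmodType} (P : pred K) (c : {malg M[K]}) :
  (forall w, ~~ P w) -> c \in badsupp P -> c = 0.
Proof.
move=> P0 /badsuppP cP; apply/malgP => w; rewrite mcoeff0 mcoeff_outdom //.
by apply/negP => /cP; rewrite (negPf (P0 w)).
Qed.

Lemma badsupp_mlift {M A : zmodType} (P : pred K) (Q : zmodClosed A)
    (F : K -> M -> A) c :
  (forall w m, P w -> F w m \in Q) -> c \in badsupp P -> mlift F c \in Q.
Proof.
move=> FQ /badsuppP cP; rewrite /mlift big_seq; apply: rpred_sum => w /cP.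
exact: FQ.
Qed.

Lemma badsupp_linearize {A : zmodType} (P : pred K) (Q : zmodClosed A)
    (f : K -> A) c :
  (forall w, P w -> f w \in Q) -> c \in badsupp P -> linearize f c \in Q.
Proof.
by move=> fQ; apply: badsupp_mlift => w n Pw; rewrite rpredMz ?fQ.
Qed.

Lemma badsuppT {M : zmodType} (c : {malg M[K]}) : c \in badsupp xpredT.
Proof. exact/badsuppP. Qed.

End Malg.

Section FreeBimodules.
Variable S : monoidType.

(** The bimodule structure is given by [bimul], and bimodule maps are the maps [ext phi].
    Contractions are not bimodule maps and are built with [blin]. *)
Definition fbim (K : choiceType) : zmodType := {malg int[(S * K * S)%type]}.

(* the element a . w . b of the free S-bimodule on K *)
Definition bgen3 (K : choiceType) (a : S) (w : K) (b : S) : fbim K :=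
  << (a, w, b) >>.

Section Lift.
Variable K : choiceType.

Lemma fbimP {A : zmodType} (f g : {additive fbim K -> A}) :
  (forall a w b, f (bgen3 a w b) = g (bgen3 a w b)) -> f =1 g.
Proof. by move=> fg; apply: malg_intP => -[[a w] b]; exact: fg. Qed.

Definition blin {A : zmodType} (f : S -> K -> S -> A) (z : fbim K) : A :=
  linearize (fun t : S * K * S => f t.1.1 t.1.2 t.2) z.
Lemma blin_additive {A : zmodType} (f : S -> K -> S -> A) :
  zmod_morphism (blin f).
Proof. exact: linearize_additive. Qed.
HB.instance Definition _ (A : zmodType) f := GRing.isZmodMorphism.Build
  (fbim K) A (blin f) (blin_additive f).

Lemma blinU {A : zmodType} (f : S -> K -> S -> A) a w b :
  blin f (bgen3 a w b) = f a w b.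
Proof. exact: linearizeU. Qed.

Lemma eq_blin {A : zmodType} (f g : S -> K -> S -> A) :
  (forall a w b, f a w b = g a w b) -> blin f =1 blin g.
Proof. by move=> fg; apply: eq_linearize => -[[a w] b]; exact: fg. Qed.

Lemma blin_comp {A A' : zmodType} (g : {additive A -> A'})
    (f : S -> K -> S -> A) z :
  g (blin f z) = blin (fun a w b => g (f a w b)) z.
Proof. exact: linearize_comp. Qed.

Lemma blinB {A : zmodType} (f g : S -> K -> S -> A) z :
  blin (fun a w b => f a w b - g a w b) z = blin f z - blin g z.
Proof. exact: (linearizeB (fun t => f _ _ _) (fun t => g _ _ _)). Qed.

Lemma blinD {A : zmodType} (f g : S -> K -> S -> A) z :
  blin (fun a w b => f a w b + g a w b) z = blin f z + blin g z.
Proof. exact: (linearizeD (fun t => f _ _ _) (fun t => g _ _ _)). Qed.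

Definition bsupp (P : S -> K -> S -> bool) : {pred fbim K} :=
  badsupp (fun t : S * K * S => P t.1.1 t.1.2 t.2).
Lemma bsupp_zmod_closed P : zmod_closed (bsupp P).
Proof. exact: badsupp_zmod_closed. Qed.
HB.instance Definition _ P := GRing.isZmodClosed.Build (fbim K) (bsupp P)
  (bsupp_zmod_closed P).

Lemma bsuppU (P : S -> K -> S -> bool) a w b :
  P a w b -> bgen3 a w b \in bsupp P.
Proof. by move=> Pw; apply: badsuppU. Qed.

Lemma bsuppT (P : S -> K -> S -> bool) z :
  (forall a w b, P a w b) -> z \in bsupp P.
Proof. by move=> PT; apply: badsuppS (badsuppT z). Qed.

Lemma bsuppS (P Q : S -> K -> S -> bool) z :
  (forall a w b, P a w b -> Q a w b) -> z \in bsupp P -> z \in bsupp Q.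
Proof. by move=> PQ; apply: badsuppS => -[[a w] b]; exact: PQ. Qed.

Lemma bsupp0 (P : S -> K -> S -> bool) z :
  (forall a w b, ~~ P a w b) -> z \in bsupp P -> z = 0.
Proof. by move=> PQ; apply: badsupp0 => -[[a w] b]; exact: PQ. Qed.

Lemma bsupp_blin {A : zmodType} (P : S -> K -> S -> bool) (Q : zmodClosed A)
    (f : S -> K -> S -> A) z :
  (forall a w b, P a w b -> f a w b \in Q) -> z \in bsupp P -> blin f z \in Q.
Proof.
by move=> fQ; apply: badsupp_linearize => -[[a w] b]; exact: fQ.
Qed.

Lemma bsupp_additive {A : zmodType} (P : S -> K -> S -> bool)
    (Q : zmodClosed A) (f : {additive fbim K -> A}) z :
  (forall a w b, P a w b -> f (bgen3 a w b) \in Q) -> z \in bsupp P ->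
  f z \in Q.
Proof.
move=> fQ; rewrite (_ : f z = blin (fun a w b => f (bgen3 a w b)) z).
  exact: bsupp_blin.
by apply: (@fbimP _ f (blin _)) => a w b; rewrite /= blinU.
Qed.

Lemma blin_id z : blin (@bgen3 K) z = z.
Proof.
by apply: (@fbimP _ (blin (@bgen3 K)) idfun) => a w b; rewrite /= blinU.
Qed.

Lemma bsupp_split (P Q : S -> K -> S -> bool) z :
  z \in bsupp (fun a w b => P a w b || Q a w b) ->
  exists2 y, y \in bsupp P & z - y \in bsupp Q.
Proof.
move=> zPQ; exists (blin (fun a w b => if P a w b then bgen3 a w b else 0) z).
  apply: (@bsupp_blin _ (fun _ _ _ => true)) (bsuppT _ _) => // a w b _.
  by case: ifP => [Pw|_]; [exact: bsuppU|exact: rpred0].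
rewrite -{1}[z]blin_id -blinB; apply: bsupp_blin zPQ => a w b.
by case: ifP => [_ _|_ Qw]; [rewrite subrr rpred0|rewrite subr0 bsuppU].
Qed.

(** Finiteness of the support; it starts the induction in [kos_exact]. *)
Lemma bsupp_bounded (f : S -> nat) z :
  exists n, z \in bsupp (fun _ _ b => f b < n)%N.
Proof.
exists (\max_(t <- msupp z) f t.2).+1; apply/badsuppP => t tz.
by rewrite ltnS (@leq_bigmax_seq _ _ _ (fun t => f t.2)).
Qed.

Definition null (bad : pred K) : {pred fbim K} := bsupp (fun _ w _ => bad w).
HB.instance Definition _ (bad : pred K) :=
  GRing.isZmodClosed.Build (fbim K) (null bad) (bsupp_zmod_closed _).

Lemma nullU (bad : pred K) a w b : bad w -> bgen3 a w b \in null bad.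
Proof. by move=> bw; apply: bsuppU. Qed.

Definition bimul (a b : S) : fbim K -> fbim K :=
  blin (fun a' w b' => bgen3 (a * a')%g w (b' * b)%g).
HB.instance Definition _ a b := GRing.isZmodMorphism.Build (fbim K) (fbim K)
  (bimul a b) (blin_additive _).

Lemma bimulU a b a' (w : K) b' :
  bimul a b (bgen3 a' w b') = bgen3 (a * a')%g w (b' * b)%g.
Proof. exact: blinU. Qed.

Lemma bimul1 z : bimul 1%g 1%g z = z.
Proof.
apply: (@fbimP _ (bimul 1%g 1%g) idfun) => a w b.
by rewrite /= bimulU mul1g mulg1.
Qed.

Lemma bimulM a b a' b' z :
  bimul a b (bimul a' b' z) = bimul (a * a')%g (b' * b)%g z.
Proof.
apply: (@fbimP _ (bimul a b \o bimul a' b') (bimul _ _)) => c w d.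
by rewrite /= !bimulU !mulgA.
Qed.

Definition fgen (w : K) : fbim K := bgen3 1%g w 1%g.

Lemma bimul_fgen a b (w : K) : bimul a b (fgen w) = bgen3 a w b.
Proof. by rewrite bimulU mulg1 mul1g. Qed.

Lemma bimul_null (bad : pred K) a b z :
  z \in null bad -> bimul a b z \in null bad.
Proof. by apply: bsupp_blin => a' w b' bw; exact: nullU. Qed.

(** The augmentation onto Z[S]; it is applied in degree 0, where the only generator is the empty
    tuple. *)
Definition aug : fbim K -> {malg int[S]} :=
  blin (fun a w b => << (a * b)%g >>).
HB.instance Definition _ := GRing.isZmodMorphism.Build (fbim K) _ aug
  (blin_additive _).

Lemma augU a (w : K) b : aug (bgen3 a w b) = << (a * b)%g >>.
Proof. exact: blinU. Qed.

End Lift.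

Definition ext (K L : choiceType) (phi : K -> fbim L) : fbim K -> fbim L :=
  blin (fun a w b => bimul a b (phi w)).
HB.instance Definition _ (K L : choiceType) phi :=
  GRing.isZmodMorphism.Build (fbim K) (fbim L) (ext phi) (blin_additive _).

Lemma extU (K L : choiceType) (phi : K -> fbim L) a w b :
  ext phi (bgen3 a w b) = bimul a b (phi w).
Proof. exact: blinU. Qed.

Lemma ext_fgen (K L : choiceType) (phi : K -> fbim L) w :
  ext phi (fgen w) = phi w.
Proof. by rewrite extU bimul1. Qed.

Lemma ext_bimul (K L : choiceType) (phi : K -> fbim L) a b z :
  ext phi (bimul a b z) = bimul a b (ext phi z).
Proof.
apply: (@fbimP _ _ (ext phi \o bimul a b) (bimul a b \o ext phi)).
by move=> c w d; rewrite /= bimulU !extU bimulM.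
Qed.

Lemma ext_comp (K L P : choiceType) (phi : K -> fbim L) (psi : L -> fbim P) z :
  ext (fun w => ext psi (phi w)) z = ext psi (ext phi z).
Proof.
apply: (@fbimP _ _ (ext _) (ext psi \o ext phi)) => a w b.
by rewrite /= !extU ext_bimul.
Qed.

Lemma eq_ext (K L : choiceType) (phi psi : K -> fbim L) :
  phi =1 psi -> ext phi =1 ext psi.
Proof. by move=> e z; apply: eq_blin => a w b; rewrite e. Qed.

Lemma extB (K L : choiceType) (phi psi : K -> fbim L) z :
  ext (fun w => phi w - psi w) z = ext phi z - ext psi z.
Proof. by rewrite -blinB; apply: eq_blin => a w b; rewrite raddfB. Qed.

Lemma extD (K L : choiceType) (phi psi : K -> fbim L) z :
  ext (fun w => phi w + psi w) z = ext phi z + ext psi z.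
Proof. by rewrite -blinD; apply: eq_blin => a w b; rewrite raddfD. Qed.

Lemma ext0 (K L : choiceType) z : ext (fun _ : K => 0 : fbim L) z = 0.
Proof.
apply: (@fbimP _ _ (ext (fun _ => 0)) \0) => a w b.
by rewrite /= extU raddf0.
Qed.

Lemma ext_id (K : choiceType) z : ext (@fgen K) z = z.
Proof.
apply: (@fbimP _ _ (ext _) idfun) => a w b.
by rewrite /= extU bimul_fgen.
Qed.

Lemma ext_null (K L : choiceType) (bK : pred K) (bL : pred L)
    (phi : K -> fbim L) z :
  (forall w, bK w -> phi w \in null bL) ->
  z \in null bK -> ext phi z \in null bL.
Proof.
by move=> phiN; apply: bsupp_blin => a w b bw; apply/bimul_null/phiN.
Qed.

Lemma ext_allnull (K L : choiceType) (bL : pred L) (phi : K -> fbim L) z :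
  (forall w, phi w \in null bL) -> ext phi z \in null bL.
Proof. by move=> phiN; apply: (@ext_null _ _ xpredT) => //; exact: bsuppT. Qed.

(** [aug] carries [bimul] to two-sided multiplication in Z[S], so only the augmentations of the
    images of generators matter. *)
Lemma aug_ext (K L L' : choiceType) (phi : K -> fbim L) (psi : K -> fbim L') z :
  (forall w, aug (phi w) = aug (psi w)) -> aug (ext phi z) = aug (ext psi z).
Proof.
pose mul a b : {malg int[S]} -> {malg int[S]} :=
  linearize (fun s => << (a * s * b)%g >>).
have augb (P : choiceType) a b (y : fbim P) :
    aug (bimul a b y) = mul a b (aug y).
  pose ad := GRing.isZmodMorphism.Build _ _ (mul a b) (linearize_additive _).
  pose m : {additive {malg int[S]} -> {malg int[S]}} := HB.pack (mul a b) ad.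
  apply: (@fbimP _ _ (@aug P \o bimul a b) (m \o @aug P)) => c w d.
  by rewrite /= bimulU !augU /mul linearizeU !mulgA.
move=> e.
apply: (@fbimP _ _ (@aug L \o ext phi) (@aug L' \o ext psi)) => a w b.
by rewrite /= !extU !augb e.
Qed.

(** * Tensoring with M and mapping to M *)

Section Coefficients.
Variables (M : zmodType) (B : mon_bimodule S M).

(** The tensor product of M and F(K) over S on both sides is M (x) Z[K]. It is cyclic: the left
    coefficient a acts on m from the right, and b from the left. *)
Definition act (K : choiceType) (z : fbim K) (m : M) : {malg M[K]} :=
  blin (fun a w b => << mact_l B b (mact_r B m a) *g w >>) z.

Lemma act_additive (K : choiceType) (z : fbim K) : zmod_morphism (act z).
Proof.
move=> m n; rewrite /act -blinB; apply: eq_blin => a w b.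
by rewrite mact_rD mact_lD monalgUB.
Qed.
HB.instance Definition _ K z := GRing.isZmodMorphism.Build _ _ (@act K z)
  (act_additive z).

Lemma actE (K : choiceType) (z : fbim K) m :
  act z m = blin (fun a w b => << mact_l B b (mact_r B m a) *g w >>) z.
Proof. by []. Qed.

Lemma actU (K : choiceType) a (w : K) b m :
  act (bgen3 a w b) m = << mact_l B b (mact_r B m a) *g w >>.
Proof. exact: blinU. Qed.

Lemma actB (K : choiceType) (y z : fbim K) m :
  act (y - z) m = act y m - act z m.
Proof. exact: raddfB. Qed.

Lemma act_null (K : choiceType) (bad : pred K) (z : fbim K) m :
  z \in null bad -> act z m \in badsupp bad.
Proof. by apply: bsupp_blin => a w b bw; exact: badsuppU. Qed.

Definition chainM (K L : choiceType) (phi : K -> fbim L) :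
    {malg M[K]} -> {malg M[L]} :=
  mlift (fun w m => act (phi w) m).

Lemma chainM_additive (K L : choiceType) (phi : K -> fbim L) :
  zmod_morphism (chainM phi).
Proof. exact: (@mlift_additive _ _ _ (fun w => @act L (phi w))). Qed.
HB.instance Definition _ K L phi := GRing.isZmodMorphism.Build _ _
  (@chainM K L phi) (chainM_additive phi).

Lemma chainMU (K L : choiceType) (phi : K -> fbim L) m w :
  chainM phi << m *g w >> = act (phi w) m.
Proof. exact: (@mliftU _ _ _ (fun w => @act L (phi w))). Qed.

Lemma chainM_act (K L : choiceType) (psi : K -> fbim L) z m :
  chainM psi (act z m) = act (ext psi z) m.
Proof.
rewrite /act (blin_comp (chainM psi)) /ext (blin_comp (blin _)).
apply: eq_blin => a w b /=; rewrite chainMU /act (blin_comp (blin _)).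
by apply: eq_blin => a' l b'; rewrite /= blinU mact_rM mact_lM mact_lr.
Qed.

Lemma chainM_comp (K L P : choiceType) (phi : K -> fbim L)
    (psi : L -> fbim P) c :
  chainM (fun w => ext psi (phi w)) c = chainM psi (chainM phi c).
Proof.
apply: (@malg_addP _ _ _ (chainM _) (chainM psi \o chainM phi)) => m w.
by rewrite /= !chainMU chainM_act.
Qed.

Lemma chainMB (K L : choiceType) (phi psi : K -> fbim L) c :
  chainM (fun w => phi w - psi w) c = chainM phi c - chainM psi c.
Proof. by rewrite -sumrB; apply: eq_bigr => w _; rewrite actB. Qed.

Lemma chainM_id (K : choiceType) c : chainM (@fgen K) c = c.
Proof.
apply: (@malg_addP _ _ _ (chainM _) idfun) => m w.
by rewrite /= chainMU actU mact_r1 mact_l1.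
Qed.

Lemma chainM_bad (K L : choiceType) (bK : pred K) (bL : pred L)
    (phi : K -> fbim L) c :
  (forall w, bK w -> phi w \in null bL) ->
  c \in badsupp bK -> chainM phi c \in badsupp bL.
Proof.
by move=> phiN; apply: badsupp_mlift => w m bw; apply/act_null/phiN.
Qed.

Lemma chainM_null (K L : choiceType) (bL : pred L) (phi : K -> fbim L) c :
  (forall w, phi w \in null bL) -> chainM phi c \in badsupp bL.
Proof. by move=> phiN; apply: chainM_bad (badsuppT c). Qed.

(** The bimodule map F(K) -> M extending f; through it Map(K, M) is the group of bimodule maps. *)
Definition cov (K : choiceType) (f : K -> M) (z : fbim K) : M :=
  blin (fun a w b => mact_l B a (mact_r B (f w) b)) z.
HB.instance Definition _ (K : choiceType) f := GRing.isZmodMorphism.Build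
  (fbim K) M (@cov K f) (blin_additive _).

Lemma covU (K : choiceType) (f : K -> M) a w b :
  cov f (bgen3 a w b) = mact_l B a (mact_r B (f w) b).
Proof. exact: blinU. Qed.

Lemma cov_fgen (K : choiceType) (f : K -> M) w : cov f (fgen w) = f w.
Proof. by rewrite covU mact_r1 mact_l1. Qed.

Definition cochM (K L : choiceType) (phi : K -> fbim L) (f : L -> M) : K -> M :=
  fun w => cov f (phi w).

Lemma cov_additive (K : choiceType) (z : fbim K) :
  zmod_morphism (fun f : K -> M => cov f z).
Proof.
move=> f g; rewrite /cov -blinB; apply: eq_blin => a w b.
by rewrite mact_rD mact_lD.
Qed.

Lemma cochM_additive (K L : choiceType) (phi : K -> fbim L) :
  zmod_morphism (cochM phi).
Proof. by move=> f g; apply/funext => w; apply: cov_additive. Qed.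
HB.instance Definition _ K L phi := GRing.isZmodMorphism.Build _ _
  (@cochM K L phi) (cochM_additive phi).

Lemma cov_cochM (K L : choiceType) (psi : K -> fbim L) f z :
  cov (cochM psi f) z = cov f (ext psi z).
Proof.
have additive_act a b : zmod_morphism (fun m => mact_l B a (mact_r B m b)).
  by move=> m n; rewrite mact_rD mact_lD.
rewrite /ext /cov (blin_comp (blin _)); apply: eq_blin => a w b /=.
pose ad := GRing.isZmodMorphism.Build _ _ _ (additive_act a b).
pose g : {additive M -> M} := HB.pack (fun m => mact_l B a (mact_r B m b)) ad.
rewrite -[LHS]/(g _) /cochM /cov (blin_comp g) (blin_comp (blin _)).
by apply: eq_blin => a' l b'; rewrite /= blinU mact_rM mact_lM !mact_lr.
Qed.

Lemma cochM_comp (K L P : choiceType) (phi : K -> fbim L)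
    (psi : L -> fbim P) f :
  cochM (fun w => ext psi (phi w)) f = cochM phi (cochM psi f).
Proof. by apply/funext => w; rewrite /cochM -cov_cochM. Qed.

Lemma cochMB (K L : choiceType) (phi psi : K -> fbim L) f :
  cochM (fun w => phi w - psi w) f = cochM phi f - cochM psi f.
Proof. by apply/funext => w; rewrite /cochM raddfB. Qed.

Lemma cochM_id (K : choiceType) f : cochM (@fgen K) f = f.
Proof. by apply/funext => w; rewrite /cochM cov_fgen. Qed.

Lemma mact_r0 s : mact_r B 0 s = 0.
Proof. by have := mact_rD B s 0 0; rewrite !subrr. Qed.

Lemma mact_l0 s : mact_l B s 0 = 0.
Proof. by have := mact_lD B s 0 0; rewrite !subrr. Qed.

Lemma cov_null (K : choiceType) (bad : pred K) (f : K -> M) z :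
  (forall w, bad w -> f w = 0) -> z \in null bad -> cov f z = 0.
Proof.
move=> f0 /badsuppP zN; rewrite /cov /blin /linearize /mlift big1_seq //.
move=> [[a w] b] /andP[_ /zN bw].
by rewrite f0 //= mact_r0 mact_l0 mul0rz.
Qed.

End Coefficients.
End FreeBimodules.
Arguments null {S K} bad : rename.

Lemma inj_surj_bij (T U : Type) (f : T -> U) :
  injective f -> (forall y, exists x, f x = y) -> bijective f.
Proof.
move=> fI /choice[g fg]; exists g => // x; exact: fI.
Qed.

(** * Resolutions by free bimodules *)

Section HomologyBijective.
Context {A B C A' B' C' : zmodType}.
Context (f : {additive A -> B}) (g : {additive B -> C}).
Context (f' : {additive A' -> B'}) (g' : {additive B' -> C'}).
Context (u : {additive A -> A'}) (v : {additive B -> B'}).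
Hypothesis vf : forall a, v (f a) = f' (u a).
Hypothesis vker : forall z, z \in ker_pred g -> v z \in ker_pred g'.

Lemma homology_map_bij :
  (forall z a', g z = 0 -> v z = f' a' -> exists a, z = f a) ->
  (forall z', g' z' = 0 ->
    exists z a', g z = 0 /\ z' - v z = f' a') ->
  bijective (homology_map f' vker : homology f g -> homology f' g').
Proof.
move=> inj surj; apply: inj_surj_bij => [x y|y].
  rewrite -[x]reprK -[y]reprK !(homology_map_pi vf).
  move: (repr x) (repr y) => {}x {}y /eqP.
  rewrite -Quotient.idealrBE => /asboolP[a' fa'].
  apply/eqP; rewrite -Quotient.idealrBE; apply/asboolP.
  have [||a xy] := inj (val (x - y)) a'.
  - by have := valP (x - y); rewrite inE => /eqP.
  - by rewrite fa' /= !raddfB.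
  - by exists a; rewrite xy.
have := valP (repr y); rewrite inE => /eqP /surj[z [a' [gz yz]]].
have zk : z \in ker_pred g by rewrite inE gz.
exists (\pi_{ideal_quot im_pred f g} (SubGrp zk)).
rewrite (homology_map_pi vf) -[RHS]reprK; apply/eqP.
rewrite -Quotient.idealrBE; apply/asboolP; exists (- a').
by rewrite raddfN -yz opprB.
Qed.

End HomologyBijective.

(** Homotopies are asked for one cycle at a time, so none has to be defined as a map on the quotient
    complexes. *)
Lemma quasi_isoP (C D : chain_seq) (F : chain_map C D)
    (g : forall k, D k -> C k) :
  is_complex C -> is_complex D ->
  (forall k y, g k (cdiff D k y) = cdiff C k (g k.+1 y)) ->
  (forall k c, cdiff_out C k c = 0 ->
    exists x, c - g k (F k c) = cdiff C k x) ->
  (forall k y, cdiff_out D k y = 0 ->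
    exists x, y - F k (g k y) = cdiff D k x) ->
  (forall k, g k 0 = 0) ->
  quasi_iso F.
Proof.
move=> cC cD gd gF Fg g0; split=> // k.
apply: (@homology_map_bij _ _ _ _ _ _ _ _ _ _ (F k.+1)) => [a|c y dc Fc|y dy].
- exact: cmapP.
- have [x cx] := gF k c dc; exists (x + g k.+1 y).
  by rewrite raddfD -gd -Fc -cx addrNK.
- have [x yx] := Fg k y dy; exists (g k y), x; split=> //.
  case: k y dy {x yx} => [|k] y //= dy; by rewrite -gd dy g0.
Qed.

Lemma co_quasi_isoP (D C : cochain_seq) (F : cochain_map D C)
    (g : forall k, C k -> D k) :
  is_cocomplex D -> is_cocomplex C ->
  (forall k c, g k.+1 (codiff C k c) = codiff D k (g k c)) ->
  (forall k y, codiff D k y = 0 ->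
    exists x, y - g k (F k y) = codiff_in D k x) ->
  (forall k c, codiff C k c = 0 ->
    exists x, c - F k (g k c) = codiff_in C k x) ->
  (forall k, g k 0 = 0) ->
  co_quasi_iso F.
Proof.
move=> cD cC gd gF Fg g0; split=> // k.
apply: (@homology_map_bij _ _ _ _ _ _ _ _ _ _ (F k.-1)) => [a|c y dc Fc|y dy].
- by case: k a => [|k] a /=; rewrite ?raddf0 // comapP.
- have [x cx] := gF k c dc.
  case: k c y dc Fc x cx => [|k] c y dc Fc x cx.
    by exists 0; move: cx; rewrite Fc /= g0 subr0.
  exists (x + g k y).
  by rewrite raddfD /= -gd -[codiff C k y]Fc -cx addrNK.
- have [x yx] := Fg k y dy; exists (g k y), x; split=> //.
  by rewrite -gd dy g0.
Qed.

(** Lifts and homotopies are built degree by degree: [I] is what permits the next step, [R] ties two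
    consecutive degrees together. *)
Lemma dependent_choice (T : nat -> Type) (I : forall k, T k -> Prop)
    (R : forall k, T k -> T k.+1 -> Prop) (x0 : T 0%N) :
  I 0%N x0 ->
  (forall k x, I k x -> exists y, I k.+1 y /\ R k x y) ->
  exists s : forall k, T k,
    [/\ s 0%N = x0, forall k, I k (s k) & forall k, R k (s k) (s k.+1)].
Proof.
move=> I0 next.
pose U k := {x : T k | I k x}.
have step k (x : U k) : {y : U k.+1 | R k (sval x) (sval y)}.
  apply: cid; have [y [Iy Ry]] := next k _ (svalP x).
  by exists (exist _ y Iy).
pose s := fix s k : U k :=
  if k is k'.+1 then sval (step k' (s k')) else exist _ x0 I0.
exists (fun k => sval (s k)); split=> // k; first exact: svalP.
exact: (svalP (step k (s k))).
Qed.

Section Resolutions.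
Variable S : monoidType.
Local Notation fbim := (fbim S).

Section Cycles.
Variables (K : nat -> choiceType) (bad : forall k, pred (K k)).
Variable d : forall k, K k.+1 -> fbim (K k).

(** In degree 0 the augmentation stands in for the differential, as the resolved bimodule is
    Z[S]. *)
Definition is_cycle k : fbim (K k) -> Prop :=
  match k with
  | 0%N => fun z => aug z = 0
  | k'.+1 => fun z => ext (d (k := k')) z \in null (bad (k := k'))
  end.

(* (F(K), d) modulo the sub-bimodules spanned by the bad generators is a free
   resolution of the bimodule Z[S]. *)
Record resolution : Prop := Resolution {
  res_bad0 : forall w : K 0%N, ~~ bad w;
  res_bad : forall k (w : K k.+1), bad w -> d w \in null (bad (k := k));
  res_cycle : forall k (w : K k.+1), is_cycle (d w);
  res_exact : forall k (z : fbim (K k)), is_cycle z ->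
    exists y, z - ext (d (k := k)) y \in null (bad (k := k)) }.

End Cycles.

(** * The comparison theorem for free resolutions *)

Section Comparison.
Variables (P Q : nat -> choiceType).
Variables (bP : forall k, pred (P k)) (bQ : forall k, pred (Q k)).
Variables (dP : forall k, P k.+1 -> fbim (P k)).
Variables (dQ : forall k, Q k.+1 -> fbim (Q k)).
Hypothesis resP : resolution bP dP.
Hypothesis resQ : resolution bQ dQ.

Local Notation dP_ k := (ext (dP (k := k))).
Local Notation dQ_ k := (ext (dQ (k := k))).

Definition chain_hom (f : forall k, P k -> fbim (Q k)) : Prop :=
  (forall k w, bP w -> f k w \in null (bQ (k := k))) /\
  (forall k w, dQ_ k (f k.+1 w) - ext (f k) (dP w) \in null (bQ (k := k))).

Lemma extend_to_good k (f : P k -> fbim (Q k)) :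
  (forall w, bP w -> f w \in null (bQ (k := k))) ->
  (forall w, is_cycle bQ dQ (f w)) ->
  exists h : P k -> fbim (Q k.+1),
    (forall w, bP w -> h w \in null (bQ (k := k.+1))) /\
    (forall w, f w - dQ_ k (h w) \in null (bQ (k := k))).
Proof.
move=> fN fc.
have [h hP] := choice (fun w => res_exact resQ (fc w)).
(* On bad generators f is null already, so 0 serves there and keeps h null. *)
exists (fun w => if bP w then 0 else h w).
split=> w; case: ifP => // bw; rewrite ?rpred0 // raddf0 subr0; exact: fN.
Qed.

(** In degree 0 all generators go to [q0], which has the same augmentation 1. The invariant [I] says
    that g d gives cycles; exactness of the target then supplies the next degree. *)
Lemma lift_exists (q0 : Q 0%N) : exists G, chain_hom G /\
  forall w, G 0%N w = fgen S q0.
Proof.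
pose I k (g : P k -> fbim (Q k)) :=
  (forall w, bP w -> g w \in null (bQ (k := k))) /\
  (forall w : P k.+1, is_cycle bQ dQ (ext g (dP w))).
pose R k (g : P k -> fbim (Q k)) (g' : P k.+1 -> fbim (Q k.+1)) :=
  forall w, dQ_ k (g' w) - ext g (dP w) \in null (bQ (k := k)).
have [|k g [gN gc]|G [G0 GI GR]] :=
    @dependent_choice (fun k => P k -> fbim (Q k)) I R (fun _ => fgen S q0).
- split=> [w|w /=]; first by rewrite (negPf (res_bad0 resP w)).
  rewrite (@aug_ext _ _ _ _ _ (@fgen S (P 0%N))) ?ext_id.
    exact: (res_cycle resP w).
  by move=> v; rewrite !augU.
- have [h' h'P] := choice (fun w => res_exact resQ (gc w)).
  pose g' w := if bP w then 0 else h' w.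
  have g'P w : dQ_ k (g' w) - ext g (dP w) \in null (bQ (k := k)).
    rewrite /g' -opprB rpredN; case: ifP => bw; last exact: h'P.
    rewrite raddf0 subr0.
    apply: ext_null (res_bad resP bw); exact: gN.
  exists g'; split=> //; split=> w; first by rewrite /g' => ->; rewrite rpred0.
  (* d g' d = (d g' - g d) d + g d d, where both summands are null. *)
  rewrite /= -ext_comp -[ext _ _](subrK (ext (fun v => ext g (dP v)) (dP w))).
  rewrite -extB rpredD //; first exact: ext_allnull.
  by rewrite ext_comp; apply: ext_null (res_cycle resP w).
- exists G; split=> [|w]; last by rewrite G0.
  by split=> k; [case: (GI k)|exact: GR].
Qed.

(** The invariant [I] says that (f - d h) d is null; this makes f - h d a cycle one degree higher,
    to be filled by exactness. *)
Lemma homotopy_exists (f : forall k, P k -> fbim (Q k)) :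
  chain_hom f -> (forall w, aug (f 0%N w) = 0) ->
  exists h : forall k, P k -> fbim (Q k.+1),
    [/\ forall k w, bP w -> h k w \in null (bQ (k := k.+1)),
        forall w, f 0%N w - dQ_ 0 (h 0%N w) \in null (bQ (k := 0%N))
      & forall k w, f k.+1 w - ext (h k) (dP w) - dQ_ k.+1 (h k.+1 w)
          \in null (bQ (k := k.+1))].
Proof.
move=> [fN fd] f0.
pose I k (h : P k -> fbim (Q k.+1)) :=
  (forall w, bP w -> h w \in null (bQ (k := k.+1))) /\
  (forall w : P k.+1, ext (fun v => f k v - dQ_ k (h v)) (dP w)
     \in null (bQ (k := k))).
pose R k (h : P k -> fbim (Q k.+1)) (h' : P k.+1 -> fbim (Q k.+2)) :=
  forall w, f k.+1 w - ext h (dP w) - dQ_ k.+1 (h' w)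
    \in null (bQ (k := k.+1)).
have [h0 [h0N h0P]] := extend_to_good (fN 0%N) f0.
have [|k h [hN hc]|h [h0E hI hR]] :=
    @dependent_choice (fun k => P k -> fbim (Q k.+1)) I R h0.
- by split=> // w; apply: ext_allnull.
- have [w bw|w|h' [h'N h'P]] :=
      @extend_to_good k.+1 (fun w => f k.+1 w - ext h (dP w)).
  + rewrite rpredB ?fN //; apply: ext_null (res_bad resP bw); exact: hN.
  + rewrite /= raddfB /= -ext_comp.
    (* d (f - h d) = (d f - f d) + (f - d h) d. *)
    rewrite -[dQ_ _ _](subrK (ext (f k) (dP w))) -addrA.
    by rewrite rpredD //; [exact: fd|rewrite -extB; exact: hc].
  exists h'; split=> //; split=> // w.
  rewrite -(eq_ext (phi := fun v =>
    (f k.+1 v - ext h (dP v) - dQ_ k.+1 (h' v)) + ext h (dP v))); last first.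
    by move=> v; rewrite addrAC subrK.
  rewrite extD rpredD //; first exact: ext_allnull.
  rewrite ext_comp; apply: ext_null (res_cycle resP w); exact: hN.
- exists h; split=> [k||k]; [by case: (hI k)|by rewrite h0E|exact: hR].
Qed.

End Comparison.
End Resolutions.

Section ChainHoms.
Variable S : monoidType.
Local Notation fbim := (fbim S).

Lemma chain_hom_id (K : nat -> choiceType) (bK : forall k, pred (K k))
    (dK : forall k, K k.+1 -> fbim (K k)) :
  chain_hom bK bK dK dK (fun k => @fgen S (K k)).
Proof.
split=> k w; first exact: nullU.
by rewrite ext_fgen ext_id subrr rpred0.
Qed.

Lemma chain_homB (K L : nat -> choiceType)
    (bK : forall k, pred (K k)) (bL : forall k, pred (L k))
    (dK : forall k, K k.+1 -> fbim (K k)) (dL : forall k, L k.+1 -> fbim (L k))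
    (f g : forall k, K k -> fbim (L k)) :
  chain_hom bK bL dK dL f -> chain_hom bK bL dK dL g ->
  chain_hom bK bL dK dL (fun k w => f k w - g k w).
Proof.
move=> [fN fd] [gN gd]; split=> k w => [bw|]; first by rewrite rpredB ?fN ?gN.
rewrite extB raddfB /= opprD addrACA -opprD.
by apply: rpredB; [exact: fd|exact: gd].
Qed.

Lemma chain_hom_comp (K L P : nat -> choiceType) (bK : forall k, pred (K k))
    (bL : forall k, pred (L k)) (bP : forall k, pred (P k))
    (dK : forall k, K k.+1 -> fbim (K k)) (dL : forall k, L k.+1 -> fbim (L k))
    (dP : forall k, P k.+1 -> fbim (P k))
    (f : forall k, K k -> fbim (L k)) (g : forall k, L k -> fbim (P k)) :
  chain_hom bK bL dK dL f -> chain_hom bL bP dL dP g ->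
  chain_hom bK bP dK dP (fun k w => ext (g k) (f k w)).
Proof.
move=> [fN fd] [gN gd]; split=> k w => [bw|].
  by apply: ext_null (fN _ _ bw); exact: gN.
rewrite ext_comp -(subrKA (ext (g k) (ext (dL k) (f k.+1 w)))) rpredD //.
  by rewrite -!ext_comp -extB; apply: ext_allnull => v; exact: gd.
by rewrite -raddfB /=; apply: ext_null (fd k w); exact: gN.
Qed.

Section Equivalence.
Variables (K L : nat -> choiceType).
Variables (bK : forall k, pred (K k)) (bL : forall k, pred (L k)).
Variables (dK : forall k, K k.+1 -> fbim (K k)).
Variables (dL : forall k, L k.+1 -> fbim (L k)).
Hypotheses (resK : resolution bK dK) (resL : resolution bL dL).
Variables (k0 : K 0%N).
Variable q : forall k, K k -> fbim (L k).
Hypothesis q_hom : chain_hom bK bL dK dL q.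
Hypothesis q_aug : forall w : K 0%N, aug (q w) = << 1%g >>.

Definition homotopic_id (P : nat -> choiceType) (b : forall k, pred (P k))
    (d : forall k, P k.+1 -> fbim (P k)) (f : forall k, P k -> fbim (P k))
    (h : forall k, P k -> fbim (P k.+1)) : Prop :=
  [/\ forall k w, b k w -> h k w \in null (b k.+1),
      forall w, fgen S w - f 0%N w - ext (d 0%N) (h 0%N w) \in null (b 0%N)
    & forall k w, fgen S w - f k.+1 w - ext (h k) (d k w)
        - ext (d k.+1) (h k.+1 w) \in null (b k.+1)].

Lemma chain_equivalence : exists G hK hL,
  [/\ chain_hom bL bK dL dK G,
      homotopic_id bK dK (fun k w => ext (G k) (q w)) hK
    & homotopic_id bL dL (fun k w => ext (q (k := k)) (G k w)) hL].
Proof.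
have [G [G_hom G_aug]] := lift_exists resL resK k0.
have aug_fgen (P : choiceType) (w : P) : aug (fgen S w) = << 1%g >>.
  by rewrite augU mulg1.
have [|hK hKP] := homotopy_exists resK resK (chain_homB (chain_hom_id bK dK)
  (chain_hom_comp q_hom G_hom)).
  move=> w; rewrite raddfB /= aug_fgen -(q_aug w).
  rewrite (@aug_ext _ _ _ _ _ (@fgen S _)) ?ext_id ?subrr // => v.
  by rewrite G_aug !aug_fgen.
have [|hL hLP] := homotopy_exists resL resL (chain_homB (chain_hom_id bL dL)
  (chain_hom_comp G_hom q_hom)).
  by move=> w; rewrite raddfB /= aug_fgen G_aug ext_fgen q_aug subrr.
by exists G, hK, hL.
Qed.

End Equivalence.
End ChainHoms.

(** * From homotopies of bimodules to (co)homology with coefficients *)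

Section Transfer.
Variables (S : monoidType) (M : zmodType) (B : mon_bimodule S M).
Local Notation fbim := (fbim S).

Section Presentations.
Variables (K : nat -> choiceType) (bad : forall k, pred (K k)).
Variables (d : forall k, K k.+1 -> fbim (K k)).

(* C is the chain complex M (x) F(K), resp. D is Hom(F(K), M), modulo bad
   generators *)
Record chain_pres (C : chain_seq)
    (pi : forall k, {additive {malg M[K k]} -> C k}) : Prop := ChainPres {
  pi_surj : forall k x, exists c, pi k c = x;
  pi_null : forall k c, (pi k c == 0) = (c \in badsupp (bad (k := k)));
  pi_diff : forall k c,
    cdiff C k (pi k.+1 c) = pi k (chainM B (d (k := k)) c) }.

Record cochain_pres (D : cochain_seq)
    (iota : forall k, {additive D k -> (K k -> M)}) : Prop := CochainPres {
  iota_inj : forall k, injective (iota k);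
  iota_bad : forall k x w, bad w -> iota k x w = 0;
  iota_surj : forall k f, (forall w, bad w -> f w = 0) ->
    exists x, iota k x = f;
  iota_diff : forall k x,
    iota k.+1 (codiff D k x) = cochM B (d (k := k)) (iota k x) }.

Hypothesis res : resolution bad d.

Lemma pres_is_complex C pi : @chain_pres C pi -> is_complex C.
Proof.
move=> presC k x; have [c <-] := pi_surj presC x.
apply/eqP; rewrite !(pi_diff presC) (pi_null presC) -chainM_comp.
exact/chainM_null/(res_cycle res).
Qed.

Lemma pres_is_cocomplex D iota : @cochain_pres D iota -> is_cocomplex D.
Proof.
move=> presD k x; apply: (iota_inj presD).
rewrite !(iota_diff presD) raddf0 -cochM_comp; apply/funext => w.
by rewrite /cochM (cov_null _ (iota_bad presD x)) //; apply: (res_cycle res w).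
Qed.

End Presentations.

Section Maps.
Variables (K L : nat -> choiceType).
Variables (bK : forall k, pred (K k)) (bL : forall k, pred (L k)).
Variables (dK : forall k, K k.+1 -> fbim (K k)).
Variables (dL : forall k, L k.+1 -> fbim (L k)).

Lemma pres_map_exists (C D : chain_seq)
    (piC : forall k, {additive {malg M[K k]} -> C k})
    (piD : forall k, {additive {malg M[L k]} -> D k})
    (f : forall k, K k -> fbim (L k)) :
  chain_pres bK dK piC -> chain_pres bL dL piD ->
  chain_hom bK bL dK dL f ->
  exists F : chain_map C D,
    forall k c, F k (piC k c) = piD k (chainM B (f k) c).
Proof.
move=> presC presD [fN fd].
pose r k (x : C k) := sval (cid (pi_surj presC x)).
have rP k (x : C k) : piC k (r k x) = x.
  exact: (svalP (cid (pi_surj presC x))).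
pose F k (x : C k) := piD k (chainM B (f k) (r k x)).
have FP k c : F k (piC k c) = piD k (chainM B (f k) c).
  apply/eqP; rewrite -subr_eq0 -!raddfB (pi_null presD).
  apply: chainM_bad (fN k) _.
  by rewrite -(pi_null presC) raddfB subr_eq0 rP.
have Fadd k : zmod_morphism (F k).
  move=> x y; have [c <-] := pi_surj presC x; have [e <-] := pi_surj presC y.
  by rewrite -raddfB !FP !raddfB.
pose Fa k : {additive C k -> D k} :=
  HB.pack (F k) (GRing.isZmodMorphism.Build _ _ (F k) (Fadd k)).
have Fd k x : Fa k (cdiff C k x) = cdiff D k (Fa k.+1 x).
  have [c <-] := pi_surj presC x; rewrite /= (pi_diff presC) !FP.
  rewrite (pi_diff presD) -!chainM_comp; apply/eqP; rewrite eq_sym -subr_eq0.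
  rewrite -raddfB (pi_null presD) -chainMB.
  by apply: chainM_null => w; exact: fd.
by exists (ChainMap Fd).
Qed.

Lemma pres_comap_exists (C D : cochain_seq)
    (iC : forall k, {additive C k -> (K k -> M)})
    (iD : forall k, {additive D k -> (L k -> M)})
    (f : forall k, K k -> fbim (L k)) :
  cochain_pres bK dK iC -> cochain_pres bL dL iD ->
  chain_hom bK bL dK dL f ->
  exists F : cochain_map D C, forall k x, iC k (F k x) = cochM B (f k) (iD k x).
Proof.
move=> presC presD [fN fd].
have surj k (x : D k) : exists y, iC k y = cochM B (f k) (iD k x).
  apply: (iota_surj presC) => w bw; rewrite /cochM.
  by apply: cov_null (fN _ _ bw) => v; exact: (iota_bad presD).
pose F k x := sval (cid (surj k x)).
have FP k x : iC k (F k x) = cochM B (f k) (iD k x).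
  by exact: (svalP (cid (surj k x))).
have Fadd k : zmod_morphism (F k).
  by move=> x y; apply: (iota_inj presC); rewrite raddfB !FP !raddfB.
pose Fa k : {additive D k -> C k} :=
  HB.pack (F k) (GRing.isZmodMorphism.Build _ _ (F k) (Fadd k)).
have Fd k x : Fa k.+1 (codiff D k x) = codiff C k (Fa k x).
  apply: (iota_inj presC); rewrite /= (iota_diff presC) !FP.
  rewrite (iota_diff presD) -!cochM_comp.
  apply/eqP; rewrite -subr_eq0 -cochMB; apply/eqP/funext => w.
  by apply: cov_null (fd _ _) => v; exact: (iota_bad presD).
by exists (CochainMap Fd).
Qed.

End Maps.

(** On a cycle d c is null, and h respects null chains, so the term h d disappears and d h c is the
    required boundary. *)
Lemma homotopic_id_chain (P : nat -> choiceType) (b : forall k, pred (P k))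
    (d : forall k, P k.+1 -> fbim (P k)) (f : forall k, P k -> fbim (P k))
    (h : forall k, P k -> fbim (P k.+1)) (C : chain_seq)
    (pi : forall k, {additive {malg M[P k]} -> C k}) :
  chain_pres b d pi -> homotopic_id b d f h ->
  forall k c, cdiff_out C k (pi k c) = 0 ->
  exists x, pi k c - pi k (chainM B (f k) c) = cdiff C k x.
Proof.
move=> pres [hN h0 hS] [|k] c dc.
  exists (pi 1%N (chainM B (h 0%N) c)).
  apply/eqP; rewrite (pi_diff pres) -subr_eq0 -!raddfB (pi_null pres).
  rewrite -[X in X - _ - _](chainM_id B) -chainM_comp -!chainMB.
  exact: chainM_null.
exists (pi k.+2 (chainM B (h k.+1) c)).
apply/eqP; rewrite (pi_diff pres) -subr_eq0 -!raddfB (pi_null pres).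
rewrite -[X in X - _ - _](chainM_id B) -chainM_comp -!chainMB.
rewrite -[X in X \in _](subrK (chainM B (fun w => ext (h k) (d k w)) c)).
rewrite rpredD //.
  rewrite -chainMB; apply: chainM_null => w.
  by rewrite addrAC; exact: hS.
rewrite chainM_comp; apply: chainM_bad (hN k) _.
by rewrite -(pi_null pres) -(pi_diff pres); apply/eqP.
Qed.

(** Precomposition exchanges the roles: d h vanishes on a cocycle, and h d becomes the coboundary of
    z. In degree 0 there is no term h d, and x = y. *)
Lemma homotopic_id_cochain (P : nat -> choiceType) (b : forall k, pred (P k))
    (d : forall k, P k.+1 -> fbim (P k)) (f : forall k, P k -> fbim (P k))
    (h : forall k, P k -> fbim (P k.+1)) (C : cochain_seq)
    (i : forall k, {additive C k -> (P k -> M)}) :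
  cochain_pres b d i -> homotopic_id b d f h ->
  forall k x y, codiff C k x = 0 -> i k y = cochM B (f k) (i k x) ->
  exists z, x - y = codiff_in C k z.
Proof.
move=> pres [hN h0 hS] [|k] x y dx iy.
  exists 0; apply: (iota_inj pres); rewrite raddfB iy !raddf0.
  have dix : cochM B (d 0%N) (i 0%N x) = 0.
    by rewrite -(iota_diff pres) dx raddf0.
  rewrite -[X in X - _](cochM_id B) -cochMB.
  have hd : cochM B (fun w => ext (d 0%N) (h 0%N w)) (i 0%N x) = 0.
    by rewrite cochM_comp dix raddf0.
  rewrite -[LHS]subr0 -[X in _ - X]hd -cochMB; apply/funext => w.
  by apply: cov_null (h0 w) => v; exact: (iota_bad pres).
have dix : cochM B (d k.+1) (i k.+1 x) = 0.
  by rewrite -(iota_diff pres) dx raddf0.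
have [z iz] : exists z, i k z = cochM B (h k) (i k.+1 x).
  apply: (iota_surj pres) => w bw.
  by apply: cov_null (hN _ _ bw) => v; exact: (iota_bad pres).
exists z; apply: (iota_inj pres); rewrite raddfB iy /= (iota_diff pres) iz.
rewrite -cochM_comp -[X in X - _](cochM_id B) -cochMB; apply/eqP.
rewrite -subr_eq0 -cochMB.
have hd : cochM B (fun w => ext (d k.+1) (h k.+1 w)) (i k.+1 x) = 0.
  by rewrite cochM_comp dix raddf0.
rewrite -[X in X == _]subr0 -[X in _ - X]hd -cochMB; apply/eqP/funext => w.
by apply: cov_null (hS _ _) => v; exact: (iota_bad pres).
Qed.

Variables (K L : nat -> choiceType).
Variables (bK : forall k, pred (K k)) (bL : forall k, pred (L k)).
Variables (dK : forall k, K k.+1 -> fbim (K k)).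
Variables (dL : forall k, L k.+1 -> fbim (L k)).
Hypotheses (resK : resolution bK dK) (resL : resolution bL dL).
Variables (k0 : K 0%N).
Variable q : forall k, K k -> fbim (L k).
Hypothesis q_hom : chain_hom bK bL dK dL q.
Hypothesis q_aug : forall w : K 0%N, aug (q w) = << 1%g >>.

Lemma pres_quasi_iso (C D : chain_seq)
    (piC : forall k, {additive {malg M[K k]} -> C k})
    (piD : forall k, {additive {malg M[L k]} -> D k}) (F : chain_map C D) :
  chain_pres bK dK piC -> chain_pres bL dL piD ->
  (forall k c, F k (piC k c) = piD k (chainM B (q (k := k)) c)) ->
  quasi_iso F.
Proof.
move=> presC presD FP.
have [G [hK [hL [G_hom hKP hLP]]]] :=
  chain_equivalence resK resL k0 q_hom q_aug.
have [g gP] := pres_map_exists presD presC G_hom.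
apply: (@quasi_isoP C D F (fun k => g k)).
- exact: pres_is_complex resK _ _ presC.
- exact: pres_is_complex resL _ _ presD.
- by move=> k y; rewrite cmapP.
- move=> k c; have [{}c <-] := pi_surj presC c.
  by rewrite FP gP -chainM_comp; exact: homotopic_id_chain presC hKP k c.
- move=> k c; have [{}c <-] := pi_surj presD c.
  by rewrite gP FP -chainM_comp; exact: homotopic_id_chain presD hLP k c.
- by move=> k; rewrite raddf0.
Qed.

Lemma pres_co_quasi_iso (C D : cochain_seq)
    (iC : forall k, {additive C k -> (K k -> M)})
    (iD : forall k, {additive D k -> (L k -> M)}) (F : cochain_map D C) :
  cochain_pres bK dK iC -> cochain_pres bL dL iD ->
  (forall k x, iC k (F k x) = cochM B (q (k := k)) (iD k x)) ->
  co_quasi_iso F.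
Proof.
move=> presC presD FP.
have [G [hK [hL [G_hom hKP hLP]]]] :=
  chain_equivalence resK resL k0 q_hom q_aug.
have [g gP] := pres_comap_exists presD presC G_hom.
apply: (@co_quasi_isoP D C F (fun k => g k)).
- exact: pres_is_cocomplex resL _ _ presD.
- exact: pres_is_cocomplex resK _ _ presC.
- by move=> k c; rewrite comapP.
- move=> k y dy; apply: (homotopic_id_cochain presD hLP dy).
  by rewrite gP FP -cochM_comp.
- move=> k c dc; apply: (homotopic_id_cochain presC hKP dc).
  by rewrite FP gP -cochM_comp.
- by move=> k; rewrite raddf0.
Qed.

End Transfer.

(** * The bar resolution *)

(* Unification would otherwise unfold these constants down to finite maps. *)
Opaque rcons_tuple tnth tbehead tbelast tmerge.
Opaque fbim bgen3 blin bimul ext aug act cov bsupp null.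

Section BarResolution.
Variable S : monoidType.
Local Notation fbim := (fbim S).
Local Notation tup k := (k.-tuple S : choiceType).

Definition bar_d k (s : k.+1.-tuple S) : fbim (tup k) :=
  bgen3 (tnth s ord0) (tbehead s) 1%g
  + \sum_(j < k) bgen3 1%g (tmerge j s) 1%g *~ (-1) ^+ j.+1
  + bgen3 1%g (tbelast s) (tnth s ord_max) *~ (-1) ^+ k.+1.

Lemma bar_d0 (s : 1.-tuple S) : bar_d s =
  bgen3 (tnth s ord0) ([tuple] : tup 0%N) 1%g
  - bgen3 1%g ([tuple] : tup 0%N) (tnth s ord0).
Proof.
rewrite /bar_d big_ord0 [X in X + _]addr0 expr1 mulrN1z.
rewrite (_ : ord_max = ord0); last exact: val_inj.
by rewrite [tbehead s]tuple0 [tbelast s]tuple0.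
Qed.

(** The contraction absorbs the right coefficient into the tuple, so it commutes with left
    multiplication only. *)
Definition bar_h k : fbim (tup k) -> fbim (tup k.+1) :=
  blin (fun a (s : tup k) b =>
    bgen3 a (rcons_tuple s b : tup k.+1) 1%g).
HB.instance Definition _ k := GRing.isZmodMorphism.Build _ _ (@bar_h k)
  (blin_additive _).

Lemma bar_hU k a (s : tup k) b :
  bar_h (bgen3 a s b) = bgen3 a (rcons_tuple s b : tup k.+1) 1%g.
Proof. exact: blinU. Qed.

(** The composite h d; in degree 0 the augmentation followed by its section s -> s . [] . 1. *)
Definition bar_hd k : fbim (tup k) -> fbim (tup k) :=
  match k with
  | 0%N => fun z =>
      linearize (fun s : S => bgen3 s ([tuple] : tup 0%N) 1%g) (aug z)
  | k'.+1 => fun z => bar_h (ext (@bar_d k') z)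
  end.
Lemma bar_hd_additive k : zmod_morphism (@bar_hd k).
Proof. by case: k => [|k] x y; rewrite /= !raddfB. Qed.
HB.instance Definition _ k := GRing.isZmodMorphism.Build _ _ (@bar_hd k)
  (@bar_hd_additive k).

Lemma bar_h_bimul k a b a' (t : tup k) b' c : c = (b' * b)%g ->
  bimul a 1%g (bgen3 a' (rcons_tuple t c : tup k.+1) 1%g) =
  bar_h (bimul a b (bgen3 a' t b')).
Proof. by move=> ->; rewrite !bimulU bar_hU mulg1. Qed.

(** Consider the faces of the tuple (s, b). Those that leave b alone come from faces of s, merging
    the last entry of s with b comes from the last face of s, and dropping b gives back a . s . b up
    to sign. *)
Lemma bar_homotopy k (z : fbim (tup k)) :
  ext (@bar_d k) (bar_h z) = bar_hd z + z *~ (-1) ^+ k.+1.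
Proof.
have scale_add : zmod_morphism (fun z : fbim (tup k) => z *~ (-1) ^+ k.+1).
  by move=> x y; rewrite mulrzBl.
pose sc : {additive fbim (tup k) -> fbim (tup k)} := HB.pack
  (fun z : fbim (tup k) => z *~ (-1) ^+ k.+1)
  (GRing.isZmodMorphism.Build _ _ _ scale_add).
apply: (@fbimP _ _ _ (ext (@bar_d k) \o @bar_h k) (@bar_hd k \+ sc)).
move=> a s b /=; rewrite bar_hU extU.
rewrite {scale_add sc z}; case: k s => [|k] s /=.
  rewrite augU linearizeU bar_d0 raddfB /= !bimulU.
  rewrite (_ : tnth _ _ = b); last by rewrite (tnth_nth b) [s]tuple0.
  by rewrite [s]tuple0 !mulg1 expr1 mulrN1z.
rewrite extU [X in bimul a 1%g X]/bar_d big_ord_recr /=.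
rewrite tbelast_rcons tnth_rcons_max tnth_rcons_ord0 tbehead_rcons.
rewrite tmerge_rcons_last.
under eq_bigr => j _ do rewrite tmerge_rcons.
rewrite !raddfD /= raddf_sum /= !raddfMz /=.
under eq_bigr => j _ do rewrite raddfMz /=
  (@bar_h_bimul k a b _ (tmerge j s) 1%g b (esym (mul1g b))).
rewrite [X in X + _ + _ = _]
  (@bar_h_bimul k a b _ (tbehead s) 1%g b (esym (mul1g b))).
rewrite [X in _ + (_ + X *~ _) + _]
  (@bar_h_bimul k a b _ (tbelast s) (tnth s ord_max) _ erefl).
rewrite [X in _ + X *~ _ = _]bimulU !mulg1.
rewrite [X in _ = _ + bar_h X + _ + _]raddf_sum.
rewrite [X in _ = _ + X + _ + _]raddf_sum.
under [in RHS]eq_bigr => j _ do rewrite !raddfMz /=.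
by rewrite !addrA.
Qed.

Lemma bar_d_aug (s : 1.-tuple S) : aug (bar_d s) = 0.
Proof.
by rewrite bar_d0 raddfB /= !augU mulg1 mul1g subrr.
Qed.

Lemma bar_d_h k (s : tup k) b :
  bar_d (rcons_tuple s b) =
  bar_hd (bgen3 1%g s b) + (bgen3 1%g s b) *~ (-1) ^+ k.+1.
Proof. by rewrite -bar_homotopy bar_hU extU bimul1. Qed.

(** Every tuple is h of a cell, so its boundary is h d z + z up to sign. Applying d and
    [bar_homotopy] again leaves h d d z, zero by induction, and two copies of d z with opposite
    signs. *)
Lemma bar_dd k (s : k.+2.-tuple S) : ext (@bar_d k) (bar_d s) = 0.
Proof.
have hd0 m (z : fbim (tup m.+1)) : bar_hd (ext (@bar_d m) z) = 0 ->
    ext (@bar_d m) (bar_hd z + z *~ (-1) ^+ m.+2) = 0.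
  move=> hd0; rewrite raddfD raddfMz /= bar_homotopy hd0 add0r -mulrzDr.
  by rewrite [in X in _ + X]exprS mulN1r subrr mulr0z.
elim: k s => [|k IH] s; have [s' [b ->]] := tuple_rconsP s; rewrite bar_d_h.
  apply: hd0.
  rewrite /= (@aug_ext _ _ _ _ _ (fun _ : tup 1%N => 0 : fbim (tup 0%N))).
    by rewrite ext0 !raddf0.
  by move=> w; rewrite bar_d_aug raddf0.
apply: hd0; rewrite /= -ext_comp (eq_ext (psi := fun _ => 0)); last exact: IH.
by rewrite ext0 !raddf0.
Qed.

Variable norm : bool.

Definition bar_bad k : pred (k.-tuple S) := fun s => norm && (1%g \in s).

Lemma bar_h_null k z : z \in null (@bar_bad k) ->
  bar_h z \in null (@bar_bad k.+1).
Proof.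
apply: bsupp_blin => a s b /andP[n us]; apply: nullU.
by rewrite /bar_bad /= n mem_rcons inE us orbT.
Qed.

(** Again through d h = h d + z up to sign: a unit in s' is handled by induction, so the case left
    is b = 1. *)
Lemma bar_d_null k (s : k.+1.-tuple S) :
  bar_bad s -> bar_d s \in null (@bar_bad k).
Proof.
elim: k s => [|k IH] s; have [s' [b ->]] := tuple_rconsP s.
  rewrite /bar_bad mem_rcons inE [s']tuple0 orbF => /andP[_ /eqP<-].
  rewrite bar_d_h /= augU linearizeU mulg1 expr1 mulrN1z subrr.
  exact: rpred0.
rewrite /bar_bad mem_rcons inE => /andP[n]; case: (boolP (1%g \in s')) => us.
  move=> _; rewrite bar_d_h rpredD //.
    by rewrite /= bar_h_null // extU; apply/bimul_null/IH; rewrite /bar_bad n.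
  by rewrite rpredMz //; apply: nullU; rewrite /bar_bad n.
rewrite orbF => /eqP<-; rewrite bar_d_h /= extU bimul1 /bar_d raddfD -addrA.
rewrite rpredD //.
  have null_rcons a (t : tup k) :
      bgen3 a (rcons_tuple t 1%g : tup k.+1) 1%g \in null (@bar_bad k.+1).
    by apply: nullU; rewrite /bar_bad /= n mem_rcons inE eqxx.
  rewrite raddfD; apply: rpredD; first by rewrite /= bar_hU.
  rewrite raddf_sum; apply: rpred_sum => j _.
  by rewrite raddfMz rpredMz //= bar_hU.
(* The one face of s' without an appended unit: its last entry times b = 1 restores s', which
   cancels the term z. *)
rewrite raddfMz /= bar_hU rcons_tbelast -mulrzDr.
by rewrite [in X in _ + X]exprS mulN1r subrr mulr0z rpred0.
Qed.

Lemma bar_resolution :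
  resolution (K := fun k => tup k) bar_bad bar_d.
Proof.
split=> [w|k w|k w|k z].
- by rewrite /bar_bad [w]tuple0 andbF.
- exact: bar_d_null.
- by case: k w => [|k] w /=; [exact: bar_d_aug|rewrite bar_dd rpred0].
- move=> zc; exists (bar_h z *~ (-1) ^+ k.+1).
  have -> : z - ext (bar_d (k:=k)) (bar_h z *~ (-1) ^+ k.+1)
      = - (bar_hd z *~ (-1) ^+ k.+1).
    rewrite raddfMz /= bar_homotopy mulrzDl -mulrzA -expr2 sqrr_sign mulr1z.
    by rewrite opprD addrCA subrr addr0.
  rewrite rpredN rpredMz //; case: k z zc => [|k] z /=; last exact: bar_h_null.
  by move=> ->; rewrite raddf0 rpred0.
Qed.

End BarResolution.

Lemma sum_pairing (I : finType) (V : zmodType) (f : I -> V) (t : I -> I)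
    (P : pred I) :
  involutive t -> (forall i, P (t i) = ~~ P i) ->
  (forall i, P i -> f (t i) = - f i) -> \sum_i f i = 0.
Proof.
move=> tK Pt ft; rewrite (bigID P) /= [X in _ + X](reindex_inj (inv_inj tK)).
rewrite (eq_bigl P) => [|i]; last by rewrite Pt negbK.
by rewrite -big_split big1 //= => i /ft->; rewrite subrr.
Qed.

Lemma tbehead_map (T U : Type) (f : T -> U) k (w : k.+1.-tuple T) :
  tbehead (map_tuple f w) = map_tuple f (tbehead w).
Proof. by apply: val_inj; rewrite /= !val_tbehead behead_map. Qed.

Lemma tbelast_map (T U : Type) (f : T -> U) k (w : k.+1.-tuple T) :
  tbelast (map_tuple f w) = map_tuple f (tbelast w).
Proof. by apply: val_inj; rewrite /= !val_tbelast map_take. Qed.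

Section NthBgen.
Variables (X : choiceType) (sigma : X * X -> X * X).

Lemma nth_bgen_seq x0 i w m : (i.+1 < size w)%N ->
  nth x0 (bgen_seq sigma i w) m =
  if m == i then (sigma (nth x0 w i, nth x0 w i.+1)).1
  else if m == i.+1 then (sigma (nth x0 w i, nth x0 w i.+1)).2
  else nth x0 w m.
Proof.
elim: i w m => [|i IH] [|x w] [|m] //=.
- by case: w.
- by case: w m => [|y w] [|m].
- by move=> iw; rewrite IH.
Qed.

End NthBgen.

(** * The quantum symmetrizer and the braided resolution *)

Section QuantumSymmetrizer.
Variables (X : choiceType) (sigma : X * X -> X * X).
Hypothesis sigma_braided : braided sigma.
Variables (S : monoidType) (gm : X -> S).
Hypothesis gm_sigma : forall x y,
  (gm x * gm y = gm (sigma (x, y)).1 * gm (sigma (x, y)).2)%g.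
Local Notation fbim := (fbim S).
Local Notation tX k := (k.-tuple X : choiceType).
Local Notation tS k := (k.-tuple S : choiceType).

Definition braid_d k (w : k.+1.-tuple X) : fbim (tX k) :=
  \sum_(i < k.+1)
    (bgen3 (gm (tnth (pull_left sigma i w) ord0))
       (tbehead (pull_left sigma i w) : tX k) 1%g
     - bgen3 1%g (tbelast (pull_right sigma i w) : tX k)
       (gm (tnth (pull_right sigma i w) ord_max))) *~ (-1) ^+ i.

Definition qs k (w : k.-tuple X) : fbim (tS k) :=
  \sum_(s : 'S_k)
    fgen S (map_tuple gm (perm_act sigma s w) : tS k) *~ (-1) ^+ perm_len s.

Lemma tmerge_bgen k j (u : k.+1.-tuple X) : (j < k)%N ->
  tmerge j (map_tuple gm (bgen sigma j u)) = tmerge j (map_tuple gm u).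
Proof.
move=> jk; apply: eq_from_tnth => i; have x0 := tnth u ord0.
have su : (j.+1 < size u)%N by rewrite size_tuple ltnS.
rewrite !(tnth_tmerge _ _ (gm x0)); have ik := ltn_ord i.
rewrite !(nth_map x0) ?size_tuple ?ltnS //; try exact: ltnW.
rewrite /= !nth_bgen_seq //; case: ltngtP => [ij|ji|->].
- by rewrite !ltn_eqF // ltnW.
- by rewrite !gtn_eqF // ltnW.
- by rewrite !eqxx gtn_eqF // -gm_sigma.
Qed.

Lemma sum_merge k (j : 'I_k) (w : k.+1.-tuple X) :
  \sum_(s : 'S_k.+1) bgen3 (1%g : S)
    (tmerge j (map_tuple gm (perm_act sigma s w)) : tS k) 1%g
    *~ (-1) ^+ perm_len s = 0.
Proof.
have jk : (j.+1 < k.+1)%N by rewrite ltnS.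
pose t (s : 'S_k.+1) := (s * adj_perm jk)%g.
apply: (@sum_pairing _ _ _ t (fun s => perm_len s < perm_len (t s))%N).
- by move=> s; rewrite /t -mulgA adj_permK mulg1.
- move=> s; rewrite {2}/t -mulgA adj_permK mulg1 [LHS]ltnNge; congr negb.
  case: (perm_len_mulr s jk) => ->; rewrite -/(t s).
    by rewrite leqnSn ltnSn.
  by rewrite ltnn ltnNge leqnSn.
move=> s; rewrite /t; case: (perm_len_mulr s jk) => len; last first.
  by rewrite len ltnNge leqnSn.
move=> _; rewrite (perm_act_mulr sigma_braided) // tmerge_bgen //.
by rewrite len exprS mulN1r mulrNz.
Qed.

Lemma qs_chain k (w : k.+1.-tuple X) :
  ext (@bar_d S k) (qs w) = ext (@qs k) (braid_d w).
Proof.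
pose T (s : 'S_k.+1) := map_tuple gm (perm_act sigma s w).
have -> : ext (@bar_d S k) (qs w) =
    \sum_s bgen3 (tnth (T s) ord0) (tbehead (T s) : tS k) 1%g
      *~ (-1) ^+ perm_len s +
    \sum_s bgen3 (1%g : S) (tbelast (T s) : tS k) (tnth (T s) ord_max)
      *~ ((-1) ^+ k.+1 * (-1) ^+ perm_len s).
  rewrite raddf_sum; under eq_bigr => s _ do
    rewrite raddfMz /= ext_fgen /bar_d !mulrzDl -mulrzA.
  rewrite !big_split /=; congr (_ + _); rewrite -[RHS]addr0; congr (_ + _).
  under eq_bigr => s _ do rewrite mulrz_suml.
  rewrite exchange_big big1 //= => j _.
  under eq_bigr => s _ do rewrite mulrzAC.
  by rewrite -mulrz_suml sum_merge mul0rz.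
have -> : ext (@qs k) (braid_d w) =
    \sum_(i < k.+1) bimul (gm (tnth (pull_left sigma i w) ord0)) 1%g
      (qs (tbehead (pull_left sigma i w))) *~ (-1) ^+ i -
    \sum_(i < k.+1) bimul 1%g (gm (tnth (pull_right sigma i w) ord_max))
      (qs (tbelast (pull_right sigma i w))) *~ (-1) ^+ i.
  rewrite raddf_sum -sumrB; apply: eq_bigr => i _.
  by rewrite /= raddfMz raddfB /= !extU mulrzBl.
congr (_ + _).
  (* Left faces: s is sorted by the letter i that it brings to the front, which costs the sign of
     i. *)
  rewrite (sum_lift_perm ord0); apply: eq_bigr => i _.
  rewrite raddf_sum mulrz_suml; apply: eq_bigr => s _.
  have [h b] := perm_act_lift0 sigma_braided i s w.
  rewrite raddfMz /= bimul_fgen -mulrzA mulrC -exprD -perm_len_lift0 /T.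
  by rewrite tnth_map tbehead_map h b.
rewrite (sum_lift_perm ord_max) -sumrN; apply: eq_bigr => i _.
rewrite raddf_sum mulrz_suml -sumrN; apply: eq_bigr => s _.
have [h b] := perm_act_lift_max sigma_braided i s w.
rewrite (raddfMz (bimul _ _)) /= bimul_fgen -mulrzA /T tnth_map tbelast_map h b.
rewrite -mulrNz.
congr (_ *~ _); rewrite perm_len_lift_max -!exprD.
have ik : (i <= k)%N by rewrite -ltnS.
(* The exponents k + 1 + |s| + (k - i) and |s| + i have opposite parities, which accounts for the
   minus sign of the right faces. *)
rewrite -[in LHS]signr_odd -[in RHS]signr_odd.
rewrite !oddD oddS oddB //.
by case: (odd k); case: (odd i); case: (odd _); rewrite /= ?opprK.
Qed.

End QuantumSymmetrizer.

(** * Exactness of the braided complex modulo noncritical words *)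

Section BraidedResolution.
Variables (X : choiceType) (sigma : X * X -> X * X).
Hypothesis sigma_braided : braided sigma.
Hypothesis sigma_idem : forall p, sigma (sigma p) = sigma p.
Variable E : pred X.
Hypothesis E_sigma : forall e, E e -> forall x,
  sigma (e, x) \in [:: (e, x); (x, e)] /\
  sigma (x, e) \in [:: (e, x); (x, e)].
Hypothesis E_normal : forall e, E e -> forall u v,
  normal_word sigma (u ++ e :: v) -> normal_word sigma (u ++ v).
Variable R : seq X -> seq X -> Prop.
Hypothesis R_def : forall u v, R u v <->
  struct_rel sigma u v \/ (exists2 e, E e & u = [:: e] /\ v = [::]).
Variable norm : bool.
Hypothesis E_norm : forall e, E e -> norm.

Local Notation S := (presented R).
Local Notation fbim := (fbim S).
Local Notation tX k := (k.-tuple X : choiceType).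
Local Notation tS k := (k.-tuple S : choiceType).
Local Notation nfS := (nfS sigma E (R := R)).
Local Notation normal := (normal_word sigma).
Local Notation del := (del E).
Local Notation bad_S := (@bar_bad S norm).
Local Notation qs := (@qs _ sigma S (gen R)).
Local Notation braid_d := (@braid_d _ sigma S (gen R)).

Let g_sigma := gen_sigma R_def.

Definition crit (w : seq X) : bool :=
  all (predC E) w && sorted (fun x y => sigma (x, y) != (x, y)) w.

Definition noncrit k : pred (tX k) := fun w => ~~ crit w.

(** By the first axiom sigma leaves a pseudo-unit in place or exchanges it with its neighbour, but
    never loses it. *)
Lemma has_E_bgen j w : has E w -> has E (bgen_seq sigma j w).
Proof.
elim: j w => [|j IH] [|x w] //=; last by case/orP => [->|/IH->]; rewrite ?orbT.
case: w => [|y w] //=; rewrite orbA => /orP[Exy|->]; last by rewrite !orbT.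
rewrite orbA; apply/orP; left; case/orP: Exy => [Ex|Ey].
  have [+ _] := E_sigma Ex y.
  by rewrite !inE => /orP[]/eqP-> /=; rewrite Ex ?orbT.
have [_ +] := E_sigma Ey x.
by rewrite !inE => /orP[]/eqP-> /=; rewrite Ey ?orbT.
Qed.

Lemma has_E_bword e w : has E w -> has E (bword_seq sigma e w).
Proof. by elim: e => //= j e IH /IH; exact: has_E_bgen. Qed.

Lemma not_crit_cases w : ~~ crit w -> has E w \/
  exists2 j, (j.+1 < size w)%N & bgen_seq sigma j w = w.
Proof.
rewrite negb_and => /orP[|ns]; first by rewrite all_predC negbK; left.
right; elim: w ns => [|x [|y w] IH] //=.
rewrite negb_and negbK => /orP[/eqP xy|]; first by exists 0%N; rewrite //= xy.
by move=> /IH[j jw eq]; exists j.+1; rewrite //= -[in RHS]eq.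
Qed.

Lemma crit_bgen j w : (j.+1 < size w)%N -> bgen_seq sigma j w = w -> ~~ crit w.
Proof.
move=> jw eq; rewrite negb_and; apply/orP; right.
elim: j w jw eq => [|j IH] [|x w] //=; last first.
  move=> jw [eq]; have := IH _ jw eq; apply: contra.
  exact: path_sorted.
case: w => [|y w] //= _; case: (sigma (x, y)) => a b /= [-> ->].
by rewrite eqxx.
Qed.

Lemma map_gen_unit (w : seq X) : has E w -> norm && (1%g \in map (gen R) w).
Proof.
case/hasP => e ew Ee; rewrite (E_norm Ee) -(gen_E sigma_braided sigma_idem
  E_sigma E_normal R_def Ee); exact: map_f.
Qed.

(** If sigma fixes the letters at j and j + 1, then s and s preceded by s_j give the same word with
    opposite signs, and the sum is zero. A pseudo-unit survives in every T_s w and becomes 1 in S,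
    which makes the tuple bad. *)
Lemma qs_null k (w : tX k) : noncrit w -> qs w \in null (@bad_S k).
Proof.
move=> /not_crit_cases[Ew|[j]]; last first.
  rewrite size_tuple => jk eq; suff -> : qs w = 0 by exact: rpred0.
  pose t (s : 'S_k) := (adj_perm jk * s)%g.
  apply: (@sum_pairing _ _ _ t (fun s => perm_len s < perm_len (t s))%N).
  - by move=> s; rewrite /t mulgA adj_permK mul1g.
  - move=> s; rewrite {2}/t mulgA adj_permK mul1g [LHS]ltnNge; congr negb.
    case: (perm_len_mull s jk) => ->; rewrite -/(t s).
      by rewrite leqnSn ltnSn.
    by rewrite ltnn ltnNge leqnSn.
  move=> s; rewrite /t; case: (perm_len_mull s jk) => len; last first.
    by rewrite len ltnNge leqnSn.
  have eqw : bgen sigma j w = w by exact: val_inj.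
  move=> _; rewrite (perm_act_mull sigma_braided) // eqw.
  by rewrite len exprS mulN1r mulrNz.
apply: rpred_sum => s _; rewrite rpredMz // nullU //.
by apply: map_gen_unit; rewrite val_bword has_E_bword.
Qed.

(** A left inverse of [qs] modulo noncritical words: tuples of one-letter normal forms are read as
    words. In that branch the lengths add up to k, so [insub] succeeds. *)
Definition retract k (s : tS k) : fbim (tX k) :=
  if all (fun t => size (nfS t) == 1)%N s then
    if insub (flatten (map nfS s)) is Some w then fgen S (w : tX k) else 0
  else 0.

Lemma retract_null k (s : tS k) : bad_S s -> retract s \in null (@noncrit k).
Proof.
case/andP => _ us; rewrite /retract; case: allP => [all1|_]; last exact: rpred0.
have := all1 _ us; rewrite nfS_one //.
Qed.

Lemma retract_gen k (w : tX k) :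
  retract (map_tuple (gen R) w) - fgen S w \in null (@noncrit k).
Proof.
have nf_gen x := nfS_gen sigma_braided sigma_idem E_sigma E_normal R_def x.
case: (boolP (has E w)) => [Ew|nEw].
  rewrite /retract; case: allP => [all1|_]; last first.
    by rewrite sub0r rpredN nullU // /noncrit /crit all_predC Ew.
  have /hasP[e ew Ee] := Ew.
  by have := all1 _ (map_f (gen R) ew); rewrite nf_gen Ee.
rewrite -all_predC in nEw; rewrite /retract.
have -> : all (fun t => size (nfS t) == 1)%N (map_tuple (gen R) w).
  rewrite all_map; apply: sub_all nEw => x /= /negPf Ex.
  by rewrite nf_gen Ex.
have -> : flatten (map nfS (map_tuple (gen R) w)) = w.
  rewrite /= -map_comp; elim: (tval w) nEw => //= x v IH /andP[/negPf Ex /IH->].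
  by rewrite nf_gen Ex.
by rewrite valK subrr rpred0.
Qed.

Lemma retract_qs k (w : tX k) :
  ext (@retract k) (qs w) - fgen S w \in null (@noncrit k).
Proof.
pose u (s : 'S_k) : tX k := perm_act sigma s w.
have -> : ext (@retract k) (qs w) =
    \sum_(s : 'S_k) retract (map_tuple (gen R) (u s)) *~ (-1) ^+ perm_len s.
  by rewrite raddf_sum; apply: eq_bigr => s _; rewrite raddfMz /= ext_fgen.
rewrite (bigD1 1%g) //= addrAC; apply: rpredD.
  rewrite perm_len1 expr0 mulr1z /u (perm_act1 sigma_braided).
  exact: retract_gen.
apply: rpred_sum => s s1; rewrite rpredMz //.
rewrite -[retract _](subrK (fgen S (u s))); apply: rpredD.
  exact: retract_gen.
apply: nullU; rewrite /noncrit /u /perm_act.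
have [[vs _] _] := reduced_exprP s; have := @reduced_expr_nil _ s.
case: (reduced_expr s) vs => [|i e] /=.
  by move=> _ /(_ erefl) s1'; rewrite s1' eqxx in s1.
move=> /andP[ik _] _; apply: (@crit_bgen i).
  by rewrite size_bgen_seq val_bword size_bword_seq size_tuple.
exact: bgen_seq_idem.
Qed.

(* Through this lemma and [qs_chain], [braid_d] inherits from [bar_d] that it
   squares to zero and preserves non-critical words. *)
Lemma qs_injective k (z : fbim (tX k)) :
  ext (@qs k) z \in null (@bad_S k) -> z \in null (@noncrit k).
Proof.
move=> zN; rewrite -(subKr (ext (@retract k) (ext (@qs k) z)) z).
rewrite rpredB //; first by apply: ext_null zN; exact: retract_null.
rewrite -ext_comp -[X in _ - X]ext_id -extB.
by apply: ext_allnull => w; exact: retract_qs.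
Qed.

Lemma braid_d_null k (w : tX k.+1) :
  noncrit w -> braid_d w \in null (@noncrit k).
Proof.
move=> bw; apply: qs_injective; rewrite -(qs_chain sigma_braided g_sigma).
by apply: ext_null (qs_null bw) => s; exact: bar_d_null.
Qed.

Lemma braid_dd k (w : tX k.+2) :
  ext (@braid_d k) (braid_d w) \in null (@noncrit k).
Proof.
apply: qs_injective; rewrite -ext_comp.
rewrite (eq_ext (psi := fun v => ext (@bar_d S k) (qs v))) => [|v]; last first.
  by rewrite (qs_chain sigma_braided g_sigma).
rewrite ext_comp -(qs_chain sigma_braided g_sigma) -ext_comp.
rewrite (eq_ext (psi := fun _ => 0)); last exact: bar_dd.
by rewrite ext0 rpred0.
Qed.

Lemma qs0 (w : tX 0) : qs w = fgen S ([tuple] : tS 0).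
Proof.
rewrite /qs (big_pred1 1%g) => [|s]; last first.
  by apply/esym/eqP/perm.permP => -[].
by rewrite perm_len1 expr0 mulr1z; congr (fgen S _); exact: tuple0.
Qed.

Lemma braid_d_aug (w : tX 1) : aug (braid_d w) = 0.
Proof.
rewrite -[braid_d w]ext_id (aug_ext (psi := @qs 0%N)).
  rewrite -(qs_chain sigma_braided g_sigma).
  rewrite (@aug_ext _ _ _ _ _ (fun _ : tS 1 => 0 : fbim (tS 0))).
    by rewrite ext0 raddf0.
  by move=> s; rewrite bar_d_aug raddf0.
by move=> v; rewrite qs0 !augU.
Qed.

(* A cell a.w.b is moved up when the first letter of the normal form of b can be
   appended to w. *)
Definition up k (w : tX k) (b : S) : bool :=
  if nfS b is y :: v then crit (rcons w y) else false.

Definition len (b : S) : nat := size (nfS b).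

(** The sign is that of the last right face of the new cell in [braid_d], so that d h returns the
    old cell with coefficient 1. *)
Definition kos_h k : fbim (tX k) -> fbim (tX k.+1) :=
  blin (fun a (w : tX k) b =>
    if nfS b is y :: v then
      if crit (rcons w y) then
        bgen3 a (rcons_tuple w y : tX k.+1) (\pi_S v) *~ (-1) ^+ k.+1 else 0
    else 0).
HB.instance Definition _ k := GRing.isZmodMorphism.Build _ _ (@kos_h k)
  (blin_additive _).

Lemma kos_hU k a (w : tX k) b y v : nfS b = y :: v -> crit (rcons w y) ->
  kos_h (bgen3 a w b) =
  bgen3 a (rcons_tuple w y : tX k.+1) (\pi_S v) *~ (-1) ^+ k.+1.
Proof. by move=> bE cr; rewrite /kos_h blinU bE cr. Qed.

Lemma kos_h0 k a (w : tX k) b : ~~ up w b -> kos_h (bgen3 a w b) = 0.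
Proof.
by rewrite /kos_h blinU /up; case: (nfS b) => // y v /negPf->.
Qed.

Lemma nf_tail b y v : nfS b = y :: v ->
  [/\ nfS (\pi_S v) = v, b = (gen R y * \pi_S v)%g, ~~ E y &
   normal (y :: v)].
Proof.
move=> bE; have nb := normal_nfS sigma_braided sigma_idem E_normal b.
have eb := nfS_noE sigma E b.
move: nb eb; rewrite bE => nb /= /andP[Ey Ev]; split=> //.
  rewrite (nfS_pi sigma_braided sigma_idem E_sigma E_normal R_def) nf_id //.
  exact: path_sorted nb.
by rewrite -[LHS](pi_nfS R_def) bE [RHS]pmul_pi.
Qed.

Lemma critW w y : crit (rcons w y) -> crit w.
Proof.
move=> /andP[]; rewrite all_rcons => /andP[_ Ew] sw; apply/andP; split=> //.
by move: sw; case: w {Ew} => //= x w; rewrite rcons_path => /andP[].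
Qed.

Lemma len_gen_mul x b : (len (gen R x * b)%g <= (len b).+1)%N.
Proof.
rewrite /len (nfS_gen_mul sigma_braided sigma_idem E_sigma E_normal R_def).
by rewrite size_filter (leq_trans (count_size _ _)) // size_ins.
Qed.

Local Notation short n := (fun (_ : S) _ (b : S) => (len b < n)%N).
(** Cells that count as lower than a cell with [len b = n] which can be moved up: shorter ones, and
    those of length at most n that cannot be moved up. *)
Local Notation descent n :=
  (fun (_ : S) w (b : S) => (len b < n) || (~~ up w b && (len b <= n)))%N.

(** A noncritical word stays noncritical when a letter is appended. *)
Lemma kos_h_null k z : z \in null (@noncrit k) -> kos_h z = 0.
Proof.
move=> zN; apply: (@bsupp0 _ _ (fun _ _ _ => false)) => //.
apply: bsupp_additive zN => a w b bw; rewrite /= kos_h0 ?rpred0 // /up.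
by case: (nfS b) => // y v; apply: contra bw => /critW.
Qed.

Lemma kos_h_short k n z : z \in bsupp (K := tX k) (descent n.+1) ->
  kos_h z \in bsupp (K := tX k.+1) (short n).
Proof.
apply: bsupp_blin => a w b; rewrite /up /len.
case bE: (nfS b) => [|y v] /=; first by rewrite rpred0.
case: ifP => cr; rewrite ?rpred0 // orbF ltnS => vn.
by rewrite rpredMz // bsuppU //; have [-> _ _ _] := nf_tail bE.
Qed.

Lemma braid_d_short k n z : z \in bsupp (K := tX k.+1) (short n) ->
  ext (@braid_d k) z \in bsupp (K := tX k) (short n.+1).
Proof.
apply: bsupp_additive => a w b bn; rewrite /= extU raddf_sum.
apply: rpred_sum => i _; rewrite raddfMz rpredMz // raddfB rpredB //= bimulU.
  by rewrite bsuppU // mul1g ltnW.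
by rewrite bsuppU // (leq_ltn_trans (len_gen_mul _ _)).
Qed.

(** The leading term of d h is the cell itself. Left faces of w y . v keep the shorter coefficient
    v, and the right faces that pull a letter of w do not move up. *)
Lemma kos_up k a (w : tX k) b n : up w b -> len b = n ->
  ext (@braid_d k) (kos_h (bgen3 a w b)) - bgen3 a w b
    \in bsupp (K := tX k) (descent n).
Proof.
rewrite {1}/up /len; case bE: (nfS b) => [|y v] // cr /= nE.
have [vE bM nEy ny] := nf_tail bE; rewrite (kos_hU _ bE cr).
rewrite raddfMz /= extU raddf_sum.
have left_short x (t : tX k) :
    bimul a (\pi_S v) (bgen3 (gen R x) t 1%g) \in bsupp (descent n).
  by rewrite bimulU bsuppU // mul1g /len vE -nE ltnSn.
have split_last (V : zmodType) (p q c : V) t :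
    (p + q) *~ t - c = p *~ t + (q *~ t - c) by rewrite mulrzDl addrA.
(* The index k is set apart: its right face pulls y itself and restores a . w . b. *)
rewrite big_ord_recr split_last; apply: rpredD.
  apply: rpredMz; apply: rpred_sum => i _; rewrite raddfMz; apply: rpredMz.
  rewrite raddfB /=; apply: rpredB; first exact: left_short.
  rewrite bimulU.
  have [u [x [tE ->]]] := pull_right_rcons sigma w y (ltn_ord i).
  apply: bsuppU; set x'' := (sigma (x, y)).2.
  apply/orP; right; apply/andP; split; last first.
    by apply: leq_trans (len_gen_mul _ _) _; rewrite /len vE -nE.
  rewrite /up (nfS_gen_mul sigma_braided sigma_idem E_sigma E_normal R_def) vE.
  (* The word x' ([ins] x'' v) is normal, also after deletion in its tail. So the first letter of
     the normal form of x'' v forms a fixed pair with x', the last letter of the face. *)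
  have := normal_ins sigma_braided sigma_idem x ny.
  move=> /= /(@normal_del_cat _ _ _ E_normal [:: _] _) /=.
  rewrite -/x''; case: (del _) => // z r /andP[/eqP nz _].
  rewrite tE; apply: (@crit_bgen (size u)); first by rewrite !size_rcons.
  by rewrite bgen_seq_last nz.
rewrite [pull_right _ _ _](_ : _ = rcons_tuple w y); last first.
  by rewrite /pull_right /= subnn.
rewrite raddfMz -mulrzA tbelast_rcons tnth_rcons_max.
have -> : (-1) ^+ k * (-1) ^+ k.+1 = -1 :> int.
  by rewrite exprS mulrCA -expr2 sqrr_sign mulr1.
rewrite mulrN1z raddfB opprB /= [X in X - _ - _]bimulU mulg1 -bM.
by rewrite addrAC subrr sub0r rpredN; exact: left_short.
Qed.

(** Write w = w' x. The cell is, up to sign, h of the cell a . w' . x b, which does move up;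
    applying h to [kos_up] for the latter gives the claim, as h shortens the lower cells. *)
Lemma kos_down k a (w : tX k.+1) b : crit w -> ~~ up w b ->
  kos_h (ext (@braid_d k) (bgen3 a w b)) - bgen3 a w b
    \in bsupp (K := tX k.+1) (short (len b)).
Proof.
have [w' [x ->]] := tuple_rconsP w; rewrite val_rcons_tuple => cr nup.
have Ex : ~~ E x by move: cr; rewrite /crit all_rcons => /andP[/andP[]].
have bE : nfS (gen R x * b)%g = x :: nfS b.
  rewrite (nfS_gen_mul sigma_braided sigma_idem E_sigma E_normal R_def).
  (* Since w is critical and y is no pseudo-unit, appending y can fail to be critical only if sigma
     fixes (x, y). *)
  have nxb : normal (x :: nfS b).
    have := normal_nfS sigma_braided sigma_idem E_normal b.
    have := nfS_noE sigma E b; move: nup; rewrite /up.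
    case: (nfS b) => [|y v] // ncr; rewrite [all _ _]/= => /andP[Ey _] nv.
    rewrite normal_cons nv andbT; apply: contraR ncr => nxy.
    rewrite val_rcons_tuple; move: cr.
    rewrite /crit !all_rcons /= Ey => /andP[-> +].
    case: (tval w') => [|z t] /=; first by rewrite nxy.
    by rewrite !rcons_path last_rcons => ->.
  rewrite ins_id // del_cons (negPf Ex); congr cons.
  by apply/all_filterP; exact: nfS_noE.
have upc : up w' (gen R x * b)%g by rewrite /up bE.
have := kos_up a upc (erefl _); rewrite (kos_hU _ bE cr) (pi_nfS R_def).
set c := bgen3 a _ b; rewrite raddfMz => /= dc.
have -> : kos_h (ext (@braid_d k) c) - c =
    kos_h (ext (@braid_d k) c *~ (-1) ^+ k.+1 - bgen3 a w' (gen R x * b)%g)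
      *~ (-1) ^+ k.+1.
  rewrite (raddfB (@kos_h k)) (raddfMz (@kos_h k)) /= (kos_hU _ bE cr).
  by rewrite (pi_nfS R_def) -/c -mulrzBl -mulrzA -expr2 sqrr_sign mulr1z.
rewrite rpredMz //; apply: kos_h_short; move: dc.
by rewrite /len bE.
Qed.

Lemma kos_up_step k n z : z \in bsupp (K := tX k) (short n.+1) ->
  z - ext (@braid_d k) (kos_h z) \in bsupp (K := tX k) (descent n).
Proof.
apply: (@bsupp_additive _ _ _ _ _
  (idfun \- (ext (@braid_d k) \o @kos_h k))) => a w b /=; rewrite ltnS => bn.
case: (boolP (up w b)) => ub; last first.
  rewrite kos_h0 // raddf0 subr0 bsuppU //.
  by move: bn; rewrite ub leq_eqVlt => /orP[->|->] //; rewrite orbT.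
rewrite -opprB rpredN; apply: bsuppS (kos_up a ub erefl) => a' w' b'.
case/orP => [lb|/andP[-> lb]]; first by rewrite (leq_trans lb).
by rewrite (leq_trans lb) ?orbT.
Qed.

Lemma kos_down_step k n z : z \in bsupp (K := tX k.+1) (descent n) ->
  kos_h (ext (@braid_d k) z) - z
    \in bsupp (K := tX k.+1) (fun a w b => short n a w b || noncrit w).
Proof.
apply: (@bsupp_additive _ _ _ _ _
  ((@kos_h k \o ext (@braid_d k)) \- idfun)) => a w b /=.
case: ltnP => [bn _|nb /= /andP[ub bn]].
  apply: rpredB; last by rewrite bsuppU // bn.
  apply: (@bsuppS _ _ (short n)) => [a' w' b' -> //|].
  apply: kos_h_short; apply: (@bsuppS _ _ (short n.+1)) => [a' w' b' -> //|].
  by apply: braid_d_short; exact: bsuppU.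
case: (boolP (crit w)) => cw.
  apply: bsuppS (kos_down a cw ub) => a' w' b' lb.
  by rewrite (leq_trans lb).
rewrite kos_h_null; last first.
  by rewrite extU; apply/bimul_null/braid_d_null.
by rewrite sub0r rpredN bsuppU // /noncrit cw orbT.
Qed.

Local Notation cyc k :=
  (is_cycle (K := fun m => tX m) noncrit braid_d (k := k)).

(** One round of the induction uses both lemmas: subtracting d h z leaves only cells of [descent n],
    and on a cycle these are short up to noncritical ones. *)
Lemma kos_exact k (z : fbim (tX k.+1)) : cyc k.+1 z ->
  exists y, z - ext (@braid_d k.+1) y \in null (@noncrit k.+1).
Proof.
have [n] := bsupp_bounded len z; elim: n z => [|n IH] z zn zc.
  by exists 0; rewrite (bsupp0 _ zn) // raddf0 subrr rpred0.
pose z1 := z - ext (@braid_d k.+1) (kos_h z).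
have z1n : z1 \in bsupp (descent n) := kos_up_step zn.
have z1c : ext (@braid_d k) z1 \in null (@noncrit k).
  rewrite raddfB rpredB //= -ext_comp; apply: ext_allnull => w.
  exact: braid_dd.
(* As d z1 is null, h d z1 = 0, and [kos_down_step] now speaks of z1 alone. Only its short part z2
   is passed to the induction. *)
have := kos_down_step z1n; rewrite (kos_h_null z1c) sub0r rpredN.
move=> /bsupp_split[z2 z2n z12]; have [|y yz2] := IH z2 z2n.
  rewrite /= -(subKr z1 z2) raddfB rpredB //=.
  by apply: ext_null z12 => w; exact: braid_d_null.
exists (kos_h z + y).
have -> : z - ext (@braid_d k.+1) (kos_h z + y) =
    (z1 - z2) + (z2 - ext (@braid_d k.+1) y).
  by rewrite addrA subrK raddfD opprD addrA.
exact: rpredD.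
Qed.

(** Here w is empty, so every cell with b different from 1 moves up and d h shortens it. On the
    cells with b = 1 that remain, the augmentation is injective. *)
Lemma kos_exact0 (z : fbim (tX 0)) : aug z = 0 ->
  exists y, z - ext (@braid_d 0) y \in null (@noncrit 0).
Proof.
have base (x : fbim (tX 0)) : x \in bsupp (short 1) ->
    x = linearize (fun s : S => bgen3 s ([tuple] : tX 0) 1%g) (aug x).
  pose L : {additive _ -> _} :=
    linearize (fun s : S => bgen3 s ([tuple] : tX 0) 1%g).
  move=> x0; apply/eqP; rewrite -subr_eq0; apply/eqP.
  apply: (@bsupp0 _ _ (fun _ _ _ => false)) => //.
  move: x0; apply: (@bsupp_additive _ _ _ _ _ (idfun \- (L \o @aug S _))).
  move=> a w b /=; rewrite ltnS leqn0 size_eq0 => /eqP/(nfS_nil R_def) ->.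
  by rewrite augU mulg1 linearizeU [w]tuple0 subrr rpred0.
have [n] := bsupp_bounded len z; case: n => [|n].
  by move=> zn _; exists 0; rewrite (bsupp0 _ zn) // raddf0 subrr rpred0.
elim: n z => [|n IH] z zn z0.
  by exists 0; rewrite raddf0 subr0 (base _ zn) z0 raddf0 rpred0.
pose z1 := z - ext (@braid_d 0) (kos_h z).
have z1n : z1 \in bsupp (short n.+1).
  apply: bsuppS (kos_up_step zn) => a w b /orP[//|/andP[]].
  rewrite /up /len; have := nfS_noE sigma E b.
  case: (nfS b) => // y v /= /andP[Ey _].
  by rewrite [w]tuple0 /crit /= Ey.
have [|y yz1] := IH z1 z1n.
  rewrite raddfB /= z0 sub0r
    (@aug_ext _ _ _ _ _ (fun _ : tX 1 => 0 : fbim (tX 0))).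
    by rewrite ext0 raddf0 oppr0.
  by move=> w; rewrite braid_d_aug raddf0.
exists (kos_h z + y); rewrite raddfD opprD addrA; exact: yz1.
Qed.

Lemma braid_resolution : resolution (K := fun k => tX k) noncrit braid_d.
Proof.
split=> [w|k w|[|k] w|[|k] z].
- by rewrite [w]tuple0.
- exact: braid_d_null.
- exact: braid_d_aug.
- exact: braid_dd.
- exact: kos_exact0.
- exact: kos_exact.
Qed.

Lemma qs_hom : @chain_hom S (fun k => tX k) (fun k => tS k)
  noncrit bad_S braid_d (@bar_d S) (fun k => @qs k).
Proof.
split=> k w; first exact: qs_null.
by rewrite (qs_chain sigma_braided g_sigma) subrr rpred0.
Qed.

Lemma qs_aug (w : tX 0) : aug (qs w) = << 1%g >>.
Proof. by rewrite qs0 augU mulg1. Qed.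

End BraidedResolution.

(** * Critical and Hochschild complexes *)

Section Linearized.
Variables (K L : choiceType) (M : zmodType).

Lemma linearizeMz (f : K -> M) t n :
  linearize f (t *~ n) = linearize f t *~ n.
Proof. exact: raddfMz. Qed.

Lemma linearize_sum (I : finType) (f : K -> M) (g : I -> K) (n : I -> int) :
  linearize f (\sum_i << g i >> *~ n i) = \sum_i f (g i) *~ n i.
Proof.
by rewrite raddf_sum; apply: eq_bigr => i _; rewrite /= linearizeMz linearizeU.
Qed.

Lemma tensE (m : M) (t : {malg int[K]}) :
  tens m t = linearize (fun w => << m *g w >>) t.
Proof. by apply: eq_bigr => w _; rewrite raddfMz. Qed.

Lemma tensU (m : M) (w : K) : tens m << w >> = << m *g w >>.
Proof. by rewrite tensE linearizeU. Qed.

Lemma mpush_intE (f : K -> L) (t : {malg int[K]}) :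
  mpush f t = linearize (fun w => << f w >>) t.
Proof. by apply: eq_bigr => w _; rewrite malg_intE. Qed.

Lemma kill_unitsE (S : monoidType) k (t : {malg int[k.-tuple S]}) :
  kill_units t = linearize
    (fun s : k.-tuple S => if 1%g \in s then 0 else << s >>) t.
Proof.
by apply: eq_bigr => s _; case: ifP => _; rewrite ?mul0rz // malg_intE.
Qed.

Lemma lin_vanish_bad (P : pred K) (T : set {malg int[K]}) (f : K -> M) :
  (forall t, T t <-> t \in badsupp P) ->
  reflect (forall w, P w -> f w = 0) (f \in lin_vanish_on T).
Proof.
move=> TP; apply: (iffP (asboolP _)) => [f0 w Pw|f0 t /TP tP].
  by rewrite -(linearizeU f) f0 //; apply/TP/badsuppU.
apply: big1_seq => w /andP[_ wt]; rewrite f0 ?mul0rz //.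
exact: (badsuppP _ _ tP).
Qed.

Lemma gen_subgroup_bad (P : pred K) (G : set {malg M[K]}) c :
  (forall c, G c -> c \in badsupp P) ->
  (forall m w, P w -> G << m *g w >>) ->
  (c \in gen_subgroup G) = (c \in badsupp P).
Proof.
move=> GP PG; apply/idP/idP => [/asboolP cG|/badsuppP cP].
  by apply: (cG (fun c => c \in badsupp P)); split; first split => [|x y] /=;
    [exact: rpred0|exact: rpredB|exact: GP].
rewrite [c]monalgE big_seq; apply: rpred_sum => w /cP Pw.
by apply/asboolP => A [_]; apply; exact: PG.
Qed.

End Linearized.

Section Quantum.
Variables (X : choiceType) (sigma : X * X -> X * X).

Lemma quantum_symU k (w : k.-tuple X) :
  quantum_sym sigma << w >> =
  \sum_(s : 'S_k) << map_tuple (gen (struct_rel sigma)) (perm_act sigma s w) >>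
    *~ (-1) ^+ perm_len s.
Proof.
rewrite /quantum_sym mpush_intE raddf_sum; apply: eq_bigr => s _.
by rewrite raddfMz mpush_intE linearizeU /= linearizeU.
Qed.

(** The representative of the class of x may be any congruent word, but congruence in the structure
    monoid persists in its quotient. *)
Lemma presented_proj_gen e x :
  presented_proj (red_struct_rel sigma e) (gen (struct_rel sigma) x) =
  gen (red_struct_rel sigma e) x.
Proof.
apply/presentedP; have := repr_cong (struct_rel sigma) [:: x].
elim=> [u a b v ab|u|u v _|u v w _ uv _ vw].
- by apply: cong_step; left.
- exact: cong_refl.
- exact: cong_sym.
- exact: cong_trans uv vw.
Qed.

Lemma map_presented_proj e k (w : k.-tuple X) :
  map_tuple (presented_proj (red_struct_rel sigma e))
    (map_tuple (gen (struct_rel sigma)) w) =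
  map_tuple (gen (red_struct_rel sigma e)) w.
Proof.
apply: val_inj; rewrite /= -map_comp; apply: eq_map => x.
exact: presented_proj_gen.
Qed.

Lemma red_quantum_symU e k (w : k.-tuple X) :
  red_quantum_sym sigma e << w >> =
  \sum_(s : 'S_k)
    (let t := map_tuple (gen (red_struct_rel sigma e)) (perm_act sigma s w) in
     if 1%g \in t then 0 else << t >>) *~ (-1) ^+ perm_len s.
Proof.
rewrite /red_quantum_sym kill_unitsE quantum_symU mpush_intE !linearize_sum.
by apply: eq_bigr => s _; rewrite map_presented_proj.
Qed.

End Quantum.

(** * The ideals are spanned by noncritical words *)

Section Ideals.
Variables (X : choiceType) (sigma : X * X -> X * X) (E : pred X).
Local Notation crit := (crit sigma E).
Local Notation ZX := {malg int[{fmonom X}]}.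
Local Open Scope classical_set_scope.

Lemma crit_cat u v : crit (u ++ v) -> crit u /\ crit v.
Proof.
rewrite /crit all_cat => /andP[/andP[-> ->]].
case: u => [|x u]; first by split.
rewrite /= cat_path => /andP[-> /= pv]; split=> //.
by case: v pv => //= y v /andP[].
Qed.

Definition noncrit_monom : pred {fmonom X} := fun m => ~~ crit (fmonom_val m).

Lemma fmonom_mulE (u v : {fmonom X}) : mmul u v = FMonom (u ++ v).
Proof. exact: fmmulE. Qed.

(** Factors of critical words are critical, so one noncritical factor makes a product
    noncritical. *)
Lemma noncrit_ideal :
  two_sided_ideal (fun z => z \in @badsupp _ int noncrit_monom).
Proof.
split; first by split=> [|x y] /=; [exact: rpred0|exact: rpredB].
move=> a x /badsuppP xN; split;
  apply/badsuppP => m /msuppM_le[u [v [ux vx ->]]].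
  rewrite /noncrit_monom fmonom_mulE /=.
  by apply: contra (xN _ vx) => /crit_cat[].
rewrite /noncrit_monom fmonom_mulE /=.
by apply: contra (xN _ ux) => /crit_cat[].
Qed.

Variable G : set ZX.
Hypothesis G_E : forall e, E e -> G << FMonom [:: e] >>.
Hypothesis G_normal : forall x y, sigma (x, y) = (x, y) ->
  G << FMonom [:: x; y] >>.
Hypothesis G_bad : forall g, G g -> g \in badsupp noncrit_monom.
Local Notation I := (smallest (@two_sided_ideal X) G).

(** The noncritical words span an ideal containing G; conversely each of them has an element of G as
    a factor. *)
Lemma word_incl_bad k (t : {malg int[k.-tuple X]}) :
  I (word_incl t) <-> t \in badsupp (@noncrit X sigma E k).
Proof.
have inclE := @mpush_intE _ _ (fun w : k.-tuple X => FMonom (tval w)).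
split=> [/(_ _ (conj noncrit_ideal G_bad)) /= /badsuppP tN|tN].
  apply/badsuppP => w wt; apply: (tN (FMonom (tval w))).
  (* Distinct words remain distinct monomials, so the coefficient of w does not change. *)
  rewrite -mcoeff_neq0 /word_incl inclE /linearize /mlift raddf_sum /=.
  rewrite (big_fsetD1 w) //= big_seq big1 ?addr0; last first.
    move=> v; rewrite !inE => /andP[vw _].
    rewrite raddfMz /= mcoeffU; case: eqP => [[/val_inj vw']|_]; last first.
      by rewrite mulr0n mul0rz.
    by rewrite vw' eqxx in vw.
  by rewrite raddfMz /= mcoeffUU intz mcoeff_neq0.
move=> J [[[J0 JB] JM] GJ].
have JN x : J x -> J (- x) by move=> Jx; rewrite -sub0r; exact: JB.
have JD x y : J x -> J y -> J (x + y).
  by move=> Jx Jy; rewrite -[y]opprK; apply: JB => //; exact: JN.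
have JU (u v : seq X) g : J << FMonom g >> -> J << FMonom (u ++ g ++ v) >>.
  move=> Jg; have := (JM << FMonom v >> _ (JM << FMonom u >> _ Jg).1).2.
  rewrite !malgM_def !fgmulUU !mulr1.
  by rewrite !fmonom_mulE /= catA.
have JP (w : k.-tuple X) : ~~ crit w -> J << FMonom (tval w) >>.
  move=> /not_crit_cases[/hasP[e ew Ee]|[j jw eq]].
    case/splitPr: ew => u v; rewrite -[e :: v]/([:: e] ++ v).
    exact/JU/GJ/G_E.
  have [u [v [x [y [-> xy]]]]] : exists u v x y,
      tval w = u ++ [:: x; y] ++ v /\ sigma (x, y) = (x, y).
    elim: j (tval w) jw eq => [|j IH] [|x s] //=.
      case: s => [|y s] //= _ [e1 e2]; exists [::], s, x, y; split=> //.
      by rewrite [LHS]surjective_pairing e1 e2.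
    move=> js [eqs]; have [u [v [y [z [-> yz]]]]] := IH _ js eqs.
    by exists (x :: u), v, y, z.
  exact/JU/GJ/G_normal.
rewrite /word_incl inclE /linearize /mlift; rewrite [big_op in J big_op]big_seq.
elim/big_rec: _ => // w x wt Jx; apply: (JD) => //.
have Jw : J << FMonom (tval w) >> by apply/JP/(badsuppP _ _ tN).
have Jn n : J (<< FMonom (tval w) >> *+ n).
  by elim: n => [|n IHn]; rewrite ?mulr0n // mulrS; apply: (JD).
case: (t@_w) => n; first by rewrite -pmulrn.
by rewrite NegzE mulrNz -pmulrn; exact: JN.
Qed.

End Ideals.

Section TwoSidedIdeals.
Variables (X : choiceType) (sigma : X * X -> X * X).
Local Open Scope classical_set_scope.

Lemma word_incl_badsupp (E : pred X) k (t : {malg int[k.-tuple X]}) :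
  t \in badsupp (@noncrit X sigma E k) ->
  word_incl t \in badsupp (noncrit_monom sigma E).
Proof. by apply: badsupp_mlift => w n bw; exact: badsuppU. Qed.

Lemma word_inclU k (w : k.-tuple X) : word_incl << w >> = << FMonom (tval w) >>.
Proof. by rewrite /word_incl mpush_intE linearizeU. Qed.

Lemma Rminus_bad (E : pred X) c :
  Rminus sigma c -> c \in badsupp (@noncrit X sigma E 2).
Proof.
move=> /(_ (fun c => c \in badsupp (@noncrit X sigma E 2))); apply.
split; first by split=> [|x y]; [exact: rpred0|exact: rpredB].
move=> _ [x [y [xy ->]]]; apply: badsuppU; rewrite /noncrit.
by apply: (@crit_bgen _ _ _ 0) => //=; rewrite xy.
Qed.

Lemma Rminus_normal x y : sigma (x, y) = (x, y) ->
  (@word_incl X 2 @` Rminus sigma) << FMonom [:: x; y] >>.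
Proof.
move=> xy; exists << [tuple x; y] >>; last by rewrite word_inclU.
by move=> A [_]; apply; exists x, y.
Qed.

Lemma TminusE k (t : {malg int[k.-tuple X]}) :
  Tminus sigma t <-> t \in badsupp (@noncrit X sigma pred0 k).
Proof.
apply: (@word_incl_bad _ sigma pred0) => // [x y|_ [c cR <-]].
  exact: Rminus_normal.
exact/word_incl_badsupp/Rminus_bad.
Qed.

Lemma TunitE e k (t : {malg int[k.-tuple X]}) :
  Tunit sigma e t <-> t \in badsupp (@noncrit X sigma (pred1 e) k).
Proof.
apply: (@word_incl_bad _ sigma (pred1 e)) =>
  [_ /eqP-> |x y xy|_ [[c cR <-]|->]].
- by right.
- by left; exact: Rminus_normal.
- exact/word_incl_badsupp/Rminus_bad.
- by apply: badsuppU; rewrite /noncrit_monom /crit /= eqxx.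
Qed.

End TwoSidedIdeals.

(** * The complexes of the theorem as bimodule complexes with coefficients *)

Section ComplexPresentations.
Variables (S : monoidType) (M : zmodType) (BS : mon_bimodule S M).

Section HochschildDifferentials.
Local Notation tS := (fun k => (k.-tuple S : choiceType)).

Lemma hoch_diffE k (c : {malg M[k.+1.-tuple S]}) :
  hoch_diff BS c = chainM BS (@bar_d S k) c.
Proof.
apply: (@malg_addP _ _ _ (@hoch_diff _ _ BS k) (chainM BS (@bar_d S k))).
move=> m s; rewrite /= chainMU /hoch_diff
  (mliftU (fun s => @hoch_bd _ _ BS k s)).
rewrite /hoch_bd /bar_d actE !raddfD /= raddf_sum raddfMz /= !blinU.
rewrite mact_l1 mact_r1; congr (_ + _ + _); apply: eq_bigr => j _.
by rewrite raddfMz /= blinU mact_l1 mact_r1.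
Qed.

Lemma hoch_codiffE k (f : k.-tuple S -> M) :
  hoch_codiff BS f = cochM BS (@bar_d S k) f.
Proof.
apply/funext => s.
rewrite /hoch_codiff /cochM /bar_d !raddfD /= raddf_sum raddfMz /= !covU.
rewrite mact_l1 mact_r1; congr (_ + _ + _); apply: eq_bigr => j _.
by rewrite raddfMz /= covU mact_l1 mact_r1.
Qed.
End HochschildDifferentials.

Section Abstract.
Variables (K : nat -> choiceType) (bad : forall k, pred (K k)).
Variable d : forall k, K k.+1 -> fbim S (K k).
Hypothesis d_null : forall k (w : K k.+1), bad w -> d w \in null (bad (k := k)).

Section Chain.
Variable dC : forall k, {additive {malg M[K k.+1]} -> {malg M[K k]}}.
Hypothesis dCE : forall k c, dC k c = chainM BS (d (k := k)) c.
Let C := @ChainSeq (fun k => {malg M[K k]}) dC.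

Lemma free_chain_pres : (forall k (w : K k), ~~ bad w) ->
  chain_pres BS bad d (C := C) (fun k => idfun).
Proof.
move=> good; split=> [k x|k c|k c]; [by exists x| |exact: dCE].
apply/idP/idP => [/eqP/= ->|cN]; first exact: rpred0.
by apply/eqP; apply: badsupp0 cN; exact: good.
Qed.

Variable N : forall k, zmodClosed (C k).
Hypothesis NE : forall k c, (c \in N k) = (c \in badsupp (bad (k := k))).

Lemma quot_chain_stable : chain_stable N.
Proof.
move=> k x; rewrite !NE [cdiff _ _ _]dCE => xN.
by apply: chainM_bad xN; exact: d_null.
Qed.

Lemma quot_chain_pres (h : chain_stable N) :
  chain_pres BS bad d (C := quot_chain h) (fun k => \pi_{ideal_quot N k}).
Proof.
split=> [k x|k c|k c]; first by exists (repr x); exact: reprK.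
- rewrite -NE -[c in RHS]subr0 Quotient.idealrBE.
  by rewrite (raddf0 \pi_{ideal_quot N k}).
- by rewrite -dCE; exact: quot_diff_pi.
Qed.
End Chain.

Section Cochain.
Variable dD : forall k, {additive (K k -> M) -> (K k.+1 -> M)}.
Hypothesis dDE : forall k f, dD k f = cochM BS (d (k := k)) f.
Let D := @CochainSeq (fun k => K k -> M) dD.

Lemma free_cochain_pres : (forall k (w : K k), ~~ bad w) ->
  cochain_pres BS bad d (D := D) (fun k => idfun).
Proof.
move=> good; split=> [k x y //|k x w|k f _|k f]; last exact: dDE.
- by rewrite (negPf (good _ w)).
- by exists f.
Qed.

Variable P : forall k, zmodClosed (D k).
Hypothesis PE : forall k (f : K k -> M),
  reflect (forall w, bad w -> f w = 0) (f \in P k).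

Lemma sub_cochain_stable : cochain_stable P.
Proof.
move=> k f /PE f0; apply/PE => w bw; rewrite [codiff _ _ _]dDE.
by apply: cov_null (d_null bw) => v; exact: f0.
Qed.

Lemma sub_cochain_pres (h : cochain_stable P) :
  cochain_pres BS bad d (D := sub_cochain h) (fun k => val).
Proof.
split=> [k|k x w bw|k f /PE fP|k x]; first exact: val_inj.
- by move/PE: (valP x); exact.
- by exists (SubGrp fP).
- exact: dDE.
Qed.
End Cochain.
End Abstract.
End ComplexPresentations.

Section BraidedDifferentials.
Variables (X : choiceType) (sigma : X * X -> X * X).
Variables (M : zmodType) (B : bimodule sigma M).
Variable R : seq X -> seq X -> Prop.
Local Notation S := (presented R).
Variable BS : mon_bimodule S M.
Hypothesis BS_r : forall m x, mact_r BS m (gen R x) = bact_r B m x.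
Hypothesis BS_l : forall x m, mact_l BS (gen R x) m = bact_l B x m.
Local Notation g := (gen R).
Local Notation qs := (@qs _ sigma S g).
Local Notation braid_d := (@braid_d _ sigma S g).

Lemma act_sum (K : choiceType) (I : finType) (z : I -> fbim S K) n m :
  act BS (\sum_i z i *~ n i) m = \sum_i act BS (z i) m *~ n i.
Proof.
by rewrite actE raddf_sum; apply: eq_bigr => i _; rewrite raddfMz.
Qed.

Lemma cov_sum (K : choiceType) (I : finType) (z : I -> fbim S K) n f :
  cov BS f (\sum_i z i *~ n i) = \sum_i cov BS f (z i) *~ n i.
Proof. by rewrite raddf_sum; apply: eq_bigr => i _; rewrite raddfMz. Qed.

Lemma braid_diffE k (c : {malg M[k.+1.-tuple X]}) :
  braid_diff B c = chainM BS (@braid_d k) c.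
Proof.
apply: (@malg_addP _ _ _ (@braid_diff _ _ _ B k) (chainM BS (@braid_d k))).
move=> m w; rewrite /= chainMU /braid_diff
  (mliftU (fun w => @braid_bd _ _ _ B k w)) /= /braid_bd /braid_d act_sum.
apply: eq_bigr => i _; rewrite actB.
rewrite [X in _ = (X - _) *~ _]actU [X in _ = (_ - X) *~ _]actU.
by rewrite mact_l1 mact_r1 BS_r BS_l.
Qed.

Lemma braid_codiffE k (f : k.-tuple X -> M) :
  braid_codiff B f = cochM BS (@braid_d k) f.
Proof.
apply/funext => w; rewrite /braid_codiff /cochM /braid_d cov_sum.
apply: eq_bigr => i _; rewrite [X in _ = X *~ _]raddfB /=.
rewrite [X in _ = (X - _) *~ _]covU [X in _ = (_ - X) *~ _]covU.
by rewrite mact_l1 mact_r1 BS_r BS_l.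
Qed.

Lemma act_qs k (w : k.-tuple X) m :
  act BS (qs w) m = \sum_(s : 'S_k)
    << m *g map_tuple g (perm_act sigma s w) >> *~ (-1) ^+ perm_len s.
Proof.
rewrite act_sum; apply: eq_bigr => s _.
by rewrite [act _ _ _]actU mact_r1 mact_l1.
Qed.

Lemma cov_qs k (w : k.-tuple X) f :
  cov BS f (qs w) = \sum_(s : 'S_k)
    f (map_tuple g (perm_act sigma s w)) *~ (-1) ^+ perm_len s.
Proof.
rewrite cov_sum; apply: eq_bigr => s _.
by rewrite [cov _ _ _]covU mact_r1 mact_l1.
Qed.

End BraidedDifferentials.

Lemma linearize_sumMz (K : choiceType) (M : zmodType) (I : finType) (f : K -> M)
    (z : I -> {malg int[K]}) n :
  linearize f (\sum_i z i *~ n i) = \sum_i linearize f (z i) *~ n i.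
Proof. by rewrite raddf_sum; apply: eq_bigr => i _; rewrite /= linearizeMz. Qed.

Lemma linearize_if (K : choiceType) (M : zmodType) (f : K -> M) (b : bool) w :
  linearize f (if b then 0 else << w >>) = if b then 0 else f w.
Proof. by case: b; rewrite ?raddf0 // linearizeU. Qed.

Lemma sym_chain (X : choiceType) (sigma : X * X -> X * X) (M : zmodType)
    (BS : mon_bimodule (struct_monoid sigma) M) k (c : {malg M[k.-tuple X]}) :
  chainM BS (@qs _ sigma _ (gen (struct_rel sigma)) k) c =
  id_tensor (quantum_sym sigma (k := k)) c.
Proof.
apply: eq_bigr => w _; rewrite act_qs quantum_symU tensE.
by rewrite linearize_sum.
Qed.

(** The unreduced sum keeps the tuples with a unit that the reduced symmetrizer drops; the two agree
    in the normalized quotient. *)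
Lemma red_sym_chain (X : choiceType) (sigma : X * X -> X * X) (M : zmodType) e
    (BS : mon_bimodule (red_struct_monoid sigma e) M) k
    (c : {malg M[k.-tuple X]}) :
  chainM BS (@qs _ sigma _ (gen (red_struct_rel sigma e)) k) c -
  id_tensor (red_quantum_sym sigma e (k := k)) c
    \in badsupp (@bar_bad (red_struct_monoid sigma e) true k).
Proof.
rewrite -sumrB; apply: rpred_sum => w _.
rewrite act_qs red_quantum_symU tensE linearize_sumMz -sumrB.
apply: rpred_sum => s _; rewrite -mulrzBl; apply: rpredMz.
rewrite linearize_if; case: ifP => [t1|_]; last by rewrite subrr rpred0.
by rewrite subr0; apply: badsuppU.
Qed.

Lemma sym_cochain (X : choiceType) (sigma : X * X -> X * X) (M : zmodType)
    (BS : mon_bimodule (struct_monoid sigma) M) k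
    (f : k.-tuple (struct_monoid sigma) -> M) :
  cochM BS (@qs _ sigma _ (gen (struct_rel sigma)) k) f =
  precomp (quantum_sym sigma (k := k)) f.
Proof.
apply/funext => w; rewrite /cochM cov_qs /precomp quantum_symU.
by rewrite linearize_sum.
Qed.

(** On a cochain that vanishes at tuples with a unit, dropping these tuples changes no value. *)
Lemma red_sym_cochain (X : choiceType) (sigma : X * X -> X * X) (M : zmodType) e
    (BS : mon_bimodule (red_struct_monoid sigma e) M) k
    (f : k.-tuple (red_struct_monoid sigma e) -> M) :
  (forall w, bar_bad true w -> f w = 0) ->
  cochM BS (@qs _ sigma _ (gen (red_struct_rel sigma e)) k) f =
  precomp (red_quantum_sym sigma e (k := k)) f.
Proof.
move=> f0; apply/funext => w; rewrite /cochM cov_qs /precomp red_quantum_symU.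
rewrite linearize_sumMz; apply: eq_bigr => s _; rewrite linearize_if.
by case: ifP => // t1; rewrite f0.
Qed.

(** * The symmetrizer as a quasi-isomorphism, for any admissible [E] and [norm] *)

Section Comparison.
Variables (X : choiceType) (sigma : X * X -> X * X).
Hypothesis sigma_braided : braided sigma.
Hypothesis sigma_idem : forall p, sigma (sigma p) = sigma p.
Variable E : pred X.
Hypothesis E_sigma : forall e, E e -> forall x,
  sigma (e, x) \in [:: (e, x); (x, e)] /\ sigma (x, e) \in [:: (e, x); (x, e)].
Hypothesis E_normal : forall e, E e ->
  forall u v, normal_word sigma (u ++ e :: v) -> normal_word sigma (u ++ v).
Variable R : seq X -> seq X -> Prop.
Hypothesis R_def : forall u v,
  R u v <-> struct_rel sigma u v \/ (exists2 e, E e & u = [:: e] /\ v = [::]).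
Variable norm : bool.
Hypothesis E_norm : forall e, E e -> norm.
Variables (M : zmodType) (B : bimodule sigma M).
Local Notation S := (presented R).
Variable BS : mon_bimodule S M.
Hypothesis BS_r : forall m x, mact_r BS m (gen R x) = bact_r B m x.
Hypothesis BS_l : forall x m, mact_l BS (gen R x) m = bact_l B x m.
Local Notation tX := (fun k => (k.-tuple X : choiceType)).
Local Notation tS := (fun k => (k.-tuple S : choiceType)).
Local Notation noncrit := (@noncrit X sigma E).
Local Notation braid_d := (@braid_d X sigma S (gen R)).
Local Notation bar_bad := (@bar_bad S norm).
Local Notation qs := (@qs X sigma S (gen R)).

Let resX :=
  braid_resolution sigma_braided sigma_idem E_sigma E_normal R_def E_norm.
Let resS := bar_resolution S norm.
Let homq := qs_hom sigma_braided sigma_idem E_sigma E_normal R_def E_norm.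

Lemma qs_quasi_iso (C D : chain_seq)
    (piC : forall k, {additive {malg M[tX k]} -> C k})
    (piD : forall k, {additive {malg M[tS k]} -> D k}) :
  chain_pres BS (K := tX) noncrit braid_d piC ->
  chain_pres BS (K := tS) bar_bad (@bar_d S) piD ->
  exists F : chain_map C D,
    (forall k c, F k (piC k c) = piD k (chainM BS (@qs k) c)) /\ quasi_iso F.
Proof.
move=> presC presD; have [F FP] := pres_map_exists presC presD homq.
exists F; split=> //.
exact: (pres_quasi_iso resX resS [tuple] homq (@qs_aug _ _ _) presC presD FP).
Qed.

Lemma qs_co_quasi_iso (C D : cochain_seq)
    (iC : forall k, {additive C k -> (tX k -> M)})
    (iD : forall k, {additive D k -> (tS k -> M)}) :
  cochain_pres BS (K := tX) noncrit braid_d iC ->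
  cochain_pres BS (K := tS) bar_bad (@bar_d S) iD ->
  exists F : cochain_map D C,
    (forall k x, iC k (F k x) = cochM BS (@qs k) (iD k x)) /\ co_quasi_iso F.
Proof.
move=> presC presD; have [F FP] := pres_comap_exists presC presD homq.
exists F; split=> //.
exact:
  (pres_co_quasi_iso resX resS [tuple] homq (@qs_aug _ _ _) presC presD FP).
Qed.

Variable T : forall k, set {malg int[k.-tuple X]}.
Hypothesis TE : forall k t, @T k t <-> t \in badsupp (@noncrit k).

Lemma crit_subE k (c : {malg M[k.-tuple X]}) :
  (c \in crit_sub B T k) = (c \in badsupp (@noncrit k)).
Proof.
apply: gen_subgroup_bad => [_ [m [t [/TE tN ->]]]|m w wN].
  by rewrite tensE; apply: badsupp_linearize tN => w wN; exact: badsuppU.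
by exists m, << w >>; rewrite tensU; split=> //; apply/TE/badsuppU.
Qed.

Let d_null k (w : k.+1.-tuple X) : noncrit w -> braid_d w \in null (@noncrit k).
Proof.
exact: (braid_d_null sigma_braided sigma_idem E_sigma E_normal R_def E_norm).
Qed.

Lemma crit_sub_stable : chain_stable (crit_sub B T).
Proof.
exact: (quot_chain_stable (K := tX) d_null (braid_diffE BS_r BS_l) crit_subE).
Qed.

Lemma crit_chain_pres (hC : chain_stable (crit_sub B T)) :
  chain_pres BS (K := tX) noncrit braid_d (C := crit_chain hC)
    (fun k => \pi_{ideal_quot crit_sub B T k}).
Proof.
exact: (quot_chain_pres (K := tX) (braid_diffE BS_r BS_l) crit_subE).
Qed.

Lemma crit_cosubP k (f : k.-tuple X -> M) :
  reflect (forall w, noncrit w -> f w = 0) (f \in crit_cosub B T k).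
Proof. exact: lin_vanish_bad. Qed.

Lemma crit_cosub_stable : cochain_stable (crit_cosub B T).
Proof.
exact: (sub_cochain_stable (K := tX) d_null (braid_codiffE BS_r BS_l)
  crit_cosubP).
Qed.

Lemma crit_cochain_pres (hC : cochain_stable (crit_cosub B T)) :
  cochain_pres BS (K := tX) noncrit braid_d (D := crit_cochain hC)
    (fun k => val).
Proof.
exact: (sub_cochain_pres (K := tX) (braid_codiffE BS_r BS_l) crit_cosubP).
Qed.

End Comparison.

Section HochschildComplexes.
Variables (S : monoidType) (M : zmodType) (BS : mon_bimodule S M).
Local Notation tS := (fun k => (k.-tuple S : choiceType)).

Lemma hoch_chain_pres :
  chain_pres BS (K := tS) (@bar_bad S false) (@bar_d S)
    (C := hoch_chain BS) (fun k => idfun).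
Proof. by apply: (free_chain_pres (K := tS) (hoch_diffE BS)). Qed.

Lemma hoch_cochain_pres :
  cochain_pres BS (K := tS) (@bar_bad S false) (@bar_d S)
    (D := hoch_cochain BS) (fun k => idfun).
Proof. by apply: (free_cochain_pres (K := tS) (hoch_codiffE BS)). Qed.

Lemma unit_chainsE k (c : {malg M[k.-tuple S]}) :
  (c \in unit_chains BS k) = (c \in badsupp (@bar_bad S true k)).
Proof.
apply: gen_subgroup_bad => [_ [m [s [s1 ->]]]|m s s1]; first exact: badsuppU.
by exists m, s.
Qed.

Lemma unit_chains_stable : chain_stable (unit_chains BS).
Proof.
exact: (quot_chain_stable (K := tS) (@bar_d_null S true) (hoch_diffE BS)
  unit_chainsE).
Qed.

Lemma norm_hoch_chain_pres (h : chain_stable (unit_chains BS)) :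
  chain_pres BS (K := tS) (@bar_bad S true) (@bar_d S) (C := norm_hoch_chain h)
    (fun k => \pi_{ideal_quot unit_chains BS k}).
Proof. exact: (quot_chain_pres (K := tS) (hoch_diffE BS) unit_chainsE). Qed.

Lemma norm_cochainsP k (f : k.-tuple S -> M) :
  reflect (forall s, bar_bad true s -> f s = 0) (f \in norm_cochains BS k).
Proof. exact: asboolP. Qed.

Lemma norm_cochains_stable : cochain_stable (norm_cochains BS).
Proof.
exact: (sub_cochain_stable (K := tS) (@bar_d_null S true) (hoch_codiffE BS)
  norm_cochainsP).
Qed.

Lemma norm_hoch_cochain_pres (h : cochain_stable (norm_cochains BS)) :
  cochain_pres BS (K := tS) (@bar_bad S true) (@bar_d S)
    (D := norm_hoch_cochain h) (fun k => val).
Proof.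
exact: (sub_cochain_pres (K := tS) (hoch_codiffE BS) norm_cochainsP).
Qed.

End HochschildComplexes.

Section StructureBimodules.
Variables (X : choiceType) (sigma : X * X -> X * X).
Variables (M : zmodType) (B : bimodule sigma M).

Lemma struct_bimodule_r m x :
  mact_r (struct_bimodule B) m (gen (struct_rel sigma) x) = bact_r B m x.
Proof. exact: (pact_r_pi (struct_rel_r B) m [:: x]). Qed.

Lemma struct_bimodule_l x m :
  mact_l (struct_bimodule B) (gen (struct_rel sigma) x) m = bact_l B x m.
Proof. exact: (pact_l_pi (struct_rel_l B) m [:: x]). Qed.

Variables (e : X) (triv : acts_trivially B e).

Lemma red_struct_bimodule_r m x :
  mact_r (red_struct_bimodule triv) m (gen (red_struct_rel sigma e) x) =
  bact_r B m x.
Proof. exact: (pact_r_pi (red_struct_rel_r triv) m [:: x]). Qed.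

Lemma red_struct_bimodule_l x m :
  mact_l (red_struct_bimodule triv) (gen (red_struct_rel sigma e) x) m =
  bact_l B x m.
Proof. exact: (pact_l_pi (red_struct_rel_l triv) m [:: x]). Qed.

End StructureBimodules.

(** * The structure monoid: [E] empty, bar complex not normalized *)

Section Plain.
Variables (X : choiceType) (sigma : X * X -> X * X).
Hypothesis sigma_braided : braided sigma.
Hypothesis sigma_idem : forall p, sigma (sigma p) = sigma p.
Variables (M : zmodType) (B : bimodule sigma M).

Let E_sigma : forall e, pred0 e -> forall x,
  sigma (e, x) \in [:: (e, x); (x, e)] /\ sigma (x, e) \in [:: (e, x); (x, e)].
Proof. by []. Qed.
Let E_normal : forall e, pred0 e ->
  forall u v, normal_word sigma (u ++ e :: v) -> normal_word sigma (u ++ v).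
Proof. by []. Qed.
Let R_def u v : struct_rel sigma u v <->
  struct_rel sigma u v \/ (exists2 e, pred0 e & u = [:: e] /\ v = [::]).
Proof. by split=> [|[//|[]//]]; left. Qed.
Let E_norm : forall e : X, pred0 e -> false. Proof. by []. Qed.
Let BS := struct_bimodule B.
Let BS_r := struct_bimodule_r B.
Let BS_l := struct_bimodule_l B.
Let TE := @TminusE X sigma.

Lemma quantum_sym_quasi_iso :
  exists (hC : chain_stable (crit_sub B (Tminus sigma)))
         (F : chain_map (crit_chain hC) (hoch_chain (struct_bimodule B))),
    (forall k (c : {malg M[k.-tuple X]}),
      F k (quot_proj hC c) = id_tensor (quantum_sym sigma (k := k)) c) /\
    quasi_iso F.
Proof.
have hC := crit_sub_stable sigma_braided sigma_idem E_sigma E_normal R_def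
  E_norm BS_r BS_l TE.
exists hC.
have [F [FP qF]] := qs_quasi_iso sigma_braided sigma_idem E_sigma E_normal R_def
  E_norm (crit_chain_pres BS_r BS_l TE hC) (hoch_chain_pres BS).
exists F; split=> // k c; rewrite -(sym_chain BS); exact: FP.
Qed.

Lemma quantum_sym_co_quasi_iso :
  exists (hC : cochain_stable (crit_cosub B (Tminus sigma)))
         (F : cochain_map (hoch_cochain (struct_bimodule B))
                          (crit_cochain hC)),
    (forall k (f : k.-tuple (struct_monoid sigma) -> M),
      sub_incl (F k f) = precomp (quantum_sym sigma (k := k)) f) /\
    co_quasi_iso F.
Proof.
have hC := crit_cosub_stable sigma_braided sigma_idem E_sigma E_normal R_def
  E_norm BS_r BS_l TE.
exists hC.
have [F [FP qF]] := qs_co_quasi_iso sigma_braided sigma_idem E_sigma E_normal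
  R_def E_norm (crit_cochain_pres BS_r BS_l TE hC) (hoch_cochain_pres BS).
exists F; split=> // k f; rewrite -(sym_cochain BS); exact: FP.
Qed.

End Plain.

(** * The reduced structure monoid: [E] is the pseudo-unit, bar complex normalized *)

Section Reduced.
Variables (X : choiceType) (sigma : X * X -> X * X).
Hypothesis sigma_braided : braided sigma.
Hypothesis sigma_idem : forall p, sigma (sigma p) = sigma p.
Variables (M : zmodType) (B : bimodule sigma M).
Variables (e : X) (e_unit : pseudo_unit sigma e) (e_triv : acts_trivially B e).

Let E_sigma e' : pred1 e e' -> forall x,
  sigma (e', x) \in [:: (e', x); (x, e')] /\
  sigma (x, e') \in [:: (e', x); (x, e')].
Proof. by move=> /eqP->; exact: e_unit.1. Qed.
Let E_normal e' : pred1 e e' ->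
  forall u v, normal_word sigma (u ++ e' :: v) -> normal_word sigma (u ++ v).
Proof. by move=> /eqP->; exact: e_unit.2. Qed.
Let R_def u v : red_struct_rel sigma e u v <->
  struct_rel sigma u v \/ (exists2 e', pred1 e e' & u = [:: e'] /\ v = [::]).
Proof.
split=> [[]|[|[_ /eqP->]]]; try by [left|right].
by move=> uv; right; exists e => /=.
Qed.
Let E_norm e' : pred1 e e' -> true. Proof. by []. Qed.
Let BS := red_struct_bimodule e_triv.
Let BS_r := red_struct_bimodule_r e_triv.
Let BS_l := red_struct_bimodule_l e_triv.
Let TE := @TunitE X sigma e.

Lemma red_quantum_sym_quasi_iso :
  exists (hC : chain_stable (crit_sub B (Tunit sigma e)))
         (hH : chain_stable (unit_chains (red_struct_bimodule e_triv)))
         (F : chain_map (crit_chain hC) (norm_hoch_chain hH)),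
    (forall k (c : {malg M[k.-tuple X]}),
      F k (quot_proj hC c) =
      quot_proj hH (id_tensor (red_quantum_sym sigma e (k := k)) c)) /\
    quasi_iso F.
Proof.
have hC := crit_sub_stable sigma_braided sigma_idem E_sigma E_normal R_def
  E_norm BS_r BS_l TE.
have hH := @unit_chains_stable _ _ BS.
exists hC, hH.
have [F [FP qF]] := qs_quasi_iso sigma_braided sigma_idem E_sigma E_normal R_def
  E_norm (crit_chain_pres BS_r BS_l TE hC) (norm_hoch_chain_pres hH).
exists F; split=> // k c; apply: etrans (FP k c) _; apply/eqP.
by rewrite -Quotient.idealrBE unit_chainsE; exact: red_sym_chain.
Qed.

Lemma red_quantum_sym_co_quasi_iso :
  exists (hC : cochain_stable (crit_cosub B (Tunit sigma e)))
         (hH : cochain_stable (norm_cochains (red_struct_bimodule e_triv)))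
         (F : cochain_map (norm_hoch_cochain hH) (crit_cochain hC)),
    (forall k (f : norm_hoch_cochain hH k),
      sub_incl (F k f) =
      precomp (red_quantum_sym sigma e (k := k)) (sub_incl f)) /\
    co_quasi_iso F.
Proof.
have hC := crit_cosub_stable sigma_braided sigma_idem E_sigma E_normal R_def
  E_norm BS_r BS_l TE.
have hH := @norm_cochains_stable _ _ BS.
exists hC, hH.
have [F [FP qF]] := qs_co_quasi_iso sigma_braided sigma_idem E_sigma E_normal
  R_def E_norm (crit_cochain_pres BS_r BS_l TE hC) (norm_hoch_cochain_pres hH).
exists F; split=> // k f; rewrite -(red_sym_cochain BS); first exact: FP.
exact/norm_cochainsP/(valP f).
Qed.

End Reduced.

Theorem theorem6 (X : choiceType) (sigma : X * X -> X * X)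
    (sigma_braided : braided sigma)
    (sigma_idem : forall p, sigma (sigma p) = sigma p)
    (M : zmodType) (B : bimodule sigma M) :
  [/\ (* QS_k : CrC_k(X, sigma; M) -> HC_k(M(X, sigma); M) *)
      exists (hC : chain_stable (crit_sub B (Tminus sigma)))
             (F : chain_map (crit_chain hC) (hoch_chain (struct_bimodule B))),
        (forall k (c : {malg M[k.-tuple X]}),
          F k (quot_proj hC c) = id_tensor (quantum_sym sigma (k := k)) c) /\
        quasi_iso F,
      (* QS_*^k : HC^k(M(X, sigma); M) -> CrC^k(X, sigma; M) *)
      exists (hC : cochain_stable (crit_cosub B (Tminus sigma)))
             (F : cochain_map (hoch_cochain (struct_bimodule B))
                              (crit_cochain hC)),
        (forall k (f : k.-tuple (struct_monoid sigma) -> M),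
          sub_incl (F k f) = precomp (quantum_sym sigma (k := k)) f) /\
        co_quasi_iso F
    & forall (e : X) (e_unit : pseudo_unit sigma e)
             (e_triv : acts_trivially B e),
      (* the reduced symmetrizer, from CrC_k(X, sigma, e; M) to the normalized
         Hochschild chains of the reduced structure monoid *)
      (exists (hC : chain_stable (crit_sub B (Tunit sigma e)))
              (hH : chain_stable (unit_chains (red_struct_bimodule e_triv)))
              (F : chain_map (crit_chain hC) (norm_hoch_chain hH)),
        (forall k (c : {malg M[k.-tuple X]}),
          F k (quot_proj hC c) =
          quot_proj hH (id_tensor (red_quantum_sym sigma e (k := k)) c)) /\
        quasi_iso F) /\
      (* its dual, from the normalized Hochschild cochains of the reduced
         structure monoid to CrC^k(X, sigma, e; M) *)
      (exists (hC : cochain_stable (crit_cosub B (Tunit sigma e)))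
              (hH : cochain_stable (norm_cochains (red_struct_bimodule e_triv)))
              (F : cochain_map (norm_hoch_cochain hH) (crit_cochain hC)),
        (forall k (f : norm_hoch_cochain hH k),
          sub_incl (F k f) =
          precomp (red_quantum_sym sigma e (k := k)) (sub_incl f)) /\
        co_quasi_iso F)].
Proof.
split=> [||e e_unit e_triv].
- exact: quantum_sym_quasi_iso.
- exact: quantum_sym_co_quasi_iso.
split; first exact: red_quantum_sym_quasi_iso.
exact: red_quantum_sym_co_quasi_iso.
Qed.
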